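(* Consider the two-stage interacting tempering process $\{X_n,n\ge0\}$ with auxiliary process $\{Y_n,n\ge0\}$ described in the context. Assume: (I1) $\pi$ is a continuous positive density on $\mathsf{X}$ and $\|\pi\|_\infty<+\infty$; (I2)(a) $P$ is a $\pi$-irreducible aperiodic Feller transition kernel on $(\mathsf{X},\mathcal{X})$ such that $\pi P=\pi$; (I2)(b) there exist $\tau\in(0,1/T)$, $\lambda\in(0,1)$ and $b<+\infty$ such that $PW\le\lambda W+b$ with $W(x)=(\pi(x)/\|\pi\|_\infty)^{-\tau}$; (I2)(c) for every $p\in(0,\|\pi\|_\infty)$, the set $\{\pi\ge p\}$ is $1$-small for $P$; (I3)(a) $\theta_\star(W)<+\infty$ and for every continuous function $f$ with $\sup_x|f(x)|/W(x)<\infty$, $\theta_n(f)\to\theta_\star(f)$ almost surely; (I3)(b) $\sup_n\mathbb{E}[W(Y_n)]<+\infty$; and $\mathbb{E}[W(X_0)]<+\infty$. Then: (i) for every measurable set $A$ such that $\int_{\partial A}\pi\,d\mu=0$, where $\partial A$ is the boundary of $A$, $$\frac1n\sum_{k=0}^{n-1}\mathbf{1}_A(X_k)\to\int_A\pi\,d\mu\quad\text{a.s.};$$ (ii) for every $a\in(0,1)$ and every continuous function $f$ with $\sup_x|f(x)|/W^a(x)<\infty$, $$\frac1n\sum_{k=0}^{n-1}f(X_k)\to\int f\,\pi\,d\mu\quad\text{a.s.}$$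
   Context: $\mathsf{X}$ is a Polish space with Borel $\sigma$-field $\mathcal{X}$, $\pi$ is a probability density with respect to a measure $\mu$ on $(\mathsf{X},\mathcal{X})$; $\pi$ also denotes the distribution $\pi\,d\mu$. Fix $T>1$, $\upsilon\in(0,1)$, and a Markov kernel $P$ on $(\mathsf{X},\mathcal{X})$. $\Theta$ is the set of all probability measures on $(\mathsf{X},\mathcal{X})$. For $\theta\in\Theta$, $P_\theta(x,\cdot)=(1-\upsilon)P(x,\cdot)+\upsilon K_\theta(x,\cdot)$ with $$K_\theta(x,A)=\int_A\alpha(x,y)\theta(dy)+\mathbf{1}_A(x)\int\{1-\alpha(x,y)\}\theta(dy),\qquad \alpha(x,y)=1\wedge\frac{\pi^\beta(y)}{\pi^\beta(x)},\quad\beta=1-\frac1T .$$ $\theta_\star\in\Theta$ is the probability distribution with density with respect to $\mu$ proportional to $\pi^{1/T}$. $\{Y_n,n\ge0\}$ is an $\mathsf{X}$-valued process (not necessarily Markov) such that for every bounded continuous $f$, $n^{-1}\sum_{k=1}^nf(Y_k)\to\theta_\star(f)$ a.s. Let $\theta_n(f)=(n+1)^{-1}\sum_{k=0}^nf(Y_k)$. The process $\{X_n,n\ge0\}$ is such that $(X_n,\theta_n)$ is adapted to a filtration $\{\mathcal{F}_n\}$ and $\mathbb{E}[f(X_{n+1})\mid\mathcal{F}_n]=P_{\theta_n}f(X_n)$ for every $n\ge0$ and bounded measurable $f$. A kernel is Feller if it maps bounded continuous functions to bounded continuous functions. A set $C$ is $1$-small for a kernel $Q$ if there exist $\delta>0$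 and a probability measure $\nu$ with $Q(x,\cdot)\ge\delta\nu(\cdot)$ for all $x\in C$. *)

(* Defs.v *)
From HB Require Import structures.
From mathcomp Require Import all_boot all_order all_algebra.
From mathcomp Require Import all_classical all_reals all_analysis.
From mathcomp Require Import measurable_realfun.

Set Implicit Arguments.
Unset Strict Implicit.
Unset Printing Implicit Defensive.

Import Order.TTheory GRing.Theory Num.Def Num.Theory.
Import numFieldNormedType.Exports.

Local Open Scope classical_set_scope.
Local Open Scope ring_scope.

HB.mixin Record isBorel (d : measure_display) T
    & Topological T & Measurable d T := {
  measurable_borelE : @measurable d T = <<s @open T >>
}.

#[short(type="borelType")]
HB.structure Definition Borel (d : measure_display) :=
  {T of PointedTopological T & Measurable d T & isBorel d T}.

Definition complete_metric_for (R : realType) (T : topologicalType)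
    (dist : T -> T -> R) : Prop :=
  [/\ forall x y, dist x y = 0 <-> x = y,
      forall x y, dist x y = dist y x,
      forall x y z, dist x z <= dist x y + dist y z,
      forall x (A : set T),
        nbhs x A <-> exists2 e, 0 < e & [set y | dist x y < e] `<=` A &
      forall u : nat -> T,
        (forall e, 0 < e ->
           exists N, forall m n, (N <= m)%N -> (N <= n)%N ->
             dist (u m) (u n) < e) ->
        exists l : T, u @ \oo --> l].

Definition polish (R : realType) (T : topologicalType) : Prop :=
  (exists2 D : set T, countable D & dense D) /\
  (exists dist : T -> T -> R, complete_metric_for dist).

Definition boundary (T : topologicalType) (A : set T) : set T :=
  closure A `\` interior A.

Section functions.
Context (R : realType) (T : Type).

(* [sup] returns 0 on unbounded sets: only meaningful under [is_bounded f]. *)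
Definition sup_norm (f : T -> R) : R := sup (range (fun x => `|f x|)).

Definition is_bounded (f : T -> R) : Prop :=
  has_ubound (range (fun x => `|f x|)).

Definition finite_weighted_norm (V f : T -> R) : Prop :=
  has_ubound (range (fun x => `|f x| / V x)).

End functions.

Definition drift_function (R : realType) (T : Type) (p : T -> R) (tau : R)
    (x : T) : R := (p x / sup_norm p) `^ (- tau).

Section distributions.
Context d (X : measurableType d) (R : realType).
Local Open Scope ereal_scope.

Definition probability_density (mu : {measure set X -> \bar R})
    (p : X -> R) : Prop :=
  (forall x, 0 <= p x)%R /\ \int[mu]_x (p x)%:E = 1.

Definition density_distribution (mu : {measure set X -> \bar R})
    (p : X -> R) (A : set X) : \bar R :=
  \int[mu]_(x in A) (p x)%:E.

Definition has_density_proportional_to (mu : {measure set X -> \bar R})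
    (q : X -> R) (theta : probability X R) : Prop :=
  exists c : R, forall A, measurable A ->
    theta A = \int[mu]_(x in A) (c * q x)%:E.

End distributions.

Section markov_kernels.
Context d (X : measurableType d) (R : realType).
Implicit Types (Q : X -> {measure set X -> \bar R}) (phi : set X -> \bar R).

Definition kernel_act Q (f : X -> R) (x : X) : R := \int[Q x]_y f y.

Local Open Scope ereal_scope.

Fixpoint kernel_iter Q (n : nat) (x : X) (A : set X) : \bar R :=
  if n is n'.+1 then \int[Q x]_y kernel_iter Q n' y A else \d_x A.

Definition kernel_irreducible phi Q : Prop :=
  forall (x : X) (A : set X), measurable A -> 0 < phi A ->
    exists2 n, (0 < n)%N & 0 < kernel_iter Q n x A.

Definition cycle_of phi Q (m : nat) (D : nat -> set X) : Prop :=
  [/\ forall i, (i < m)%N -> measurable (D i),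
      trivIset `I_m D,
      forall i x, (i < m)%N -> D i x -> Q x (D (i.+1 %% m)%N) = 1 &
      phi (~` \bigcup_(i in `I_m) D i) = 0].

(* Meyn and Tweedie: the period of an irreducible kernel is the largest length
   of a cycle, and the kernel is aperiodic if this length is 1; [phi] is meant
   to be an irreducibility measure of [Q]. *)
Definition kernel_aperiodic phi Q : Prop :=
  forall (m : nat) (D : nat -> set X), cycle_of phi Q m D -> (m <= 1)%N.

Definition kernel_invariant Q (mu : {measure set X -> \bar R}) (p : X -> R) : Prop :=
  forall A, measurable A ->
    \int[mu]_x (Q x A * (p x)%:E) = density_distribution mu p A.

Definition one_small Q (C : set X) : Prop :=
  exists2 delta : R, (0 < delta)%R &
  exists nu : probability X R, forall x, C x ->
    forall A, measurable A -> delta%:E * nu A <= Q x A.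

End markov_kernels.

Definition kernel_feller d (X : borelType d) (R : realType)
    (Q : X -> {measure set X -> \bar R}) : Prop :=
  forall f : X -> R, continuous f -> is_bounded f ->
    continuous (kernel_act Q f) /\ is_bounded (kernel_act Q f).

Section empirical.
Context d (X : measurableType d) (R : realType) (y : nat -> X) (n : nat).

Definition empirical_mean (f : X -> R) : R :=
  n.+1%:R^-1 * \sum_(k < n.+1) f (y k).

Definition empirical : set X -> \bar R :=
  mscale (n.+1%:R^-1)%:nng (msum (fun k => \d_(y k)) n.+1).

HB.instance Definition _ := Measure.on empirical.

Let empirical_setT : empirical setT = 1%E.
Proof.
have -> : empirical setT = ((n.+1%:R^-1)%:E * \sum_(k < n.+1) 1)%E.
  by congr (_ * _)%E; apply: eq_bigr => k _; rewrite /= diracT.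
by rewrite sumEFin sumr_const card_ord -EFinM mulVf.
Qed.

HB.instance Definition _ :=
  Measure_isProbability.Build _ _ _ empirical empirical_setT.

End empirical.

Section tempering_kernel.
Context d (X : measurableType d) (R : realType).
Variables (upsilon : {i01 R}) (P : R.-pker X ~> X).
Variables (p : {mfun X >-> R}) (beta : R).
Implicit Types (theta : probability X R) (x : X).

Definition acceptance x (y : X) : R :=
  minr 1 ((p y `^ beta) / (p x `^ beta)).

Let measurable_acceptance x : measurable_fun setT (acceptance x).
Proof.
apply: measurable_minr => //; apply: measurable_funM => //.
exact: (measurableT_comp (@measurable_powR R beta)).
Qed.

Let acceptance_ge0 x y : 0 <= acceptance x y.
Proof. by rewrite le_min ler01 divr_ge0 ?powR_ge0. Qed.

Let acceptance_le1 x y : acceptance x y <= 1.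
Proof. by rewrite ge_min lexx. Qed.

Local Open Scope ereal_scope.

Definition exchange_kernel theta x (A : set X) : \bar R :=
  \int[theta]_(y in A) (acceptance x y)%:E +
  \d_x A * \int[theta]_y (1 - acceptance x y)%:E.

Section exchange_measure.
Variables (theta : probability X R) (x : X).

Let rejection := \int[theta]_y (1 - acceptance x y)%:E.

Let rejection_ge0 : 0 <= rejection.
Proof. by apply: integral_ge0 => y _; rewrite lee_fin subr_ge0. Qed.

Let exchange0 : exchange_kernel theta x set0 = 0.
Proof. by rewrite /exchange_kernel integral_set0 measure0 mul0e adde0. Qed.

Let exchange_ge0 A : 0 <= exchange_kernel theta x A.
Proof.
apply: adde_ge0; first by apply: integral_ge0 => y _; rewrite lee_fin.
by apply: mule_ge0.
Qed.

Let exchange_semi_sigma_additive :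
  semi_sigma_additive (exchange_kernel theta x).
Proof.
move=> F mF tF mUF.
rewrite /exchange_kernel.
rewrite [X in X @ _ --> _](_ : _ = (fun n =>
   \sum_(0 <= i < n) \int[theta]_(y in F i) (acceptance x y)%:E +
   (\sum_(0 <= i < n) \d_x (F i)) * rejection)); last first.
  apply/funext => n; rewrite big_split/=; congr (_ + _).
  by rewrite ge0_sume_distrl.
have rfin : rejection \is a fin_num.
  rewrite ge0_fin_numE//; apply: (@le_lt_trans _ _ (\int[theta]_y 1)).
    apply: ge0_le_integral => //.
    - by move=> y _; rewrite lee_fin subr_ge0.
    - by apply/measurable_EFinP; apply: measurable_funB.
    - by move=> y _; rewrite lee_fin lerBlDr lerDl.
  rewrite integral_cst// mul1e.
  by apply: (@le_lt_trans _ _ 1); [exact: probability_le1 | exact: ltry].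
apply: cvgeD.
- apply: ge0_adde_def; rewrite inE.
    by apply: integral_ge0 => y _; rewrite lee_fin.
  by apply: mule_ge0.
- apply: semi_sigma_additive_nng_induced => //.
    exact/measurable_EFinP.
  by move=> y; rewrite lee_fin.
- by apply: cvgeZr => //; exact: measure_semi_sigma_additive.
Qed.

HB.instance Definition _ := isMeasure.Build _ _ _ (exchange_kernel theta x)
  exchange0 exchange_ge0 exchange_semi_sigma_additive.

End exchange_measure.

Definition tempering_kernel theta x : set X -> \bar R :=
  measure_add (mscale (1 - upsilon%:num)%:nng%R (P x))
              (mscale upsilon%:num%:nng%R (exchange_kernel theta x)).

HB.instance Definition _ theta x := Measure.on (tempering_kernel theta x).

Lemma tempering_kernelE theta x A :
  tempering_kernel theta x A =
  (1 - upsilon%:num)%R%:E * P x A +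
  (upsilon%:num)%R%:E * exchange_kernel theta x A.
Proof. by rewrite /tempering_kernel measure_addE. Qed.

End tempering_kernel.

Section conditioning.
Context dO (Omega : measurableType dO) (R : realType) (Pr : probability Omega R).

(* For maps into [pprobability], the target sigma-algebra is the one generated
   by the evaluations [mu |-> mu A], [A] measurable. *)
Definition measurable_wrt (G : set (set Omega)) d' (T : measurableType d')
    (Z : Omega -> T) : Prop :=
  forall B, measurable B -> G (Z @^-1` B).

Definition filtration (F : nat -> set (set Omega)) : Prop :=
  [/\ forall n, sigma_algebra setT (F n),
      forall n, F n `<=` measurable &
      forall n, F n `<=` F n.+1].

Definition is_conditional_expectation (G : set (set Omega))
    (Z V : Omega -> R) : Prop :=
  [/\ measurable_wrt G V,
      Pr.-integrable setT (EFin \o V) &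
      forall B, G B ->
        (\int[Pr]_(w in B) (Z w)%:E = \int[Pr]_(w in B) (V w)%:E)%E].

End conditioning.

(* Main.v *)
Require Import Defs.
From HB Require Import structures.
From mathcomp Require Import all_boot all_order all_algebra.
From mathcomp Require Import all_classical all_reals all_analysis.
From mathcomp Require Import measurable_realfun ring lra.

Set Implicit Arguments.
Unset Strict Implicit.
Unset Printing Implicit Defensive.

Import Order.TTheory GRing.Theory Num.Def Num.Theory.
Import numFieldNormedType.Exports.

Local Open Scope classical_set_scope.
Local Open Scope ring_scope.

(** The whole argument runs through one kernel, the tempering kernel P* built
    with theta_star. It leaves the target pi invariant
    ([tempering_invariant]): P does by assumption, and relative to pi the
    measure theta_star has a density proportional to pi^-beta, so that
    alpha(x,y) theta_star(dy) becomes
    c min(pi(x)^-beta, pi(y)^-beta) pi(dy), which is symmetric in x and y.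
    Fix an exponent a < 1 and let V be the a-th power of the drift function W.
    Three facts give the law of large numbers for a bounded continuous f.

    - P* forgets its starting point geometrically fast: it inherits from P a
      drift towards the sublevel sets of V and a minorization on each of them,
      hence contracts a V-weighted oscillation ([harris_contraction]), and
      the m-th iterate of P* at f differs from the integral of f against pi by
      at most D rho^m V ([harris_iterates]).

    - Almost surely the time averages of V along the process stay bounded
      ([ae_power_average_bound]). The drift yields bounded first moments of W
      ([process_moment]). The power a < 1 leaves a moment of order 1/a > 1 for
      V, enough for a variance estimate of truncated martingale sums along the
      times 2^j; between these times the averages of a nonnegative function
      cannot grow by more than a factor 2.

    - The time averages of f - P* f along the process tend to 0, for every
      bounded continuous f. The increments f(X_(k+1)) - P_(theta_k) f(X_k) are
      bounded martingale increments, whose averages vanish ([bounded_lln]).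
      Moreover P_(theta_k) f tends to P* f uniformly on each sublevel set of V
      ([tempering_act_cvg_unif]): the acceptance probability sees its starting
      point x only through the number pi(x), so that the weak convergence of
      theta_k is needed only for a one-parameter Lipschitz family of test
      functions. Outside a sublevel set {V <= r} the process spends a fraction
      of time of order 1/r, by the second fact.

    Since P* is Feller, the third fact applies to all iterates of P* at f;
    summing, the averages of f minus the m-th iterate vanish for each m. The
    first two facts bound the averages of the m-th iterate minus its mean by a
    multiple of rho^m, and m is arbitrary ([bounded_continuous_lln]).

    Functions dominated by a smaller power of W are truncated, the error being
    controlled by the averages of V ([weighted_lln]); for sets with negligible
    boundary the indicator is squeezed between bounded continuous functions
    ([set_lln]). *)

(** * Extending identities from indicators to nonnegative functions *)

Section ge0_induction.
Import HBNNSimple.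

(** Induction along the usual construction of the integral: simple functions
    one level set at a time, then increasing limits. *)
Lemma ge0_measurable_fun_ind d (T : measurableType d) (R : realType)
    (Pr : (T -> \bar R) -> Prop) :
  Pr (fun=> 0%E) ->
  (forall (k : R) (A : set T) (g : T -> R), 0 <= k -> measurable A ->
    measurable_fun setT g -> (forall x, 0 <= g x) ->
    Pr (EFin \o g) -> Pr (fun x => (k%:E * (\1_A x)%:E + (g x)%:E)%E)) ->
  (forall g : nat -> T -> R, (forall n, measurable_fun setT (g n)) ->
    (forall n x, 0 <= g n x) -> (forall x, nondecreasing_seq (g ^~ x)) ->
    (forall n, Pr (EFin \o g n)) -> Pr (fun x => limn (fun n => (g n x)%:E))) ->
  forall h : T -> \bar R, measurable_fun setT h -> (forall x, (0 <= h x)%E) ->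
  Pr h.
Proof.
move=> P0 PD Plim h mh h0.
pose g := nnsfun_approx measurableT mh.
rewrite (_ : h = fun x => limn (fun n => (g n x)%:E)); last first.
  apply/funext => x; apply/esym/cvg_lim => //.
  exact: (@cvg_nnsfun_approx _ _ _ _ measurableT _ mh (fun x _ => h0 x) x).
apply: Plim => [n|n x|x m n mn|n]; first exact/measurable_funTS.
- exact: fun_ge0.
- by have /lefP := @nd_nnsfun_approx _ _ _ _ measurableT _ mh m n mn; exact.
pose A (r : R) := g n @^-1` [set r].
have mA r : measurable (A r) by exact: measurable_sfunP.
pose G (s : seq R) x := \sum_(r <- s) r * \1_(A r) x.
have GP (s : seq R) : (forall r, r \in s -> 0 <= r) ->
    [/\ measurable_fun setT (G s), (forall x, 0 <= G s x) & Pr (EFin \o G s)].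
  elim: s => [_|r s ih rs].
    rewrite (_ : G [::] = cst 0); first by split.
    by apply/funext => x; rewrite /G big_nil.
  have r0 : 0 <= r by apply: rs; rewrite inE eqxx.
  have [|mG G0 PG] := ih; first by move=> t ts; apply: rs; rewrite inE ts orbT.
  have -> : G (r :: s) = fun x => r * \1_(A r) x + G s x.
    by apply/funext => x; rewrite /G big_cons.
  split.
  - by apply: measurable_funD => //; exact: measurable_funM.
  - by move=> x; rewrite addr_ge0// mulr_ge0// indicE.
  - by apply: PD.
rewrite (_ : EFin \o g n = EFin \o G (finmap.enum_fset (fset_set (range (g n))))).
  have [r|//] := GP (finmap.enum_fset (fset_set (range (g n)))).
  rewrite in_fset_set; last exact: fimfunP.
  by rewrite inE => -[x _ <-]; exact: fun_ge0.
apply/funext => x /=; rewrite fimfunE; congr EFin.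
by rewrite fsbig_finite//; exact: fimfunP.
Qed.

End ge0_induction.

(** The properties that make a functional on nonnegative measurable functions
    determined by its values at indicators; the integral against a measure is
    the model. Additivity is only asked in the shape used to build up simple
    functions. *)
Definition monotone_functional d (T : measurableType d) (R : realType)
    (I : (T -> \bar R) -> \bar R) : Prop := [/\
  I (fun=> 0%E) = 0%E,
  (forall g h : T -> R, measurable_fun setT g -> measurable_fun setT h ->
    (forall x, 0 <= g x <= h x) -> (I (EFin \o g) <= I (EFin \o h))%E),
  (forall (k : R) (A : set T) (g : T -> R), 0 <= k -> measurable A ->
    measurable_fun setT g -> (forall x, 0 <= g x) ->
    I (fun x => (k%:E * (\1_A x)%:E + (g x)%:E)%E)
      = (k%:E * I (EFin \o \1_A) + I (EFin \o g))%E) &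
  (forall g : nat -> T -> R, (forall n, measurable_fun setT (g n)) ->
    (forall n x, 0 <= g n x) -> (forall x, nondecreasing_seq (g ^~ x)) ->
    I (fun x => limn (fun n => (g n x)%:E)) = limn (fun n => I (EFin \o g n)))].

Lemma monotone_functional_ext d (T : measurableType d) (R : realType)
    (I J : (T -> \bar R) -> \bar R) :
  monotone_functional I -> monotone_functional J ->
  (forall A, measurable A -> I (EFin \o \1_A) = J (EFin \o \1_A)) ->
  forall h : T -> \bar R, measurable_fun setT h -> (forall x, (0 <= h x)%E) ->
  I h = J h.
Proof.
move=> [I0 _ ID Il] [J0 _ JD Jl] IJ; apply: ge0_measurable_fun_ind.
- by rewrite I0 J0.
- by move=> k A g k0 mA mg g0 IJg; rewrite ID// JD// IJ// IJg.
- by move=> g mg g0 ndg IJg; rewrite Il// Jl//; under eq_fun do rewrite IJg.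
Qed.

Lemma monotone_functional_eval d (T : measurableType d) (R : realType) (x : T) :
  monotone_functional (fun h : T -> \bar R => h x).
Proof. by split => // g h _ _ gh; rewrite lee_fin; have /andP[] := gh x. Qed.

(** Integrating a family of such functionals against a measure with a density
    gives another one. Evaluations yield integrals, and integrals
    against a kernel yield compositions. *)
Lemma monotone_functional_mix d d' (T : measurableType d)
    (T' : measurableType d') (R : realType)
    (m : {measure set T' -> \bar R}) (I : T' -> (T -> \bar R) -> \bar R)
    (q : T' -> R) :
  measurable_fun setT q -> (forall x, 0 <= q x) ->
  (forall x, monotone_functional (I x)) ->
  (forall h : T -> R, measurable_fun setT h -> (forall x, 0 <= h x) ->
    measurable_fun setT (fun x => I x (EFin \o h))) ->
  monotone_functional (fun h => \int[m]_x (I x h * (q x)%:E))%E.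
Proof.
move=> mq q0 mI mIh.
have mq' : measurable_fun setT (EFin \o q) by exact/measurable_EFinP.
have I0 (h : T -> R) x : measurable_fun setT h -> (forall y, 0 <= h y) ->
    (0 <= I x (EFin \o h))%E.
  move=> mh h0; have [I0 Ile _ _] := mI x.
  by rewrite -[leLHS]I0; apply: (Ile (cst 0)) => // y /=; rewrite lexx h0.
have mM (h : T -> R) : measurable_fun setT h -> (forall y, 0 <= h y) ->
    measurable_fun setT (fun x => I x (EFin \o h) * (q x)%:E)%E.
  by move=> mh h0; apply: emeasurable_funM => //; exact: mIh.
have M0 (h : T -> R) x : measurable_fun setT h -> (forall y, 0 <= h y) ->
    (0 <= I x (EFin \o h) * (q x)%:E)%E.
  by move=> mh h0; rewrite mule_ge0 ?lee_fin// I0.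
split.
- under eq_integral => x _ do have [-> _ _ _] := mI x.
  by under eq_integral do rewrite mul0e; rewrite integral0.
- move=> g h mg mh gh.
  have g0 x : 0 <= g x by have /andP[] := gh x.
  have h0 x : 0 <= h x by have /andP[_] := gh x; exact/le_trans.
  apply: ge0_le_integral => // [x _|||x _]; [exact: M0|exact: mM|exact: mM|].
  rewrite lee_wpmul2r ?lee_fin//; have [_ Ile _ _] := mI x; exact: Ile.
- move=> c A g c0 mA mg g0.
  under eq_integral => x _.
    have [_ _ ID _] := mI x.
    rewrite ID// ge0_muleDl//; last 2 first.
    - by rewrite mule_ge0// ?lee_fin// I0.
    - exact: I0.
    rewrite -muleA; over.
  rewrite ge0_integralD//; last 4 first.
  + by move=> x _; rewrite mule_ge0// ?lee_fin// M0.
  + by apply: measurable_funeM; exact: mM.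
  + by move=> x _; exact: M0.
  + exact: mM.
  by rewrite ge0_integralZl_EFin// => [x _|]; [exact: M0|exact: mM].
- move=> g mg g0 ndg.
  have ndI x : nondecreasing_seq (fun n => I x (EFin \o g n)).
    move=> a b ab; have [_ Ile _ _] := mI x; apply: Ile => // y.
    by rewrite g0 ndg.
  rewrite -monotone_convergence//.
  + apply: eq_integral => x _; have [_ _ _ Il] := mI x; rewrite Il//.
    under [in RHS]eq_fun do rewrite muleC.
    rewrite limeMl//; first exact: muleC.
    exact: ereal_nondecreasing_is_cvgn.
  + by move=> n; exact: mM.
  + by move=> n x _; exact: M0.
  + by move=> x _ a b ab; rewrite lee_wpmul2r// ?lee_fin//; exact: ndI.
Qed.

Lemma monotone_functional_density d (T : measurableType d) (R : realType)
    (m : {measure set T -> \bar R}) (q : T -> R) :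
  measurable_fun setT q -> (forall x, 0 <= q x) ->
  monotone_functional (fun h => \int[m]_x (h x * (q x)%:E))%E.
Proof.
move=> mq q0; apply: (@monotone_functional_mix _ _ T T R m (fun x h => h x)) => //.
  by move=> x; exact: monotone_functional_eval.
by move=> h mh _; exact/measurable_EFinP.
Qed.

Lemma monotone_functional_integral d (T : measurableType d) (R : realType)
    (m : {measure set T -> \bar R}) :
  monotone_functional (fun h => \int[m]_x h x)%E.
Proof.
have := @monotone_functional_density _ _ _ m (cst 1) (measurable_cst _)
  (fun=> ler01).
congr monotone_functional; apply/funext => h.
by apply: eq_integral => x _; rewrite mule1.
Qed.

Lemma integral_density d (T : measurableType d) (R : realType)
    (m nu : {measure set T -> \bar R}) (q : T -> R) :
  measurable_fun setT q -> (forall x, 0 <= q x) ->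
  (forall A, measurable A -> nu A = \int[m]_(x in A) (q x)%:E)%E ->
  forall h : T -> \bar R, measurable_fun setT h -> (forall x, (0 <= h x)%E) ->
  (\int[nu]_x h x = \int[m]_x (h x * (q x)%:E))%E.
Proof.
move=> mq q0 nuE; apply: monotone_functional_ext.
- exact: monotone_functional_integral.
- exact: monotone_functional_density.
- move=> A mA; rewrite integral_indic// setIT nuE// integral_mkcond.
  apply: eq_integral => x _; rewrite /patch/= indicE.
  by case: ifPn => _; rewrite ?mul1e ?mul0e.
Qed.

(** Invariance of a measure, stated on sets, extends to functions because both
    sides are monotone functionals. *)
Lemma integral_invariant d (T : measurableType d) (R : realType)
    (m : {measure set T -> \bar R}) (k : R.-pker T ~> T) :
  (forall A, measurable A -> \int[m]_x k x A = m A)%E ->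
  forall h : T -> \bar R, measurable_fun setT h -> (forall x, (0 <= h x)%E) ->
  (\int[m]_x \int[k x]_y h y = \int[m]_x h x)%E.
Proof.
move=> mk; apply: monotone_functional_ext; last first.
- by move=> A mA; rewrite integral_indic// setIT -mk//; apply: eq_integral => x _;
    rewrite integral_indic// setIT.
- exact: monotone_functional_integral.
have := @monotone_functional_mix _ _ T T R m (fun x h => \int[k x]_y h y)%E
  (cst 1) (measurable_cst _) (fun=> ler01).
rewrite (_ : (fun h => _) = (fun h => \int[m]_x \int[k x]_y h y)%E); last first.
  by apply/funext => h; apply: eq_integral => x _; rewrite mule1.
apply=> [x|h mh h0]; first exact: monotone_functional_integral.
apply: (measurable_fun_integral_kernel (measurable_kernel k)).
- by move=> x; rewrite lee_fin.
- exact/measurable_EFinP.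
Qed.

(** * Bounded integrands, almost sure convergence, conditional expectations *)

Lemma bounded_integrable d (T : measurableType d) (R : realType)
    (m : {measure set T -> \bar R}) (f : T -> R) (c : R) :
  m setT = 1%E -> measurable_fun setT f -> (forall x, `|f x| <= c) ->
  m.-integrable setT (EFin \o f).
Proof.
move=> m1 mf fc; apply: measurable_bounded_integrable => //.
  by rewrite m1 ltry.
exists c; split; first exact: num_real.
by move=> M cM x _ /=; apply: (le_trans (fc x)); exact: ltW.
Qed.

Lemma Rintegral_cst1 d (T : measurableType d) (R : realType)
    (m : {measure set T -> \bar R}) (c : R) :
  m setT = 1%E -> \int[m]_x c = c.
Proof. by move=> m1; rewrite Rintegral_cst// m1 mulr1. Qed.

Lemma Rintegral_bound d (T : measurableType d) (R : realType)
    (m : {measure set T -> \bar R}) (f : T -> R) (c : R) :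
  m setT = 1%E -> measurable_fun setT f -> (forall x, `|f x| <= c) ->
  `|\int[m]_x f x| <= c.
Proof.
move=> m1 mf fc; have intf := bounded_integrable m1 mf fc.
apply: (le_trans (le_normr_Rintegral measurableT intf)).
rewrite -[leRHS](Rintegral_cst1 c m1); apply: le_Rintegral => //.
- exact: integrable_norm.
- by apply: (@bounded_integrable _ _ _ _ _ `|c|) => //.
Qed.

Lemma EFin_Rintegral d (T : measurableType d) (R : realType)
    (m : {measure set T -> \bar R}) (f : T -> R) :
  m.-integrable setT (EFin \o f) ->
  (\int[m]_x f x)%:E = (\int[m]_x (f x)%:E)%E.
Proof. by move=> intf; rewrite /Rintegral fineK//; exact: integrable_fin_num. Qed.

(** The sum of the Z n has a finite integral, hence is finite almost everywhere,
    and the terms of a convergent series vanish. *)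
Lemma summable_ae_cvg0 d (T : measurableType d) (R : realType)
    (m : {measure set T -> \bar R}) (Z : nat -> T -> R) (u : nat -> R) (C : R) :
  (forall n, measurable_fun setT (Z n)) -> (forall n x, 0 <= Z n x) ->
  (forall n, \int[m]_x (Z n x)%:E <= (u n)%:E)%E ->
  (forall n, \sum_(k < n) u k <= C) ->
  {ae m, forall x, Z ^~ x @ \oo --> (0 : R)}.
Proof.
move=> mZ Z0 Zu uC.
have mZ' n : measurable_fun setT (EFin \o Z n) by exact/measurable_EFinP.
pose S x := (\sum_(n <oo) (Z n x)%:E)%E.
have intS : m.-integrable setT S.
  apply/integrableP; split.
    rewrite (_ : S = fun x => (\sum_(n <oo | n \in xpredT) (Z n x)%:E)%E).
      have := @ge0_emeasurable_sum _ T R setT (fun n x => (Z n x)%:E) xpredT.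
      move=> /(_ (fun k x _ _ => Z0 k x) (fun k _ => mZ' k)); exact.
    by apply/funext => x; exact: eq_eseriesl.
  rewrite (eq_integral S) => [|x _]; last first.
    by rewrite gee0_abs//; apply: nneseries_ge0 => k _ _; rewrite lee_fin.
  rewrite integral_nneseries//; last by move=> n x _; rewrite lee_fin.
  apply: (@le_lt_trans _ _ C%:E); last exact: ltry.
  apply: lime_le.
    by apply: is_cvg_nneseries => n _ _; apply: integral_ge0 => x _; rewrite lee_fin.
  apply: nearW => n; rewrite big_mkord.
  apply: (@le_trans _ _ (\sum_(k < n) (u k)%:E)%E); first exact: lee_sum.
  by rewrite sumEFin lee_fin.
have := integrable_ae measurableT intS; apply: filterS => x /(_ I) Sx.
apply: cvg_series_cvg_0; apply: nondecreasing_is_cvgn.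
  by apply/nondecreasing_seqP => n; rewrite !seriesEnat /= big_nat_recr//= lerDl.
exists (fine (S x)) => _ [n _ <-].
rewrite -lee_fin fineK// seriesEnat /= -sumEFin.
by apply: nneseries_lim_ge => k _; rewrite lee_fin.
Qed.

(** For fixed Z and V both sides are monotone functionals of H on the
    sub-sigma-algebra, and they agree on its indicators by definition of the
    conditional expectation. Adding the bounds of Z, V and H reduces to
    nonnegative functions. *)
Lemma conditional_expectation_pullout d (Omega : measurableType d)
    (R : realType) (Pr : probability Omega R) (G : set (set Omega))
    (Z V H : Omega -> R) (c c' : R) :
  sigma_algebra setT G -> G `<=` measurable ->
  is_conditional_expectation Pr G Z V ->
  measurable_fun setT Z -> (forall w, `|Z w| <= c) -> (forall w, `|V w| <= c) ->
  measurable_wrt G H -> (forall w, `|H w| <= c') ->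
  \int[Pr]_w (H w * Z w) = \int[Pr]_w (H w * V w).
Proof.
move=> sG Gm [GV iV ZV] mZ Zc Vc GH Hc'.
have Pr1 := @probability_setT _ _ _ Pr.
have mV : measurable_fun setT V by exact/measurable_EFinP/measurable_int/iV.
have mH : measurable_fun setT H.
  by move=> _ B mB; rewrite setTI; apply: Gm; exact: GH.
have mHG : measurable_fun (setT : set (g_sigma_algebraType G)) H.
  by move=> _ B mB; rewrite setTI; apply: sub_gen_smallest; exact: GH.
have ge0D (f : Omega -> R) (k : R) w : (forall w, `|f w| <= k) -> 0 <= f w + k.
  by move=> fk; have := fk w; rewrite ler_norml => /andP[]; lra.
pose I (U : Omega -> R) (h : Omega -> \bar R) := (\int[Pr]_w (h w * (U w + c)%:E))%E.
have mI (U : Omega -> R) : measurable_fun setT U -> (forall w, `|U w| <= c) ->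
    @monotone_functional _ (g_sigma_algebraType G) R (I U).
  move=> mU Uc.
  apply: (@monotone_functional_mix _ _ (g_sigma_algebraType G) Omega R Pr
    (fun w h => h w) (fun w => U w + c)).
  - exact: measurable_funD.
  - by move=> w; exact: ge0D.
  - by move=> w; exact: monotone_functional_eval.
  - move=> h mh _; apply/measurable_EFinP => _ B mB; rewrite setTI; apply: Gm.
    by rewrite -(sigma_algebra_id sG) -[_ @^-1` _]setTI; exact: mh.
have IE : I Z (fun w => (H w + c')%:E) = I V (fun w => (H w + c')%:E).
  apply: (monotone_functional_ext (mI _ mZ Zc) (mI _ mV Vc)).
  - move=> A; rewrite -[measurable A]/(<<s G >> A) sigma_algebra_id// => GA.
    have mA := Gm _ GA.
    have IA (U : Omega -> R) : measurable_fun setT U -> (forall w, `|U w| <= c) ->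
        (I U (EFin \o \1_A) = \int[Pr]_(w in A) (U w)%:E + c%:E * Pr A)%E.
      move=> mU Uc; rewrite -integral_cst// -integralD//; last 2 first.
      + by apply: integrableS (bounded_integrable Pr1 mU Uc).
      + exact: finite_measure_integrable_cst.
      rewrite [RHS]integral_mkcond; apply: eq_integral => w _.
      by rewrite /patch/= indicE; case: ifPn => _; rewrite ?mul1e ?mul0e ?EFinD.
    by rewrite !IA// ZV.
  - by apply/measurable_EFinP; exact: measurable_funD.
  - by move=> w; rewrite lee_fin; exact: ge0D.
have bM (f g : Omega -> R) (a b : R) : (forall w, `|f w| <= a) ->
    (forall w, `|g w| <= b) -> forall w, `|f w * g w| <= a * b.
  by move=> fa gb w; rewrite normrM ler_pM.
have expand (U : Omega -> R) : measurable_fun setT U -> (forall w, `|U w| <= c) ->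
    \int[Pr]_w ((H w + c') * (U w + c)) =
    \int[Pr]_w (H w * U w) + c * \int[Pr]_w H w + c' * \int[Pr]_w U w + c' * c.
  move=> mU Uc.
  have iU := bounded_integrable Pr1 mU Uc.
  have iH := bounded_integrable Pr1 mH Hc'.
  have iHU := bounded_integrable Pr1 (measurable_funM mH mU) (bM _ _ _ _ Hc' Uc).
  have icst (k : R) : Pr.-integrable setT (EFin \o cst k).
    by apply: (bounded_integrable Pr1 (c := `|k|)).
  transitivity (\int[Pr]_w (H w * U w + c * H w + c' * U w + c' * c)).
    by apply: eq_Rintegral => w _; ring.
  have icH : Pr.-integrable setT (EFin \o (fun w => c * H w)).
    exact: (integrableZl measurableT c iH).
  have icU : Pr.-integrable setT (EFin \o (fun w => c' * U w)).
    exact: (integrableZl measurableT c' iU).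
  rewrite RintegralD//; last 2 first.
  - exact: (integrableD measurableT (integrableD measurableT iHU icH) icU).
  - exact: (icst (c' * c)).
  rewrite RintegralD//; last exact: (integrableD measurableT iHU icH).
  by rewrite RintegralD// (Rintegral_cst1 (c' * c) Pr1) !RintegralZl.
have EUV : \int[Pr]_w Z w = \int[Pr]_w V w.
  by rewrite /Rintegral ZV//; case: sG => G0 GC _; rewrite -[setT]setD0; exact: GC.
have : \int[Pr]_w ((H w + c') * (Z w + c)) = \int[Pr]_w ((H w + c') * (V w + c)).
  by move: IE; rewrite /I /Rintegral => IE; congr fine.
by rewrite !expand// EUV; lra.
Qed.

(** * Contraction of a kernel with a drift and small level sets *)

Lemma ge0_integral_minorization d (T : measurableType d) (R : realType)
    (m n : {measure set T -> \bar R}) (delta : R) :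
  0 <= delta -> (forall A, measurable A -> delta%:E * m A <= n A)%E ->
  forall h : T -> \bar R, measurable_fun setT h -> (forall x, (0 <= h x)%E) ->
  (delta%:E * \int[m]_x h x <= \int[n]_x h x)%E.
Proof.
move=> delta0 mn; apply: ge0_measurable_fun_ind.
- by rewrite !integral0 mule0.
- move=> k A g k0 mA mg g0 ih.
  have mA' : measurable_fun setT (EFin \o \1_A : T -> \bar R).
    exact/measurable_EFinP.
  have split_int (mu : {measure set T -> \bar R}) :
      (\int[mu]_x (k%:E * (\1_A x)%:E + (g x)%:E)
        = k%:E * mu A + \int[mu]_x (g x)%:E)%E.
    have [_ _ -> //] := monotone_functional_integral mu.
    by rewrite integral_indic// setIT.
  rewrite !split_int ge0_muleDr//; last 2 first.
  + by rewrite mule_ge0.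
  + by apply: integral_ge0 => x _; rewrite lee_fin.
  by rewrite leeD// muleCA lee_wpmul2l// mn.
- move=> g mg g0 ndg ih.
  have lim_int (mu : {measure set T -> \bar R}) :
      (\int[mu]_x limn (fun n => (g n x)%:E) = limn (fun n => \int[mu]_x (g n x)%:E))%E.
    by have [_ _ _ -> //] := monotone_functional_integral mu.
  have ndi (mu : {measure set T -> \bar R}) :
      nondecreasing_seq (fun n => \int[mu]_x (g n x)%:E)%E.
    move=> a c ac; have [_ Ile _ _] := monotone_functional_integral mu.
    by apply: Ile => // x; rewrite g0 ndg.
  rewrite !lim_int -limeMl//; last exact: ereal_nondecreasing_is_cvgn.
  apply: lee_lim.
  + apply: ereal_nondecreasing_is_cvgn => a c ac.
    by rewrite lee_wpmul2l// ndi.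
  + exact: ereal_nondecreasing_is_cvgn.
  + by apply: nearW => p; exact: ih.
Qed.

Section harris.
Context d (T : measurableType d) (R : realType).
Variables (V : T -> R) (Q : T -> {measure set T -> \bar R}) (lambda b : R).
Hypotheses (mV : measurable_fun setT V) (V1 : forall x, 1 <= V x).
Hypothesis QT : forall x, Q x setT = 1%E.
Hypothesis drift : forall x,
  (\int[Q x]_y (V y)%:E <= (lambda * V x + b)%:E)%E.

Let V0 x : 0 <= V x.
Proof. exact: le_trans (V1 x). Qed.

Let intV x : (Q x).-integrable setT (EFin \o V).
Proof.
apply/integrableP; split; first exact/measurable_EFinP.
rewrite (eq_integral (EFin \o V)) => [|y _]; last by rewrite /= ger0_norm.
exact: le_lt_trans (drift x) (ltry _).
Qed.

Let QV x : \int[Q x]_y V y <= lambda * V x + b.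
Proof. by rewrite -lee_fin EFin_Rintegral. Qed.

Let integrable_weight (m : {measure set T -> \bar R}) (D kappa : R) :
  m setT = 1%E -> m.-integrable setT (EFin \o V) ->
  m.-integrable setT (EFin \o (fun y => D * (1 + kappa * V y))) /\
  \int[m]_y (D * (1 + kappa * V y)) = D * (1 + kappa * \int[m]_y V y).
Proof.
move=> m1 iV.
have icst (k : R) : m.-integrable setT (EFin \o cst k).
  by apply: (bounded_integrable m1 (c := `|k|)).
have ikV := integrableZl measurableT kappa iV.
have i1 := integrableD measurableT (icst 1) ikV.
split; first exact: (integrableZl measurableT D i1).
rewrite RintegralZl//; congr (_ * _).
by rewrite RintegralD//; [rewrite (Rintegral_cst1 1 m1) RintegralZl|exact: (icst 1)].
Qed.

(** Away from small sets only the drift helps: the weight of the envelope of f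
    around c shrinks under the kernel. *)
Lemma kernel_act_centre (f : T -> R) (c D kappa M : R) (x : T) :
  measurable_fun setT f -> (forall y, `|f y| <= M) ->
  (forall y, `|f y - c| <= D * (1 + kappa * V y)) -> 0 <= D -> 0 <= kappa ->
  `|kernel_act Q f x - c| <= D * (1 + kappa * (lambda * V x + b)).
Proof.
move=> mf fM fc D0 kappa0; have [iH IH] := integrable_weight D kappa (QT x) (intV x).
have if_ := bounded_integrable (QT x) mf fM.
have ic : (Q x).-integrable setT (EFin \o cst c).
  by apply: (bounded_integrable (QT x) (c := `|c|)).
have <- : \int[Q x]_y (f y - c) = kernel_act Q f x - c.
  by rewrite RintegralB// (Rintegral_cst1 c (QT x)).
have ig := integrableB measurableT if_ ic.
apply: (le_trans (le_normr_Rintegral measurableT ig)).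
apply: (@le_trans _ _ (\int[Q x]_y (D * (1 + kappa * V y)))).
  by apply: le_Rintegral => //; exact: integrable_norm.
by rewrite IH ler_wpM2l// lerD2l ler_wpM2l.
Qed.

(** On a small set the part delta nu of the kernel is common to all points:
    it contributes the constant e, and taking it out of the positive functions
    H - g and H + g lowers the envelope H of g = f - c by at least
    delta D. *)
Lemma kernel_act_centre_small (f : T -> R) (c D kappa M delta : R)
    (nu : probability T R) :
  measurable_fun setT f -> (forall y, `|f y| <= M) ->
  (forall y, `|f y - c| <= D * (1 + kappa * V y)) -> 0 <= D -> 0 <= kappa ->
  0 < delta ->
  exists e : R, forall x,
    (forall A, measurable A -> delta%:E * nu A <= Q x A)%E ->
    `|kernel_act Q f x - e| <= D * (1 - delta + kappa * (lambda * V x + b)).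
Proof.
move=> mf fM fc D0 kappa0 delta0.
exists (c + delta * \int[nu]_y (f y - c)) => x Qnu.
have nu1 : nu setT = 1%E by exact: probability_setT.
have low := ge0_integral_minorization (ltW delta0) Qnu.
have iVnu : nu.-integrable setT (EFin \o V).
  apply/integrableP; split; first exact/measurable_EFinP.
  rewrite (eq_integral (EFin \o V)) => [|y _]; last by rewrite /= ger0_norm.
  have := low (EFin \o V); rewrite -lee_pdivlMl//; move=> /(_ _ _)/le_lt_trans; apply.
  - exact/measurable_EFinP.
  - by move=> y; rewrite lee_fin.
  by rewrite -EFin_Rintegral// -EFinM ltry.
pose H y := D * (1 + kappa * V y).
pose g y := f y - c.
have [iHQ IHQ] := integrable_weight D kappa (QT x) (intV x).
have [iHnu IHnu] := integrable_weight D kappa nu1 iVnu.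
have ig (m : {measure set T -> \bar R}) : m setT = 1%E ->
    m.-integrable setT (EFin \o g) /\ \int[m]_y g y = \int[m]_y f y - c.
  move=> m1; have if_ := bounded_integrable m1 mf fM.
  have ic : m.-integrable setT (EFin \o cst c).
    by apply: (bounded_integrable m1 (c := `|c|)).
  split; first exact: (integrableB measurableT if_ ic).
  by rewrite RintegralB// (Rintegral_cst1 c m1).
have [igQ gQ] := ig _ (QT x); have [ignu _] := ig _ nu1.
have gH y : - H y <= g y <= H y by rewrite -ler_norml fc.
have key (s : R) : s = 1 \/ s = -1 ->
    delta * (\int[nu]_y H y + s * \int[nu]_y g y)
      <= \int[Q x]_y H y + s * \int[Q x]_y g y.
  move=> s1.
  have comb (m : {measure set T -> \bar R}) : m.-integrable setT (EFin \o H) ->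
      m.-integrable setT (EFin \o g) ->
      m.-integrable setT (EFin \o (fun y => H y + s * g y)) /\
      \int[m]_y (H y + s * g y) = \int[m]_y H y + s * \int[m]_y g y.
    move=> iH ig'; have isg := integrableZl measurableT s ig'.
    split; first exact: (integrableD measurableT iH isg).
    by rewrite RintegralD// RintegralZl.
  have [iQ <-] := comb _ iHQ igQ; have [inu <-] := comb _ iHnu ignu.
  rewrite -lee_fin EFinM !EFin_Rintegral//; apply: low.
  - exact: measurable_int iQ.
  - move=> y; rewrite lee_fin; have /andP[] := gH y.
    by case: s1 => ->; lra.
have Hnu1 : D <= \int[nu]_y H y.
  rewrite IHnu ler_peMr// lerDl mulr_ge0//; apply: Rintegral_ge0 => y _.
  exact: V0.
have HQ : \int[Q x]_y H y <= D * (1 + kappa * (lambda * V x + b)).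
  by rewrite IHQ ler_wpM2l// lerD2l ler_wpM2l.
have dH : delta * D <= delta * \int[nu]_y H y by rewrite ler_pM2l.
rewrite [X in X - _](_ : _ = \int[Q x]_y g y + c); last by rewrite gQ /kernel_act; lra.
have /(_ (or_introl erefl)) k1 := key 1.
have /(_ (or_intror erefl)) k2 := key (-1).
rewrite -/(g) in k1 k2 *.
rewrite ler_norml; apply/andP; split; nra.
Qed.

(** The contraction of Hairer and Mattingly for the weighted oscillation, that
    is the least D such that |f - c| <= D (1 + kappa V) for some constant c.
    For a pair of points, either V is large at one of them and the drift
    contracts, or both lie in a small set; a small kappa keeps the drift
    term from spoiling the gain of the minorization. A bound on all pairs then
    provides the new centre c'. *)
Lemma harris_contraction :
  0 <= lambda < 1 -> 0 <= b ->
  (forall r, 1 < r -> one_small Q [set x | V x <= r]) ->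
  exists kappa gamma : R, [/\ 0 < kappa, 0 <= gamma < 1 &
    forall (f : T -> R) (c D M : R), measurable_fun setT f ->
      (forall y, `|f y| <= M) -> 0 <= D ->
      (forall y, `|f y - c| <= D * (1 + kappa * V y)) ->
      exists c' : R, forall x,
        `|kernel_act Q f x - c'| <= gamma * D * (1 + kappa * V x)].
Proof.
move=> /andP[lam0 lam1] b0 small.
(* beyond level r the drift wins: lambda s + 2 b <= lam' s with lam' < 1 *)
have [r [r1 rb]] : exists r : R, 1 < r /\ 2 * b < (1 - lambda) * r.
  exists (2 + 2 * b / (1 - lambda)); split.
    have : 0 <= 2 * b / (1 - lambda) by rewrite divr_ge0//; lra.
    lra.
  rewrite mulrDr [X in _ < _ + X]mulrC divfK; last by rewrite gt_eqF//; lra.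
  lra.
have [delta delta0 [nu Qnu]] := small r r1.
(* chosen so that 2 kappa b <= delta *)
pose kappa := delta / (2 * b + 1).
have kappa0 : 0 < kappa by rewrite divr_gt0//; lra.
have kb : 2 * kappa * b <= delta.
  have : kappa * (2 * b + 1) = delta by rewrite /kappa divfK// gt_eqF//; lra.
  nra.
pose lam' := lambda + 2 * b / r.
have r0 : 0 < r by lra.
have lam'r : lam' * r = lambda * r + 2 * b by rewrite mulrDl divfK// gt_eqF.
have lam'1 : lam' < 1 by rewrite -(ltr_pM2r r0) lam'r; lra.
have lam'0 : 0 <= lam' by rewrite addr_ge0// divr_ge0//; lra.
pose gamma1 := (2 + kappa * lam' * r) / (2 + kappa * r).
have den0 : 0 < 2 + kappa * r by rewrite addr_gt0// mulr_gt0.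
have g1E : gamma1 * (2 + kappa * r) = 2 + kappa * lam' * r.
  by rewrite divfK// gt_eqF.
have kr0 : 0 < kappa * r by rewrite mulr_gt0.
have g11 : gamma1 < 1 by rewrite -(ltr_pM2r den0) g1E; nra.
have g1lam : lam' <= gamma1 by rewrite -(ler_pM2r den0) g1E; nra.
pose gamma := maxr gamma1 (maxr (1 - delta / 2) lambda).
have gam1 : gamma1 <= gamma by rewrite le_max lexx.
have gam2 : 1 - delta / 2 <= gamma by rewrite !le_max lexx orbT.
have gam3 : lambda <= gamma by rewrite !le_max lexx !orbT.
exists kappa, gamma; split => //.
  by rewrite (le_trans lam0)//= !gt_max g11 lam1 andbT/=; lra.
move=> f c D M mf fM D0 fc.
have pair x y : kernel_act Q f x - kernel_act Q f y
    <= gamma * D * (1 + kappa * V x) + gamma * D * (1 + kappa * V y).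
  have [sr|rs] := leP (V x + V y) r.
  - have [e Qe] := kernel_act_centre_small nu mf fM fc D0 (ltW kappa0) delta0.
    have Vx := V0 x; have Vy := V0 y.
    have := Qe x (Qnu x _); rewrite ler_norml => /(_ _)/andP[|_ ex] /=; first lra.
    have := Qe y (Qnu y _); rewrite ler_norml => /(_ _)/andP[|ey _] /=; first lra.
    have : (2 - 2 * delta + kappa * lambda * (V x + V y) + 2 * kappa * b)
        <= gamma * (2 + kappa * (V x + V y)).
      have : kappa * lambda * (V x + V y) <= kappa * gamma * (V x + V y).
        by rewrite ler_wpM2r ?addr_ge0// ler_wpM2l// ltW.
      nra.
    move=> /(ler_wpM2l D0); nra.
  - have := kernel_act_centre x mf fM fc D0 (ltW kappa0).
    rewrite ler_norml => /andP[_ ex].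
    have := kernel_act_centre y mf fM fc D0 (ltW kappa0).
    rewrite ler_norml => /andP[ey _].
    have : (2 + kappa * lambda * (V x + V y) + 2 * kappa * b)
        <= gamma * (2 + kappa * (V x + V y)).
      set s := V x + V y in rs *.
      apply: (@le_trans _ _ (gamma1 * (2 + kappa * s))); last first.
        by rewrite ler_wpM2r// addr_ge0// mulr_ge0 ?ltW// (lt_trans r0).
      have q0 : 0 <= 2 * b / r by rewrite divr_ge0//; lra.
      have qr : 2 * b / r * r = 2 * b by rewrite divfK// gt_eqF.
      have h1 : 0 <= 2 * b / r * (s - r) by rewrite mulr_ge0// subr_ge0 ltW.
      have h2 : 0 <= (gamma1 - lam') * kappa * (s - r).
        by apply: mulr_ge0; [apply: mulr_ge0; [rewrite subr_ge0|exact: ltW]|rewrite subr_ge0 ltW].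
      have h3 : 0 <= kappa * (2 * b / r * s - 2 * b).
        by apply: mulr_ge0; [exact: ltW|lra].
      have h4 : kappa * (lambda * s) = kappa * (lam' * s - 2 * b / r * s).
        by rewrite /lam'; ring.
      lra.
    move=> /(ler_wpM2l D0); nra.
pose E := range (fun x => kernel_act Q f x - gamma * D * (1 + kappa * V x)).
have E0 : E !=set0 by exists (kernel_act Q f point - gamma * D * (1 + kappa * V point)); exists point.
have Eub y : ubound E (kernel_act Q f y + gamma * D * (1 + kappa * V y)).
  by move=> _ [x _ <-]; have := pair x y; lra.
(* the centre is the supremum of the lower envelopes *)
exists (sup E) => x.
have h1 : sup E <= kernel_act Q f x + gamma * D * (1 + kappa * V x).
  exact: ge_sup.
have h2 : kernel_act Q f x - gamma * D * (1 + kappa * V x) <= sup E.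
  apply: ub_le_sup; last by exists x.
  by exists (kernel_act Q f x + gamma * D * (1 + kappa * V x)).
by rewrite ler_norml; apply/andP; split; lra.
Qed.

End harris.

(** * The tempering kernel: integrals and drift *)

Section density_probability.
Context d (T : measurableType d) (R : realType).
Variables (mu : {measure set T -> \bar R}) (p : {mfun T >-> R}).
Hypothesis hp : probability_density mu p.
Local Open Scope ereal_scope.

(** The proof that p is a density is an argument so that the measure and
    probability structures can be attached to the constant. *)
Definition density_probability (_ : probability_density mu p) : set T -> \bar R :=
  density_distribution mu p.

Let p0 x : 0 <= (p x)%:E.
Proof. by rewrite lee_fin; have [+ _] := hp; exact. Qed.

Let density0 : density_probability hp set0 = 0.
Proof. exact: integral_set0. Qed.

Let density_ge0 A : 0 <= density_probability hp A.
Proof. by apply: integral_ge0 => x _; exact: p0. Qed.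

Let density_sigma_additive : semi_sigma_additive (density_probability hp).
Proof.
by apply: semi_sigma_additive_nng_induced => //; exact/measurable_EFinP.
Qed.

HB.instance Definition _ := isMeasure.Build _ _ _ (density_probability hp)
  density0 density_ge0 density_sigma_additive.

Let densityT : density_probability hp setT = 1.
Proof. by have [_] := hp. Qed.

HB.instance Definition _ :=
  Measure_isProbability.Build _ _ _ (density_probability hp) densityT.

End density_probability.

Section tempering.
Context d (T : measurableType d) (R : realType).
Variables (upsilon : {i01 R}) (P : R.-pker T ~> T) (p : {mfun T >-> R}) (beta : R).
Implicit Types (theta : probability T R).
Local Notation alpha := (acceptance p beta).
Local Notation u := (upsilon%:num).

Lemma acceptance_itv x y : 0 <= alpha x y <= 1.
Proof. by rewrite le_min ler01 divr_ge0 ?powR_ge0//= ge_min lexx. Qed.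

Lemma measurable_acceptance x : measurable_fun setT (alpha x).
Proof.
apply: measurable_minr => //; apply: measurable_funM => //.
exact: (measurableT_comp (@measurable_powR R beta)).
Qed.

(** The exchange kernel draws y from theta and then moves to y with probability
    alpha(x,y): integrals against it are theta-averages of integrals against
    the two-point measures of this choice. *)
Lemma integral_exchange theta x (h : T -> \bar R) :
  measurable_fun setT h -> (forall y, 0 <= h y)%E ->
  (\int[exchange_kernel p beta theta x]_y h y
    = \int[theta]_y ((alpha x y)%:E * h y + (1 - alpha x y)%:E * h x))%E.
Proof.
have a0 y : 0 <= alpha x y by have /andP[] := acceptance_itv x y.
have a1 y : 0 <= 1 - alpha x y.
  by rewrite subr_ge0; have /andP[] := acceptance_itv x y.
have ma := measurable_acceptance x.
have ma1 : measurable_fun setT (fun y => 1 - alpha x y) by exact: measurable_funB.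
pose k y : {measure set T -> \bar R} := measure_add
  (mscale (NngNum (a0 y)) (\d_y : {measure set T -> \bar R}))
  (mscale (NngNum (a1 y)) (\d_x : {measure set T -> \bar R})).
have kE y (g : T -> \bar R) : measurable_fun setT g -> (forall z, 0 <= g z)%E ->
    (\int[k y]_z g z = (alpha x y)%:E * g y + (1 - alpha x y)%:E * g x)%E.
  move=> mg g0; rewrite ge0_integral_measure_add// !ge0_integral_mscale//=.
  by rewrite !integral_dirac// !diracT !mul1e.
move=> mh h0.
transitivity (\int[theta]_y (\int[k y]_z h z * 1))%E; last first.
  by apply: eq_integral => y _; rewrite mule1 kE.
move: h mh h0; apply: monotone_functional_ext.
- exact: monotone_functional_integral.
- apply: (@monotone_functional_mix _ _ T T R theta (fun y h => \int[k y]_z h z)%E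
    (cst 1)) => //.
    by move=> y; exact: monotone_functional_integral.
  move=> h mh h0.
  rewrite [X in measurable_fun _ X](_ : _ =
    (fun y => (alpha x y)%:E * (h y)%:E + (1 - alpha x y)%:E * (h x)%:E)%E); last first.
    by apply/funext => y; apply: (kE y (EFin \o h)); [exact/measurable_EFinP|move=> z; rewrite lee_fin].
  apply: emeasurable_funD; apply: emeasurable_funM => //; exact/measurable_EFinP.
- move=> A mA.
  rewrite integral_indic// setIT.
  rewrite -[LHS]/(exchange_kernel p beta theta x A) /exchange_kernel.
  rewrite [X in (X + _)%E = _]integral_mkcond.
  rewrite -ge0_integralZl//; last 2 first.
  + exact/measurable_EFinP.
  + by move=> y _; rewrite lee_fin.
  have mI : measurable_fun setT (EFin \o \1_A : T -> \bar R) by exact/measurable_EFinP.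
  rewrite -ge0_integralD//.
  + apply: eq_integral => y _.
    rewrite mule1 kE//; last by move=> z; rewrite lee_fin.
    rewrite /patch/= diracE !indicE; congr (_ + _)%E; last exact: muleC.
    by case: ifPn => _; rewrite ?mule1 ?mule0.
  + by move=> y _; apply: erestrict_ge0 => z _; rewrite lee_fin.
  + by apply/(measurable_restrictT _ _).1 => //; exact/measurable_EFinP/measurable_funTS.
  + by move=> y _; rewrite mule_ge0 ?lee_fin.
  + by apply: measurable_funeM; exact/measurable_EFinP.
Qed.

Lemma ge0_integral_tempering theta x (h : T -> \bar R) :
  measurable_fun setT h -> (forall y, 0 <= h y)%E ->
  (\int[tempering_kernel upsilon P p beta theta x]_y h y
    = (1 - u)%:E * \int[P x]_y h y
      + u%:E * \int[theta]_y ((alpha x y)%:E * h y + (1 - alpha x y)%:E * h x))%E.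
Proof.
move=> mh h0; rewrite -integral_exchange//.
by rewrite ge0_integral_measure_add// !ge0_integral_mscale.
Qed.

Lemma tempering_kernel_setT theta x :
  tempering_kernel upsilon P p beta theta x setT = 1%E.
Proof.
have := @ge0_integral_tempering theta x (cst 1%E) (measurable_cst _) (fun=> lee01).
rewrite integral_cst// mul1e => E; apply: (eq_trans E).
rewrite integral_cst// mul1e.
rewrite [X in (_ * X + _)%E]prob_kernel.
rewrite (eq_integral (cst 1%E)) => [|y _]; last first.
  by rewrite !mule1 -EFinD addrC subrK.
rewrite integral_cst// mul1e [X in (_ + _ * X)%E]probability_setT !mule1.
by rewrite -EFinD subrK.
Qed.

Lemma tempering_act theta (f : T -> R) (c : R) x :
  measurable_fun setT f -> (forall y, `|f y| <= c) ->
  kernel_act (tempering_kernel upsilon P p beta theta) f x =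
  (1 - u) * kernel_act P f x
  + u * (\int[theta]_y (alpha x y * f y) + f x * (1 - \int[theta]_y alpha x y)).
Proof.
move=> mf fc.
have Px1 : P x setT = 1%E by exact: prob_kernel.
have th1 : theta setT = 1%E by exact: probability_setT.
have K1 := tempering_kernel_setT theta x.
have a01 := acceptance_itv x.
have ma := measurable_acceptance x.
have an y : `|alpha x y| <= 1 by have /andP[a0 a1] := a01 y; rewrite ger0_norm.
have afn y : `|alpha x y * f y| <= c by rewrite normrM -[leRHS]mul1r ler_pM.
have ia := bounded_integrable th1 ma an.
have iaf := bounded_integrable th1 (measurable_funM ma mf) afn.
have fc0 y : 0 <= f y + c.
  by have := fc y; rewrite ler_norml => /andP[]; lra.
have mfc : measurable_fun setT (fun y => f y + c) by exact: measurable_funD.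
have c0 : 0 <= c := le_trans (normr_ge0 _) (fc x).
have fcn y : `|f y + c| <= 2 * c.
  by rewrite (le_trans (ler_normD _ _))// (ger0_norm c0); have := fc y; lra.
have shift (m : {measure set T -> \bar R}) : m setT = 1%E ->
    (\int[m]_y (f y + c)%:E = (\int[m]_y f y + c)%:E)%E.
  move=> m1; rewrite -EFin_Rintegral; last exact: bounded_integrable m1 mfc fcn.
  congr EFin; rewrite RintegralD//; first by rewrite (Rintegral_cst1 c m1).
  - exact: bounded_integrable m1 mf fc.
  - by apply: (bounded_integrable m1 (c := `|c|)).
have mfc' : measurable_fun setT (fun y => (f y + c)%:E) by exact/measurable_EFinP.
have fc0' y : (0 <= (f y + c)%:E)%E by rewrite lee_fin.
have := ge0_integral_tempering theta x mfc' fc0'.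
rewrite (shift _ K1) (shift _ Px1) (_ : (\int[theta]_y _)%E = (\int[theta]_y (alpha x y * f y)
    + f x * (1 - \int[theta]_y alpha x y) + c)%:E).
  rewrite -!EFinM -EFinD => -[]; rewrite /kernel_act; lra.
transitivity (\int[theta]_y ((alpha x y * f y - f x * alpha x y) + (f x + c))%:E)%E.
  by apply: eq_integral => y _; rewrite -!EFinM -EFinD; congr EFin; ring.
have ifa := integrableZl measurableT (f x) ia.
have iD := integrableB measurableT iaf ifa.
have icst : theta.-integrable setT (EFin \o cst (f x + c)).
  by apply: (bounded_integrable th1 (c := `|f x + c|)).
rewrite -EFin_Rintegral; last exact: (integrableD measurableT iD icst).
congr EFin; rewrite RintegralD// (Rintegral_cst1 _ th1) RintegralB// RintegralZl//.
lra.
Qed.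

(** The exchange step can at worst keep W or replace it by a draw from
    theta, and the kernel P contracts with weight 1 - u > 0. *)
Lemma tempering_drift theta (W : T -> R) (lambda b B : R) x :
  measurable_fun setT W -> (forall y, 0 <= W y) -> 0 <= b -> 0 <= B ->
  (\int[P x]_y (W y)%:E <= (lambda * W x + b)%:E)%E ->
  (\int[theta]_y (W y)%:E <= B%:E)%E ->
  (\int[tempering_kernel upsilon P p beta theta x]_y (W y)%:E
    <= (((1 - u) * lambda + u) * W x + (b + B))%:E)%E.
Proof.
move=> mW W0 b0 B0 PW thW.
have mW' : measurable_fun setT (EFin \o W) by exact/measurable_EFinP.
have u0 : 0 <= u by [].
have u1 : 0 <= 1 - u by rewrite subr_ge0.
rewrite ge0_integral_tempering//.
apply: (@le_trans _ _ ((1 - u)%:E * (lambda * W x + b)%:E + u%:E * (B + W x)%:E)%E).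
  apply: leeD; apply: lee_wpmul2l => //; rewrite ?lee_fin//.
  apply: (@le_trans _ _ (\int[theta]_y ((W y)%:E + (W x)%:E))%E).
    have ma := measurable_acceptance x.
    apply: ge0_le_integral => //.
    - move=> y _; have /andP[a0 a1] := acceptance_itv x y.
      by rewrite -!EFinM -EFinD lee_fin addr_ge0// mulr_ge0// subr_ge0.
    - apply: emeasurable_funD.
        by apply: emeasurable_funM => //; exact/measurable_EFinP.
      apply: emeasurable_funM => //; apply/measurable_EFinP.
      exact: measurable_funB.
    - exact: emeasurable_funD.
    - move=> y _; have /andP[a0 a1] := acceptance_itv x y.
      have := W0 y; have := W0 x.
      rewrite -!EFinM -!EFinD lee_fin; nra.
  rewrite ge0_integralD//; last 2 first.
    by move=> y _; rewrite lee_fin.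
    by move=> y _; rewrite lee_fin.
  by rewrite integral_cst// [X in (_ * X)%E]probability_setT mule1 EFinD leeD.
rewrite -!EFinM -EFinD lee_fin; nra.
Qed.

End tempering.

Lemma powR_gt1 (R : realType) (x c : R) : 1 < x -> 0 < c -> 1 < x `^ c.
Proof.
move=> x1 c0; have : 1 `^ c < x `^ c.
  by apply: gt0_ltr_powR => //; rewrite nnegrE// (le_trans ler01)// ltW.
by rewrite powR1.
Qed.

Lemma powR_exprn (R : realType) (x c : R) (n : nat) : 0 <= x -> (x ^+ n) `^ c = (x `^ c) ^+ n.
Proof.
move=> x0; elim: n => [|n ih]; first by rewrite !expr0 powR1.
by rewrite !exprS powRM ?exprn_ge0// ih.
Qed.

(** Concavity of t^a: its graph lies below the tangent at w, whose slope is
    a w^(a-1). *)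
Lemma powR_le_tangent (R : realType) (a t w : R) : 0 < a < 1 -> 0 <= t -> 0 < w ->
  t `^ a <= a * (w `^ a / w) * t + (1 - a) * w `^ a.
Proof.
move=> /andP[a0 a1] t0 w0.
have pq : (a^-1)^-1 + ((1 - a)^-1)^-1 = 1 by rewrite !invrK addrC subrK.
have tw0 : 0 <= t / w by rewrite divr_ge0// ltW.
have := @conjugate_powR R ((t / w) `^ a) 1 _ _ (powR_ge0 _ _) ler01 _ _ pq.
rewrite !invr_gt0 subr_gt0 => /(_ a0 a1).
rewrite mulr1 -powRrM mulfV ?gt_eqF// powRr1// powR1 !invrK mul1r.
move=> /(ler_wpM2r (powR_ge0 w a)).
rewrite -powRM// ?(ltW w0)// divfK ?gt_eqF// => h; apply: (le_trans h).
by rewrite le_eqVlt; apply/orP; left; apply/eqP; field; rewrite gt_eqF.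
Qed.

(** Jensen's inequality for the concave power a, by integrating the tangent at
    w; a drift condition for W thus passes to W^a. *)
Lemma power_drift d (T : measurableType d) (R : realType)
    (m : {measure set T -> \bar R}) (W : T -> R) (lambda b a w : R) :
  m setT = 1%E -> measurable_fun setT W -> (forall y, 0 <= W y) ->
  0 < a < 1 -> 0 <= b -> 1 <= w ->
  (\int[m]_y (W y)%:E <= (lambda * w + b)%:E)%E ->
  (\int[m]_y (W y `^ a)%:E <= ((1 - a * (1 - lambda)) * w `^ a + a * b)%:E)%E.
Proof.
move=> m1 mW W0 a01 b0 w1 mWb; have w0 : 0 < w by lra.
have /andP[a0 a1] := a01.
pose k := a * (w `^ a / w).
have k0 : 0 <= k by rewrite mulr_ge0 ?divr_ge0 ?powR_ge0// ltW.
have wa0 : 0 <= (1 - a) * w `^ a by rewrite mulr_ge0 ?powR_ge0//; lra.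
have mW' : measurable_fun setT (EFin \o W) by exact/measurable_EFinP.
apply: (@le_trans _ _ (\int[m]_y (k%:E * (W y)%:E + ((1 - a) * w `^ a)%:E))%E).
  apply: ge0_le_integral => //.
  - by move=> y _; rewrite lee_fin powR_ge0.
  - apply/measurable_EFinP.
    exact: (measurableT_comp (@measurable_powR R a)).
  - by apply: emeasurable_funD => //; exact: measurable_funeM.
  - by move=> y _; rewrite -EFinM -EFinD lee_fin; exact: powR_le_tangent.
rewrite ge0_integralD//; last 2 first.
  by move=> y _; rewrite mule_ge0// lee_fin.
  exact: measurable_funeM.
rewrite ge0_integralZl_EFin//; last by move=> y _; rewrite lee_fin.
rewrite integral_cst// [X in (_ + _ * X)%E]m1 mule1.
apply: (@le_trans _ _ (k%:E * (lambda * w + b)%:E + ((1 - a) * w `^ a)%:E)%E).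
  by rewrite leeD2r// lee_wpmul2l// lee_fin.
rewrite -EFinM -EFinD lee_fin.
have kw : k * w = a * w `^ a by rewrite /k -mulrA divfK ?gt_eqF.
have ka : k <= a.
  rewrite /k ler_piMr ?(ltW a0)// ler_pdivrMr// mul1r.
  by rewrite -[leRHS]powRr1 ?(ltW w0)// ler_powR// ltW.
have e1 : k * (lambda * w) = lambda * (a * w `^ a) by rewrite mulrCA kw.
have e2 := ler_wpM2r b0 ka.
lra.
Qed.

(** * The tempering kernel: dependence on the point and on the auxiliary measure *)

Lemma continuous_measurable_real d (S : borelType d) (R : realType) (f : S -> R) :
  continuous f -> measurable_fun setT f.
Proof.
move=> /continuousP cf; apply: (measurability _ (RGenOpens.measurableE R)).
move=> _ [_ [a [b ->] <-]]; rewrite setTI measurable_borelE.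
by apply: sub_gen_smallest; apply: cf; exact: interval_open.
Qed.

Lemma continuous_powR_pos (T : topologicalType) (R : realType) (p : T -> R)
    (beta : R) :
  continuous p -> (forall x, 0 < p x) -> continuous (fun x => p x `^ beta).
Proof.
move=> cp p0.
rewrite (_ : (fun _ => _) = fun x => expR (beta * ln (p x))); last first.
  by apply/funext => x; rewrite /powR gt_eqF.
move=> x; apply: (@continuous_comp _ _ _ (fun x => beta * ln (p x)) (@expR R)).
  apply: cvgM; first exact: cvg_cst.
  apply: (@continuous_comp _ _ _ p (@ln R)); first exact: cp.
  exact: continuous_ln.
exact: continuous_expR.
Qed.

(** The acceptance probability as a function of the values t and s of p^beta at
    the proposed and at the current point. *)
Definition metropolis (R : realType) (t s : R) : R := minr 1 (t / s).

Lemma metropolis_itv (R : realType) (t s : R) : 0 <= t -> 0 < s ->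
  0 <= metropolis t s <= 1.
Proof. by move=> t0 s0; rewrite le_min ler01 divr_ge0 ?(ltW s0)//= ge_min lexx. Qed.

(** In the reference value s the acceptance probability is Lipschitz, uniformly
    in the proposed value t. This is what turns pointwise convergence
    into uniform convergence below. *)
Lemma metropolis_lip (R : realType) (t s s' : R) : 0 <= t -> 0 < s -> s <= s' ->
  0 <= metropolis t s - metropolis t s' <= (s' - s) / s'.
Proof.
move=> t0 s0 ss'; have s'0 : 0 < s' by lra.
have sE : s / s' * s' = s by rewrite divfK// gt_eqF.
have tE : t / s' * s' = t by rewrite divfK// gt_eqF.
have qE : t / s * s = t by rewrite divfK// gt_eqF.
rewrite mulrBl divff ?gt_eqF// /metropolis.
have [ts|st] := leP t s.
  rewrite !min_r; [|rewrite ler_pdivrMr//; lra..].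
  have q'E : t / s' = t / s * (s / s') by rewrite mulrA qE.
  have a1 : t / s <= 1 by rewrite ler_pdivrMr//; lra.
  have a0 : 0 <= t / s by rewrite divr_ge0// ltW.
  have b1 : s / s' <= 1 by rewrite ler_pdivrMr//; lra.
  rewrite q'E; apply/andP; split; nra.
rewrite (@min_l _ _ 1 (t / s)); last by rewrite ler_pdivlMr//; lra.
have [ts'|st'] := leP t s'.
  rewrite min_r; last by rewrite ler_pdivrMr//; lra.
  rewrite subr_ge0 ler_pdivrMr// mul1r ts'/= lerB// ler_pM2r ?invr_gt0//.
  exact: ltW.
rewrite min_l; last by rewrite ler_pdivlMr//; lra.
by rewrite subrr lexx/= subr_ge0 ler_pdivrMr// mul1r.
Qed.

Section acceptance_mean.
Context d (S : measurableType d) (R : realType) (phi : S -> R).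
Hypotheses (mphi : measurable_fun setT phi) (phi0 : forall y, 0 <= phi y).
Implicit Types (theta : probability S R) (f : S -> R).

Definition acceptance_mean theta f (s : R) : R :=
  \int[theta]_y (metropolis (phi y) s * f y).

Lemma measurable_metropolis (s : R) : measurable_fun setT (fun y => metropolis (phi y) s).
Proof. by apply: measurable_minr => //; exact: measurable_funM. Qed.

Lemma metropolis_bound f (c s : R) : 0 < s -> (forall y, `|f y| <= c) ->
  forall y, `|metropolis (phi y) s * f y| <= c.
Proof.
move=> s0 fc y; have /andP[a0 a1] := metropolis_itv (phi0 y) s0.
by rewrite normrM -[leRHS]mul1r ler_pM// ger0_norm.
Qed.

Lemma acceptance_mean_lip theta f (c s s' : R) : measurable_fun setT f ->
  (forall y, `|f y| <= c) -> 0 < s -> s <= s' ->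
  `|acceptance_mean theta f s - acceptance_mean theta f s'| <= c * ((s' - s) / s').
Proof.
move=> mf fc s0 ss'; have s'0 : 0 < s' by lra.
have th1 : theta setT = 1%E by exact: probability_setT.
have mM (r : R) := measurable_funM (measurable_metropolis r) mf.
have ii (r : R) : 0 < r ->
    theta.-integrable setT (EFin \o (fun y => metropolis (phi y) r * f y)).
  by move=> r0; exact: (bounded_integrable th1 (mM r) (metropolis_bound r0 fc)).
rewrite /acceptance_mean -(RintegralB measurableT (ii _ s0) (ii _ s'0)).
apply: Rintegral_bound => //; first exact: (measurable_funB (mM s) (mM s')).
move=> y; rewrite -mulrBl normrM mulrC ler_pM//.
by have /andP[h0 h1] := metropolis_lip (phi0 y) s0 ss'; rewrite ger0_norm.
Qed.

(** The maps s |-> acceptance_mean theta f s share a Lipschitz constant on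
    [s0, +oo), so convergence on a fine finite grid of [s0, M] is uniform
    there. Only rational parameters are involved, which leaves countably many
    almost sure convergences. *)
Lemma acceptance_mean_cvg_unif (theta_ : nat -> probability S R) theta f (c : R) :
  measurable_fun setT f -> (forall y, `|f y| <= c) ->
  (forall i N : nat,
    (fun k => acceptance_mean (theta_ k) f (i.+1%:R / N.+1%:R)) @ \oo
      --> acceptance_mean theta f (i.+1%:R / N.+1%:R)) ->
  forall s0 M eta : R, 0 < s0 -> 0 < eta ->
  \forall k \near \oo, forall s, s0 <= s <= M ->
    `|acceptance_mean (theta_ k) f s - acceptance_mean theta f s| <= eta.
Proof.
move=> mf fc cvgth s0 M eta s00 eta0.
have c0 : 0 <= c := le_trans (normr_ge0 _) (fc point).
(* mesh 1 / N.+1 with c / (N.+1 s0) <= eta / 3 *)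
pose N := Num.truncn (3 * c / (eta * s0)).
have e0 : 0 < eta * s0 by rewrite mulr_gt0.
have N1 : 0 < (N.+1%:R : R) by [].
have NE : c / (N.+1%:R * s0) <= eta / 3.
  rewrite ler_pdivrMr ?mulr_gt0//.
  have : 3 * c / (eta * s0) < N.+1%:R by rewrite truncnS_gt.
  rewrite ltr_pdivrMr// => h.
  have -> : eta / 3 * (N.+1%:R * s0) = N.+1%:R * (eta * s0) / 3 by field.
  lra.
pose L := (Num.truncn (M * N.+1%:R)).+1.
have : \forall k \near \oo, forall i : 'I_L,
    `|acceptance_mean (theta_ k) f (i.+1%:R / N.+1%:R)
      - acceptance_mean theta f (i.+1%:R / N.+1%:R)| <= eta / 3.
  apply: filter_forall => i.
  have e3 : 0 < eta / 3 by rewrite divr_gt0.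
  have /cvgrPdist_le/(_ _ e3) := cvgth i N.
  by apply: filterS => k; rewrite distrC.
apply: filterS => k hk s /andP[s0s sM].
have sp : 0 < s by lra.
have i0 : 0 <= s * N.+1%:R by rewrite mulr_ge0// ltW.
(* the first grid point strictly above s *)
pose i := Num.truncn (s * N.+1%:R).
have iL : (i < L)%N.
  by rewrite ltnS; apply: le_truncn; rewrite ler_pM2r.
have := hk (Ordinal iL); rewrite /=.
set s' := i.+1%:R / N.+1%:R.
have ss' : s <= s'.
  by rewrite /s' ler_pdivlMr// ltW// truncnS_gt.
have s's : s' - s <= N.+1%:R^-1.
  rewrite lerBlDr /s' ler_pdivrMr// mulrDl mulVf ?gt_eqF// -natr1 addrC lerD2l.
  by rewrite truncn_le.
have step th : `|acceptance_mean th f s - acceptance_mean th f s'| <= eta / 3.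
  apply: (le_trans (acceptance_mean_lip th mf fc sp ss')).
  apply: le_trans NE; rewrite ler_wpM2l// [leRHS]invfM.
  apply: ler_pM => //; rewrite ?subr_ge0// ?invr_ge0; [lra|].
  by rewrite lef_pV2 ?posrE//; lra.
have := step (theta_ k); have := step theta.
rewrite !ler_norml => /andP[? ?] /andP[? ?] /andP[? ?].
by apply/andP; split; lra.
Qed.

End acceptance_mean.

Section tempering_regularity.
Context d (S : borelType d) (R : realType).
Variables (upsilon : {i01 R}) (P : R.-pker S ~> S) (p : {mfun S >-> R}) (beta : R).
Hypotheses (cp : continuous p) (p0 : forall x, 0 < p x).
Implicit Types (theta : probability S R) (f : S -> R).
Local Notation phi := (fun x => p x `^ beta).
Local Notation u := (upsilon%:num).
Local Notation Pth := (tempering_kernel upsilon P p beta).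

Let mphi : measurable_fun setT phi.
Proof. exact: (measurableT_comp (@measurable_powR R beta)). Qed.

Let phi0 y : 0 <= phi y.
Proof. exact: powR_ge0. Qed.

Let phip y : 0 < phi y.
Proof. exact: powR_gt0. Qed.

(** Under the exchange kernel a point x acts only through f x and the number
    p x ^ beta. *)
Lemma tempering_act_mean theta f (c : R) x :
  measurable_fun setT f -> (forall y, `|f y| <= c) ->
  kernel_act (Pth theta) f x = (1 - u) * kernel_act P f x
    + u * (acceptance_mean phi theta f (phi x)
           + f x * (1 - acceptance_mean phi theta (cst 1) (phi x))).
Proof.
move=> mf fc; rewrite (tempering_act upsilon P p beta theta x mf fc).
congr (_ + _ * (_ + _ * (_ - _))).
by apply: eq_Rintegral => y _; rewrite /acceptance_mean /metropolis mulr1.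
Qed.

Lemma tempering_act_bound theta f (c : R) x :
  measurable_fun setT f -> (forall y, `|f y| <= c) ->
  `|kernel_act (Pth theta) f x| <= c.
Proof. by move=> mf fc; apply: Rintegral_bound => //; exact: tempering_kernel_setT. Qed.

Lemma tempering_act_cvg_unif (theta_ : nat -> probability S R) theta f (c : R) :
  measurable_fun setT f -> (forall y, `|f y| <= c) ->
  (forall i N : nat,
    (fun k => acceptance_mean phi (theta_ k) f (i.+1%:R / N.+1%:R)) @ \oo
      --> acceptance_mean phi theta f (i.+1%:R / N.+1%:R)) ->
  (forall i N : nat,
    (fun k => acceptance_mean phi (theta_ k) (cst 1) (i.+1%:R / N.+1%:R)) @ \oo
      --> acceptance_mean phi theta (cst 1) (i.+1%:R / N.+1%:R)) ->
  forall s0 M eta : R, 0 < s0 -> 0 < eta ->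
  \forall k \near \oo, forall x, s0 <= phi x <= M ->
    `|kernel_act (Pth (theta_ k)) f x - kernel_act (Pth theta) f x| <= eta.
Proof.
move=> mf fc cf c1 s0 M eta s00 eta0.
have c0 : 0 <= c := le_trans (normr_ge0 _) (fc point).
have e2 : 0 < eta / (1 + c) by rewrite divr_gt0//; lra.
have eE : eta / (1 + c) * (1 + c) = eta by rewrite divfK// gt_eqF//; lra.
have one_bd (y : S) : `|(cst 1 : S -> R) y| <= 1 by rewrite normr1.
have := acceptance_mean_cvg_unif mphi phi0 (measurable_cst _) one_bd c1 M s00 e2.
have := acceptance_mean_cvg_unif mphi phi0 mf fc cf M s00 e2.
apply: filterS2 => k h1 h2 x xM.
rewrite !(tempering_act_mean _ _ mf fc).
move: (h1 _ xM) (h2 _ xM).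
set A := acceptance_mean _ _ _ _; set B := acceptance_mean _ _ _ _.
set A' := acceptance_mean _ _ _ _; set B' := acceptance_mean _ _ _ _ => hA hB.
rewrite (_ : _ - _ = u * ((A - B) - f x * (A' - B'))); last by ring.
rewrite normrM ger0_norm// -[leRHS]mul1r ler_pM//.
apply: (le_trans (ler_normB _ _)); rewrite normrM -eE mulrDr mulr1 lerD//.
by rewrite mulrC ler_pM.
Qed.

Lemma continuous_acceptance_mean theta f (c : R) :
  measurable_fun setT f -> (forall y, `|f y| <= c) ->
  continuous (fun x => acceptance_mean phi theta f (phi x)).
Proof.
move=> mf fc x.
have c0 : 0 <= c := le_trans (normr_ge0 _) (fc point).
have cphi := continuous_powR_pos (beta := beta) cp p0.
have lip (s s' : R) : 0 < s -> 0 < s' ->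
    `|acceptance_mean phi theta f s - acceptance_mean phi theta f s'|
      <= c * (`|s - s'| / s).
  move=> s0 s'0; have [ss'|s's] := leP s s'.
    apply: (le_trans (acceptance_mean_lip mphi phi0 theta mf fc s0 ss')).
    rewrite ler_wpM2l// distrC ger0_norm ?subr_ge0// ler_wpM2l ?subr_ge0//.
    by rewrite lef_pV2.
  rewrite distrC [`|s - s'|]ger0_norm ?subr_ge0 ?(ltW s's)//.
  exact: (acceptance_mean_lip mphi phi0 theta mf fc s'0 (ltW s's)).
apply/cvgrPdist_le => e e0.
have e2 : 0 < e * phi x / (1 + c).
  by rewrite divr_gt0 ?mulr_gt0//; lra.
have /cvgrPdist_le/(_ _ e2) := cphi x.
apply: filterS => y hy; apply: (le_trans (lip _ _ (phip x) (phip y))).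
rewrite mulrA ler_pdivrMr//.
move: hy; rewrite ler_pdivlMr; last by lra.
by have := normr_ge0 (phi x - phi y); lra.
Qed.

Lemma tempering_feller theta f (c : R) : kernel_feller P ->
  continuous f -> (forall y, `|f y| <= c) -> continuous (kernel_act (Pth theta) f).
Proof.
move=> PF cf fc x; have mf := continuous_measurable_real cf.
have [|cPf _] := PF f cf; first by exists c => _ [y _ <-].
have one_bd (y : S) : `|(cst 1 : S -> R) y| <= 1 by rewrite normr1.
rewrite (_ : kernel_act _ _ = fun x => (1 - u) * kernel_act P f x
    + u * (acceptance_mean phi theta f (phi x)
           + f x * (1 - acceptance_mean phi theta (cst 1) (phi x)))); last first.
  by apply/funext => z; exact: tempering_act_mean mf fc.
apply: cvgD; first by apply: cvgM; [exact: cvg_cst|exact: cPf].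
apply: cvgM; first exact: cvg_cst.
apply: cvgD; first exact: (continuous_acceptance_mean mf fc).
apply: cvgM; first exact: cf.
apply: cvgB; first exact: cvg_cst.
exact: (continuous_acceptance_mean (measurable_cst _) one_bd).
Qed.

End tempering_regularity.

(** * Invariance of the target, integrals against an empirical measure *)

Section tempering_invariance.
Context d (T : measurableType d) (R : realType).
Variables (upsilon : {i01 R}) (P : R.-pker T ~> T) (p : {mfun T >-> R}) (beta : R).
Variables (Pi theta : probability T R) (c : R).
Hypotheses (p0 : forall x, 0 < p x) (c0 : 0 <= c).
Local Notation phi := (fun x => p x `^ beta).
Local Notation u := (upsilon%:num).
Local Notation Pth := (tempering_kernel upsilon P p beta theta).
Hypothesis PiP : (forall A, measurable A -> \int[Pi]_x P x A = Pi A)%E.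
Hypothesis thetaE : forall h : T -> \bar R, measurable_fun setT h ->
  (forall x, (0 <= h x)%E) ->
  (\int[theta]_x h x = \int[Pi]_x (h x * (c / phi x)%:E))%E.

Let phip x : 0 < phi x.
Proof. exact: powR_gt0. Qed.

Let mphi : measurable_fun setT phi.
Proof. exact: (measurableT_comp (@measurable_powR R beta)). Qed.

Let mphiV : measurable_fun setT (fun x => (phi x)^-1).
Proof.
rewrite (_ : (fun _ => _) = fun x => p x `^ (- beta)); last first.
  by apply/funext => x; rewrite powRN.
exact: (measurableT_comp (@measurable_powR R (- beta))).
Qed.

Let g (x y : T) : R := c * minr (phi x)^-1 (phi y)^-1.

Let gC x y : g x y = g y x.
Proof. by rewrite /g minC. Qed.

Let accept_density x y : acceptance p beta x y * (c / phi y) = g x y.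
Proof.
rewrite /acceptance mulrC -mulrA /g minr_pMr ?invr_ge0 ?(ltW (phip y))//.
congr (_ * _); rewrite mulr1 mulrA mulVf ?gt_eqF// mul1r minC//.
Qed.

(** Relative to Pi the measure alpha(x,y) theta(dy) has the density
    g(x,y) = c min(p(x)^-beta, p(y)^-beta), symmetric in x and y. Exchanging
    the order of integration replaces g(x,y) h(y) by g(x,y) h(x), and the
    accepted and rejected parts then add up to the integral of h. *)
Lemma ge0_tempering_invariant (h : T -> R) :
  measurable_fun setT h -> (forall x, 0 <= h x) ->
  (\int[Pi]_x \int[Pth x]_y (h y)%:E = \int[Pi]_x (h x)%:E)%E.
Proof.
move=> mh h0.
have mh' : measurable_fun setT (EFin \o h) by exact/measurable_EFinP.
have h0' x : (0 <= (h x)%:E)%E by rewrite lee_fin.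
have a01 x y := acceptance_itv p beta x y.
have g0 x y : 0 <= g x y.
  by rewrite /g mulr_ge0// le_min !invr_ge0 !ltW.
have gq x y : g x y <= c / phi y by rewrite /g ler_wpM2l// ge_min lexx orbT.
have mq : measurable_fun setT (fun y => c / phi y) by exact: measurable_funM.
have mg2 : measurable_fun setT (fun z : T * T => g z.1 z.2).
  apply: measurable_funM => //; apply: measurable_minr.
    exact: (measurableT_comp mphiV).
  exact: (measurableT_comp mphiV).
have mh1 : measurable_fun setT (fun z : T * T => h z.1) by exact: (measurableT_comp mh).
have mh2 : measurable_fun setT (fun z : T * T => h z.2) by exact: (measurableT_comp mh).
have mq2 : measurable_fun setT (fun z : T * T => c / phi z.2).
  exact: (measurableT_comp mq).
(* accepted moves, their exchanged form, and rejected moves *)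
pose F1 (z : T * T) := (g z.1 z.2 * h z.2)%:E.
pose F2 (z : T * T) := (g z.1 z.2 * h z.1)%:E.
pose F3 (z : T * T) := ((c / phi z.2 - g z.1 z.2) * h z.1)%:E.
have mF1 : measurable_fun setT F1 by apply/measurable_EFinP; exact: measurable_funM.
have mF2 : measurable_fun setT F2 by apply/measurable_EFinP; exact: measurable_funM.
have mF3 : measurable_fun setT F3.
  by apply/measurable_EFinP; apply: measurable_funM => //; exact: measurable_funB.
have F10 z : (0 <= F1 z)%E by rewrite lee_fin mulr_ge0.
have F20 z : (0 <= F2 z)%E by rewrite lee_fin mulr_ge0.
have F30 z : (0 <= F3 z)%E by rewrite lee_fin mulr_ge0// subr_ge0.
have mF (F : T * T -> \bar R) : measurable_fun setT F -> (forall z, 0 <= F z)%E ->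
    measurable_fun setT (fun x => \int[Pi]_y F (x, y))%E.
  by move=> mF F0; exact: measurable_fun_fubini_tonelli_F.
have mFx (F : T * T -> \bar R) x : measurable_fun setT F ->
    measurable_fun setT (fun y => F (x, y)).
  by move=> mF'; exact: measurableT_comp.
have I0 (F : T * T -> \bar R) x : (forall z, 0 <= F z)%E ->
    (0 <= \int[Pi]_y F (x, y))%E.
  by move=> F0; exact: integral_ge0.
have exchangeE x : (\int[theta]_y ((acceptance p beta x y)%:E * (h y)%:E
      + (1 - acceptance p beta x y)%:E * (h x)%:E)
    = \int[Pi]_y F1 (x, y) + \int[Pi]_y F3 (x, y))%E.
  rewrite thetaE; last 2 first.
  - have ma := measurable_acceptance p beta x.
    apply: emeasurable_funD; apply: emeasurable_funM => //; apply/measurable_EFinP => //.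
    exact: measurable_funB.
  - move=> y; have /andP[? ?] := a01 x y.
    by rewrite -!EFinM -EFinD lee_fin addr_ge0// mulr_ge0// subr_ge0.
  rewrite -(ge0_integralD Pi measurableT (fun y _ => F10 (x, y)) (mFx _ x mF1)
    (fun y _ => F30 (x, y)) (mFx _ x mF3)).
  apply: eq_integral => y _; rewrite -!EFinM /F1 /F3 -EFinD; congr EFin.
  by rewrite -(accept_density x y)/=; ring.
have swap : (\int[Pi]_x \int[Pi]_y F1 (x, y) = \int[Pi]_x \int[Pi]_y F2 (x, y))%E.
  apply: (eq_trans (@fubini_tonelli _ _ _ _ _ Pi Pi F1 mF1 F10)).
  apply: eq_integral => x _; apply: eq_integral => y _.
  by rewrite /F1 /F2/= gC.
have exchange_inv : (\int[Pi]_x \int[theta]_y ((acceptance p beta x y)%:E * (h y)%:E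
      + (1 - acceptance p beta x y)%:E * (h x)%:E) = \int[Pi]_x (h x)%:E)%E.
  under eq_integral do rewrite exchangeE.
  rewrite (ge0_integralD Pi measurableT (fun x _ => I0 _ x F10) (mF _ mF1 F10)
    (fun x _ => I0 _ x F30) (mF _ mF3 F30)) swap.
  rewrite -(ge0_integralD Pi measurableT (fun x _ => I0 _ x F20) (mF _ mF2 F20)
    (fun x _ => I0 _ x F30) (mF _ mF3 F30)).
  apply: eq_integral => x _.
  rewrite -(ge0_integralD Pi measurableT (fun y _ => F20 (x, y)) (mFx _ x mF2)
    (fun y _ => F30 (x, y)) (mFx _ x mF3)).
  transitivity (\int[Pi]_y ((h x)%:E * (c / phi y)%:E))%E.
    by apply: eq_integral => y _; rewrite -EFinD -EFinM/=; congr EFin; ring.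
  have qint : (\int[Pi]_y (c / phi y)%:E = 1)%E.
    have := @thetaE (cst 1%E) (measurable_cst _) (fun=> lee01).
    rewrite integral_cst// [X in (_ * X)%E]probability_setT mul1e => ->.
    by apply: eq_integral => y _; rewrite mul1e.
  have q0 y : (0 <= (c / phi y)%:E)%E by rewrite lee_fin divr_ge0// ltW.
  have mq' : measurable_fun setT (fun y => (c / phi y)%:E).
    exact/measurable_EFinP.
  rewrite (ge0_integralZl_EFin Pi measurableT (fun y _ => q0 y) mq' (h0 x)).
  by rewrite qint mule1.
under eq_integral do rewrite ge0_integral_tempering//.
have mP : measurable_fun setT (fun x => \int[P x]_y (h y)%:E)%E.
  exact: (measurable_fun_integral_kernel (measurable_kernel P)).
have P0 x : (0 <= \int[P x]_y (h y)%:E)%E by exact: integral_ge0.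
have mE : measurable_fun setT (fun x => \int[theta]_y ((acceptance p beta x y)%:E * (h y)%:E
      + (1 - acceptance p beta x y)%:E * (h x)%:E))%E.
  rewrite (_ : (fun _ => _) = fun x => \int[Pi]_y F1 (x, y) + \int[Pi]_y F3 (x, y))%E.
    by apply: emeasurable_funD; exact: mF.
  by apply/funext => x; exact: exchangeE.
have E0 x : (0 <= \int[theta]_y ((acceptance p beta x y)%:E * (h y)%:E
      + (1 - acceptance p beta x y)%:E * (h x)%:E))%E.
  by rewrite exchangeE; apply: adde_ge0; exact: I0.
have u0 : 0 <= u by [].
have u1 : 0 <= 1 - u by rewrite subr_ge0.
have uP0 x : setT x -> (0 <= (1 - u)%:E * \int[P x]_y (h y)%:E)%E.
  by move=> _; exact: mule_ge0.
have uE0 x : setT x -> (0 <= u%:E * \int[theta]_y ((acceptance p beta x y)%:E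
    * (h y)%:E + (1 - acceptance p beta x y)%:E * (h x)%:E))%E.
  by move=> _; exact: mule_ge0.
rewrite (ge0_integralD Pi measurableT uP0 (measurable_funeM _ mP) uE0
  (measurable_funeM _ mE)).
rewrite (ge0_integralZl_EFin Pi measurableT (fun x _ => P0 x) mP u1).
rewrite (ge0_integralZl_EFin Pi measurableT (fun x _ => E0 x) mE u0).
rewrite exchange_inv (integral_invariant PiP mh' h0').
have h0i : (0 <= \int[Pi]_x (h x)%:E)%E by exact: integral_ge0.
rewrite -ge0_muleDl ?lee_fin//.
by rewrite -EFinD subrK mul1e.
Qed.

Lemma tempering_invariant (f : T -> R) (M : R) :
  measurable_fun setT f -> (forall x, `|f x| <= M) ->
  measurable_fun setT (kernel_act Pth f) ->
  \int[Pi]_x kernel_act Pth f x = \int[Pi]_x f x.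
Proof.
move=> mf fM mPf.
have Pi1 : Pi setT = 1%E by exact: probability_setT.
have K1 x : Pth x setT = 1%E by exact: tempering_kernel_setT.
have PM x : `|kernel_act Pth f x| <= M.
  exact: (Rintegral_bound (K1 x) mf fM).
have fM0 y : 0 <= f y + M.
  by have := fM y; rewrite ler_norml => /andP[]; lra.
have mfM : measurable_fun setT (fun y => f y + M) by exact: measurable_funD.
have shift (m : {measure set T -> \bar R}) (e : T -> R) : m setT = 1%E ->
    measurable_fun setT e -> (forall y, `|e y| <= M) ->
    (\int[m]_y (e y + M)%:E = (\int[m]_y e y + M)%:E)%E.
  move=> m1 me eM; have ie := bounded_integrable m1 me eM.
  have iM : m.-integrable setT (EFin \o cst M).
    by apply: (bounded_integrable m1 (c := `|M|)).
  rewrite -EFin_Rintegral; last exact: (integrableD measurableT ie iM).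
  by congr EFin; rewrite RintegralD//; rewrite (Rintegral_cst1 M m1).
have := ge0_tempering_invariant mfM fM0.
rewrite (shift Pi f)// (eq_integral (fun x => (kernel_act Pth f x + M)%:E)).
  by rewrite shift// => -[] /addIr.
by move=> x _; exact: (shift _ f (K1 x) mf fM).
Qed.

End tempering_invariance.

Section empirical_integral.
Context d (S : measurableType d) (R : realType) (y : nat -> S) (n : nat).

Lemma ge0_integral_empirical (f : S -> R) :
  measurable_fun setT f -> (forall x, 0 <= f x) ->
  (\int[empirical R y n]_x (f x)%:E = (empirical_mean y n f)%:E)%E.
Proof.
move=> mf f0; have mf' : measurable_fun setT (EFin \o f) by exact/measurable_EFinP.
rewrite ge0_integral_mscale//; last by move=> x _; rewrite lee_fin.
rewrite ge0_integral_measure_sum//; last by move=> x _; rewrite lee_fin.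
rewrite /empirical_mean EFinM -sumEFin; congr (_ * _)%E.
by apply: eq_bigr => k _; rewrite integral_dirac// diracT mul1e.
Qed.

Lemma Rintegral_empirical (f : S -> R) (c : R) :
  measurable_fun setT f -> (forall x, `|f x| <= c) ->
  \int[empirical R y n]_x f x = empirical_mean y n f.
Proof.
move=> mf fc; have m1 : empirical R y n setT = 1%E by exact: probability_setT.
have fc0 x : 0 <= f x + c by have := fc x; rewrite ler_norml => /andP[]; lra.
have ie := bounded_integrable m1 mf fc.
have ic : (empirical R y n).-integrable setT (EFin \o cst c).
  by apply: (bounded_integrable m1 (c := `|c|)).
have mfc : measurable_fun setT (fun x => f x + c) by exact: measurable_funD.
have := ge0_integral_empirical mfc fc0.
rewrite -EFin_Rintegral; last exact: (integrableD measurableT ie ic).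
rewrite RintegralD// (Rintegral_cst1 c m1) => -[].
have -> : empirical_mean y n (fun x => f x + c) = empirical_mean y n f + c.
  rewrite /empirical_mean big_split/= mulrDr sumr_const card_ord; congr (_ + _).
  by rewrite -[c *+ _]mulr_natl mulrA mulVf ?mul1r.
by move/addIr.
Qed.

End empirical_integral.

(** * Sums of bounded martingale increments *)

Lemma measurable_wrtP dO (Omega : measurableType dO) (R : realType)
    (G : set (set Omega)) (f : Omega -> R) : sigma_algebra setT G ->
  measurable_wrt G f <-> measurable_fun (setT : set (g_sigma_algebraType G)) f.
Proof.
move=> sG; split=> [Gf _ B mB|mf B mB].
  by rewrite setTI; apply: sub_gen_smallest; exact: Gf.
by rewrite -(sigma_algebra_id sG) -[_ @^-1` _]setTI; exact: mf.
Qed.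

Section bounded_martingale.
Context dO (Omega : measurableType dO) (R : realType) (Pr : probability Omega R).
Variables (F : nat -> set (set Omega)) (Z U : nat -> Omega -> R) (c : R).
Hypotheses (hF : filtration F)
  (FZ : forall k, measurable_wrt (F k.+1) (Z k))
  (ZU : forall k, is_conditional_expectation Pr (F k) (Z k) (U k))
  (Zc : forall k w, `|Z k w| <= c) (Uc : forall k w, `|U k w| <= c).

Definition martingale n w : R := \sum_(k < n) (Z k w - U k w).

Let filtration_le m n : (m <= n)%N -> F m `<=` F n.
Proof.
have [_ _ Fi] := hF; elim: n => [|n ih]; first by rewrite leqn0 => /eqP->.
rewrite leq_eqVlt => /predU1P[->//|]; rewrite ltnS => /ih mn.
exact: subset_trans mn (Fi n).
Qed.

Lemma martingale_adapted n : measurable_wrt (F n) (martingale n).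
Proof.
have [sF _ _] := hF; apply/(measurable_wrtP _ (sF n)).
apply: measurable_sum => k; apply: measurable_funB; apply/(measurable_wrtP _ (sF n)).
  by move=> B mB; apply: (filtration_le (ltn_ord k)); exact: FZ.
move=> B mB; apply: (filtration_le (ltnW (ltn_ord k))).
by have [+ _ _] := ZU k; exact.
Qed.

Lemma martingale_bound n w : `|martingale n w| <= 2 * c * n%:R.
Proof.
apply: (le_trans (ler_norm_sum _ _ _)).
apply: (@le_trans _ _ (\sum_(k < n) (2 * c))).
  apply: ler_sum => k _; apply: (le_trans (ler_normB _ _)).
  by have := Zc k w; have := Uc k w; lra.
by rewrite sumr_const card_ord mulr_natr.
Qed.

Let wrt_measurable n (f : Omega -> R) : measurable_wrt (F n) f -> measurable_fun setT f.
Proof. by have [_ Fm _] := hF; move=> Ff _ B mB; rewrite setTI; apply: Fm; exact: Ff. Qed.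

Lemma measurable_martingale n : measurable_fun setT (martingale n).
Proof. exact: (wrt_measurable (@martingale_adapted n)). Qed.

(** Increments are orthogonal to the past, and centring an increment
    at its conditional expectation U k can only decrease its second moment. *)
Lemma martingale_variance n :
  \int[Pr]_w (martingale n w) ^+ 2 <= \sum_(k < n) \int[Pr]_w (Z k w) ^+ 2.
Proof.
have [sF Fm _] := hF; have Pr1 : Pr setT = 1%E by exact: probability_setT.
elim: n => [|n ih].
  rewrite big_ord0 (_ : (fun w => _) = cst 0); first by rewrite (Rintegral_cst1 0 Pr1).
  by apply/funext => w; rewrite /martingale big_ord0 expr0n.
rewrite big_ord_recr/=; apply: le_trans (lerD ih (lexx _)).
have Sn := @martingale_adapted n.
have mS := @measurable_martingale n.
have mZ := wrt_measurable (@FZ n).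
have FU : measurable_wrt (F n) (U n) by have [] := ZU n.
have mU := wrt_measurable FU.
have c0 : 0 <= c := le_trans (normr_ge0 _) (Zc 0 point).
have E1 := conditional_expectation_pullout (sF n) (Fm n) (ZU n) mZ (@Zc n) (@Uc n)
  Sn (@martingale_bound n).
have E2 := conditional_expectation_pullout (sF n) (Fm n) (ZU n) mZ (@Zc n) (@Uc n)
  FU (@Uc n).
have bM (f g : Omega -> R) (a b : R) : measurable_fun setT f -> measurable_fun setT g ->
    (forall w, `|f w| <= a) -> (forall w, `|g w| <= b) ->
    Pr.-integrable setT (EFin \o (fun w => f w * g w)).
  move=> mf mg fa gb; apply: (bounded_integrable Pr1 (c := a * b)).
    exact: measurable_funM.
  by move=> w; rewrite normrM ler_pM.
have iSS := bM _ _ _ _ mS mS (@martingale_bound n) (@martingale_bound n).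
have iSZ := bM _ _ _ _ mS mZ (@martingale_bound n) (@Zc n).
have iSU := bM _ _ _ _ mS mU (@martingale_bound n) (@Uc n).
have iZZ := bM _ _ _ _ mZ mZ (@Zc n) (@Zc n).
have iUZ := bM _ _ _ _ mU mZ (@Uc n) (@Zc n).
have iUU := bM _ _ _ _ mU mU (@Uc n) (@Uc n).
have i1 := integrableB measurableT iSZ iSU.
have i2 := integrableZl measurableT 2 i1.
have i3 := integrableB measurableT iUZ iUU.
have i4 := integrableZl measurableT 2 i3.
have i12 := integrableD measurableT iSS i2.
have i124 := integrableB measurableT i12 i4.
have i5 := integrableB measurableT iZZ iUU.
rewrite (@eq_Rintegral _ _ _ Pr _ (fun w =>
   (martingale n w * martingale n w
    + 2 * (martingale n w * Z n w - martingale n w * U n w)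
    - 2 * (U n w * Z n w - U n w * U n w)) + (Z n w * Z n w - U n w * U n w))); last first.
  by move=> w _; rewrite /martingale big_ord_recr/=; ring.
rewrite (RintegralD measurableT i124 i5) (RintegralB measurableT i12 i4).
rewrite (RintegralD measurableT iSS i2) (RintegralZl _ measurableT i1).
rewrite (RintegralZl _ measurableT i3) (RintegralB measurableT iSZ iSU).
rewrite (RintegralB measurableT iUZ iUU) (RintegralB measurableT iZZ iUU) E1 E2.
have : 0 <= \int[Pr]_w (U n w * U n w).
  by apply: Rintegral_ge0 => w _; rewrite -expr2 sqr_ge0.
under [X in _ <= X + _]eq_Rintegral do rewrite expr2.
under [X in _ <= _ + X]eq_Rintegral do rewrite expr2.
lra.
Qed.

End bounded_martingale.

(** Chebyshev in summed form: the second moments of the averages along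
    the times N j are summable. Arrays are allowed so that the truncation level
    may depend on j. *)
Lemma martingale_array_ae_cvg0 dO (Omega : measurableType dO) (R : realType)
    (Pr : probability Omega R) (F : nat -> set (set Omega))
    (Z U : nat -> nat -> Omega -> R) (c B : nat -> R) (N : nat -> nat) (C : R) :
  filtration F ->
  (forall j k, measurable_wrt (F k.+1) (Z j k)) ->
  (forall j k, is_conditional_expectation Pr (F k) (Z j k) (U j k)) ->
  (forall j k w, `|Z j k w| <= c j) -> (forall j k w, `|U j k w| <= c j) ->
  (forall j k, \int[Pr]_w (Z j k w) ^+ 2 <= B j) ->
  (forall j, (0 < N j)%N) ->
  (forall n, \sum_(j < n) B j / (N j)%:R <= C) ->
  {ae Pr, forall w,
    (fun j => (martingale (Z j) (U j) (N j) w / (N j)%:R) ^+ 2) @ \oo --> (0 : R)}.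
Proof.
move=> hF FZ ZU Zc Uc ZB N0 BC.
have Pr1 : Pr setT = 1%E by exact: probability_setT.
apply: (summable_ae_cvg0 (u := fun j => B j / (N j)%:R) _ _ _ BC) => [j|j w|j].
- apply: measurable_funX; apply: measurable_funM => //.
  exact: (measurable_martingale hF (FZ j) (ZU j)).
- exact: sqr_ge0.
have mS : measurable_fun setT (martingale (Z j) (U j) (N j)).
  exact: (measurable_martingale hF (FZ j) (ZU j)).
have Nj0 : 0 < (N j)%:R :> R by rewrite ltr0n.
have c0 : 0 <= c j := le_trans (normr_ge0 _) (Zc j 0 point).
have bS2 w : `|martingale (Z j) (U j) (N j) w ^+ 2| <= (2 * c j * (N j)%:R) ^+ 2.
  rewrite normrX lerXn2r ?nnegrE ?mulr_ge0//.
  exact: (martingale_bound (Zc j) (Uc j)).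
have iS := bounded_integrable Pr1 (measurable_funX 2 mS) bS2.
have SB : \int[Pr]_w (martingale (Z j) (U j) (N j) w) ^+ 2 <= (N j)%:R * B j.
  apply: (le_trans (martingale_variance hF (FZ j) (ZU j) (Zc j) (Uc j) (N j))).
  apply: (@le_trans _ _ (\sum_(k < N j) B j)); first exact: ler_sum.
  by rewrite sumr_const card_ord mulr_natl.
rewrite (eq_integral (fun w => ((N j)%:R ^- 2)%:E *
    ((martingale (Z j) (U j) (N j) w) ^+ 2)%:E)%E) => [|w _]; last first.
  by rewrite -EFinM expr_div_n mulrC.
rewrite integralZl// -EFin_Rintegral// -EFinM lee_fin.
apply: (@le_trans _ _ ((N j)%:R ^- 2 * ((N j)%:R * B j))).
  by rewrite ler_wpM2l// invr_ge0 sqr_ge0.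
rewrite le_eqVlt; apply/orP; left; apply/eqP; field.
by rewrite gt_eqF.
Qed.

(** Between consecutive squares r^2 and (r+1)^2 a Lipschitz sequence moves by
    O(r), negligible with respect to r^2. *)
Lemma cvg0_from_squares (R : realType) (a : nat -> R) (L : R) :
  (forall m n, (m <= n)%N -> `|a n - a m| <= L * (n - m)%:R) ->
  (fun j => (a (j.+1 ^ 2)%N / (j.+1 ^ 2)%:R) ^+ 2) @ \oo --> (0 : R) ->
  (fun n => n%:R^-1 * a n) @ \oo --> (0 : R).
Proof.
move=> aL a0; apply/cvgrPdist_le => e e0.
have L0 : 0 <= L.
  by have := aL 0%N 1%N isT; rewrite subn0 mulr1; exact: le_trans.
have e2 : 0 < (e / 2) ^+ 2 by rewrite exprn_gt0// divr_gt0.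
have /cvgrPdist_le/(_ _ e2)[J _ hJ] := a0.
have Le : 0 <= 4 * L / e by rewrite divr_ge0 ?mulr_ge0// ltW.
(* beyond K the gap between squares is small as well *)
pose K := (maxn J (Num.truncn (4 * L / e)).+1).
exists (K.+1 ^ 2)%N => //= n Kn0; have Kn : (K.+1 ^ 2 <= n)%N := Kn0.
have [r [rn nr Kr]] : exists r, [/\ (r.+1 ^ 2 <= n)%N, (n < r.+2 ^ 2)%N & (K <= r)%N].
  elim: n Kn {Kn0} => [|n ih] Kn; first by move: Kn; rewrite leqNgt expn_gt0.
  move: Kn; rewrite leq_eqVlt => /predU1P[<-|].
    by exists K; split => //; rewrite ltn_sqr.
  rewrite ltnS => /ih[r [rn nr Kr]].
  move: nr; rewrite leq_eqVlt => /predU1P[E|nr].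
    by exists r.+1; split; [rewrite E|rewrite E ltn_sqr|exact: leqW].
  by exists r; split => //; exact: leqW.
have q0 : (0 < r.+1 ^ 2)%N by rewrite expn_gt0.
have n0 : (0 < n)%N := leq_trans q0 rn.
have n0' : 0 < n%:R :> R by rewrite ltr0n.
rewrite sub0r normrN normrM gtr0_norm ?invr_gt0// mulrC ler_pdivrMr//.
have h1 : `|a (r.+1 ^ 2)%N| <= e / 2 * (r.+1 ^ 2)%:R.
  have := hJ r (leq_trans (leq_maxl _ _) Kr); rewrite /= sub0r normrN.
  rewrite ger0_norm ?sqr_ge0// -[leLHS]real_normK ?num_real//.
  rewrite ler_sqr ?nnegrE ?divr_ge0 ?(ltW e0)//.
  by rewrite normf_div [`|_%:R|]ger0_norm// ler_pdivrMr ?ltr0n.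
have h2 := aL _ _ rn.
have h3 : L * (n - r.+1 ^ 2)%:R <= e / 2 * n%:R.
  have gap : (n - r.+1 ^ 2 <= 2 * r.+1)%N.
    by rewrite leq_subLR -ltnS (leq_trans nr)// -[r.+2]addn1 sqrnD exp1n muln1 addn1 addSn.
  apply: (@le_trans _ _ (L * (2 * r.+1%:R))).
    by rewrite ler_wpM2l// -natrM ler_nat.
  apply: (@le_trans _ _ (e / 2 * (r.+1 ^ 2)%:R)); last first.
    by rewrite ler_wpM2l ?divr_ge0 ?(ltW e0)// ler_nat.
  have h4 : 4 * L <= e * r.+1%:R.
    rewrite [leRHS]mulrC -ler_pdivrMr//; apply/ltW/(lt_le_trans (truncnS_gt _)).
    rewrite ler_nat; apply: leqW; exact: leq_trans (leq_maxr _ _) Kr.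
  have r0 : 0 <= r.+1%:R :> R by [].
  have := ler_wpM2r r0 h4; rewrite natrX expr2; lra.
have h5 : e / 2 * (r.+1 ^ 2)%:R <= e / 2 * n%:R.
  by rewrite ler_wpM2l ?divr_ge0 ?(ltW e0)// ler_nat.
have := ler_normD (a n - a (r.+1 ^ 2)%N) (a (r.+1 ^ 2)%N); rewrite subrK.
lra.
Qed.

Lemma sum_inv_squares (R : realType) (n : nat) :
  \sum_(j < n) ((j.+1 ^ 2)%:R)^-1 <= (2 : R).
Proof.
case: n => [|n]; first by rewrite big_ord0.
suff : \sum_(j < n.+1) ((j.+1 ^ 2)%:R)^-1 <= 2 - n.+1%:R^-1 :> R.
  by move=> /le_trans; apply; rewrite gerBl invr_ge0.
elim: n => [|n ih]; first by rewrite big_ord1 exp1n invr1; lra.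
rewrite big_ord_recr/=; apply: (le_trans (lerD ih (lexx _))).
rewrite natrX (_ : n.+2%:R = n.+1%:R + 1 :> R); last by rewrite natr1.
have : 0 < n.+1%:R :> R by rewrite ltr0n.
move: (n.+1%:R : R) => x x0.
rewrite -subr_ge0 (_ : _ - _ = (x * (x + 1) ^+ 2)^-1).
  by rewrite invr_ge0 mulr_ge0 ?sqr_ge0// ltW.
by field; rewrite !gt_eqF//; lra.
Qed.

Lemma sum_geometric_le (R : realType) (r : R) (n : nat) : 0 <= r < 1 ->
  \sum_(j < n) r ^+ j <= (1 - r)^-1.
Proof.
move=> /andP[r0 r1]; rewrite -[leRHS]mul1r ler_pdivlMr ?subr_gt0//.
have -> : (\sum_(j < n) r ^+ j) * (1 - r) = 1 - r ^+ n.
  by rewrite mulrC -[X in X * _]opprB mulNr -subrX1 opprB.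
by rewrite gerBl exprn_ge0.
Qed.

(** * Deterministic time averages and approximation of closed sets *)

Definition time_average (R : realType) (u : nat -> R) (n : nat) : R :=
  n%:R^-1 * \sum_(k < n) u k.

Section time_averages.
Context (R : realType).
Implicit Types (a b q t u v : nat -> R).

Lemma time_averageD a b n :
  time_average (fun k => a k + b k) n = time_average a n + time_average b n.
Proof. by rewrite /time_average big_split/= mulrDr. Qed.

Lemma time_averageB a b n :
  time_average (fun k => a k - b k) n = time_average a n - time_average b n.
Proof. by rewrite /time_average sumrB mulrBr. Qed.

Lemma time_average_cst (c : R) : time_average (fun=> c) @ \oo --> c.
Proof.
apply: cvg_near_cst; exists 1%N => // -[//|n] _.
by rewrite /time_average sumr_const card_ord -[c *+ _]mulr_natl mulrA mulVf ?mul1r.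
Qed.

Lemma time_average_le a b n : (forall k, a k <= b k) ->
  time_average a n <= time_average b n.
Proof. by move=> ab; rewrite ler_wpM2l ?invr_ge0// ler_sum. Qed.

Lemma time_average_norm_le a b n : (forall k, `|a k| <= b k) ->
  `|time_average a n| <= time_average b n.
Proof.
move=> ab; rewrite normrM ger0_norm ?invr_ge0// ler_wpM2l ?invr_ge0//.
by apply: (le_trans (ler_norm_sum _ _ _)); exact: ler_sum.
Qed.

Lemma time_average_bound v (C : R) n : 0 <= C ->
  \sum_(k < n) v k <= C * n%:R -> time_average v n <= C.
Proof.
case: n => [|n] C0 vC; first by rewrite /time_average big_ord0 mulr0.
by rewrite /time_average ler_pdivrMl ?ltr0n// mulrC.
Qed.

(** The sequences b and b' and their limits may depend on e. *)
Lemma sandwich_time_average u (l : R) :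
  (forall e : R, 0 < e -> exists b b' (l1 l2 : R),
    [/\ forall k, b k <= u k <= b' k, time_average b @ \oo --> l1,
        time_average b' @ \oo --> l2, l - e <= l1 & l2 <= l + e]) ->
  time_average u @ \oo --> l.
Proof.
move=> h; apply/cvgrPdist_le => e e0.
have e2 : 0 < e / 2 by rewrite divr_gt0.
have [b [b' [l1 [l2 [ub cb cb' h1 h2]]]]] := h _ e2.
have /cvgrPdist_le/(_ _ e2) B := cb; have /cvgrPdist_le/(_ _ e2) B' := cb'.
move: B B'; apply: filterS2 => n; rewrite !ler_norml => /andP[? ?] /andP[? ?].
have bu : time_average b n <= time_average u n.
  by apply: time_average_le => k; have /andP[] := ub k.
have ub' : time_average u n <= time_average b' n.
  by apply: time_average_le => k; have /andP[] := ub k.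
by apply/andP; split; lra.
Qed.

(** Errors small relative to v are harmless because the averages of v stay
    bounded. *)
Lemma approx_time_average u v (C l : R) : 0 <= C ->
  (forall n, \sum_(k < n) v k <= C * n%:R) ->
  (forall e : R, 0 < e -> exists b (l' : R),
    [/\ forall k, `|u k - b k| <= e * v k, time_average b @ \oo --> l'
      & `|l - l'| <= e]) ->
  time_average u @ \oo --> l.
Proof.
move=> C0 vC h; apply/cvgrPdist_le => e e0.
have [r e1 eE] : exists2 r : R, 0 < r & r * (2 + C) = e.
  by exists (e / (2 + C)); [rewrite divr_gt0// ltr_pwDl|rewrite divfK// gt_eqF// ltr_pwDl].
have [b [l' [ub cb ll']]] := h _ e1.
have /cvgrPdist_le/(_ _ e1) := cb; apply: filterS => n hn.
have h1 : `|time_average u n - time_average b n| <= r * C.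
  rewrite -time_averageB.
  apply: (le_trans (time_average_norm_le (b := fun k => r * v k) _ _)) => //.
  apply: time_average_bound; first by rewrite mulr_ge0// ltW.
  by rewrite -mulr_sumr -mulrA ler_wpM2l// ltW.
have -> : l - time_average u n = (l - l') + (l' - time_average b n)
    - (time_average u n - time_average b n) by ring.
apply: (le_trans (ler_normB _ _)).
have := ler_normD (l - l') (l' - time_average b n); lra.
Qed.

(** Passage from the kernels of the process to a limiting one, with
    a k = f(x_k), t k the action of the k-th kernel on f at x_k and q k that of
    the limiting kernel. Shifting the index costs two boundary terms; t - q is
    small while v stays below r, and v exceeds r at most a fraction C / r of
    the time. *)
Lemma perturbed_time_average a t q v (c C : R) :
  0 <= C -> (forall n, \sum_(k < n) v k <= C * n%:R) -> (forall k, 0 <= v k) ->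
  (forall k, `|a k| <= c) -> (forall k, `|t k| <= c) -> (forall k, `|q k| <= c) ->
  time_average (fun k => a k.+1 - t k) @ \oo --> (0 : R) ->
  (forall r eta : R, 0 < r -> 0 < eta ->
    \forall k \near \oo, v k <= r -> `|t k - q k| <= eta) ->
  time_average (fun k => a k - q k) @ \oo --> (0 : R).
Proof.
move=> C0 vC v0 ac tc qc at0 tq; apply/cvgrPdist_le => e e0.
have c0 : 0 <= c := le_trans (normr_ge0 _) (ac 0%N).
have e4 : 0 < e / 4 by rewrite divr_gt0.
(* so that the time spent above level r costs at most e / 4 *)
pose r := 8 * c * C / e + 1.
have r0 : 0 < r by rewrite ltr_pwDr// divr_ge0 ?mulr_ge0// ltW.
have [K _ hK] := tq _ _ r0 e4.
have rE : 2 * c / r * C <= e / 4.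
  have -> : 2 * c / r * C = 2 * c * C / r by ring.
  rewrite ler_pdivrMr// /r mulrDr.
  have -> : e / 4 * (8 * c * C / e) = 2 * c * C by field; rewrite gt_eqF.
  by rewrite mulr1 lerDl ltW.
(* three cases: v k <= r, v k > r, and the finitely many k < K *)
have bound k : `|t k - q k| <= e / 4 + 2 * c / r * v k + (k < K)%:R * (2 * c).
  have cv0 : 0 <= 2 * c / r * v k by rewrite mulr_ge0 ?divr_ge0 ?mulr_ge0// ltW.
  have tq2 : `|t k - q k| <= 2 * c.
    by apply: (le_trans (ler_normB _ _)); have := tc k; have := qc k; lra.
  have [kK|Kk] := ltnP k K; first by rewrite mul1r; lra.
  rewrite mul0r addr0; have [vr|rv] := leP (v k) r.
    by have := hK k Kk vr; lra.
  have : 2 * c <= 2 * c / r * v k.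
    by rewrite mulrAC ler_pdivlMr// ler_wpM2l ?mulr_ge0// ltW.
  lra.
have sumK n : \sum_(k < n) ((k < K)%:R * (2 * c)) <= K%:R * (2 * c).
  rewrite -mulr_suml ler_wpM2r ?mulr_ge0// -natr_sum ler_nat.
  have -> : (\sum_(k < n) (k < K) = minn n K)%N.
    elim: n => [|n ih]; first by rewrite big_ord0 min0n.
    rewrite big_ord_recr/= ih; have [nK|Kn] := ltnP n K.
      by rewrite (minn_idPl nK) addn1.
    by rewrite addn0 (minn_idPr (leqW Kn)).
  exact: geq_minr.
have tele n : \sum_(k < n) (a k - q k) =
    \sum_(k < n) (a k.+1 - t k) + (a 0%N - a n) + \sum_(k < n) (t k - q k).
  elim: n => [|n ih]; first by rewrite !big_ord0 subrr !addr0.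
  by rewrite !big_ord_recr/= ih; ring.
pose D := 2 * c + K%:R * (2 * c).
have D0 : 0 <= D by rewrite addr_ge0 ?mulr_ge0.
have /cvgrPdist_le/(_ _ e4) := at0.
pose N := (Num.truncn (D / (e / 4))).+1.
have : \forall n \near \oo, (N <= n)%N by exists N.
apply: filterS2 => n Nn; rewrite !sub0r !normrN => hn.
have n0 : (0 < n)%N := leq_trans (ltn0Sn _) Nn.
have n0' : 0 < n%:R :> R by rewrite ltr0n.
have hD : D <= e / 4 * n%:R.
  rewrite mulrC -ler_pdivrMr//; apply/ltW/(lt_le_trans (truncnS_gt _)).
  by rewrite ler_nat.
move: hn; rewrite /time_average !normrM gtr0_norm ?invr_gt0// mulrC ler_pdivrMr// => hn.
rewrite mulrC ler_pdivrMr// tele.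
apply: (le_trans (ler_normD _ _)).
have h2 : `|\sum_(k < n) (t k - q k)| <= e / 4 * n%:R + e / 4 * n%:R + K%:R * (2 * c).
  apply: (le_trans (ler_norm_sum _ _ _)).
  apply: (@le_trans _ _ (\sum_(k < n) (e / 4 + 2 * c / r * v k + (k < K)%:R * (2 * c)))).
    by apply: ler_sum => k _.
  rewrite !big_split/=; apply: lerD (sumK n); apply: lerD.
    by rewrite sumr_const card_ord mulr_natr.
  rewrite -mulr_sumr; apply: (@le_trans _ _ (2 * c / r * (C * n%:R))).
    by apply: ler_wpM2l (vC n); apply: divr_ge0 (ltW r0); exact: mulr_ge0.
  by rewrite mulrA ler_wpM2r.
have h3 := ler_normD (\sum_(k < n) (a k.+1 - t k)) (a 0%N - a n).
have h4 : `|a 0%N - a n| <= 2 * c.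
  by apply: (le_trans (ler_normB _ _)); have := ac 0%N; have := ac n; lra.
rewrite /D in hD; lra.
Qed.

(** With g m the m-th iterate along the path, telescoping makes g 0 equivalent
    to g m on average, and g m is close to l relative to v for large m. *)
Lemma contraction_time_average (g : nat -> nat -> R) v (C D rho l : R) :
  0 <= C -> (forall n, \sum_(k < n) v k <= C * n%:R) -> 0 <= rho < 1 -> 0 <= D ->
  (forall k, 0 <= v k) ->
  (forall m, time_average (fun k => g m k - g m.+1 k) @ \oo --> (0 : R)) ->
  (forall m k, `|g m k - l| <= D * rho ^+ m * v k) ->
  time_average (g 0%N) @ \oo --> l.
Proof.
move=> C0 vC /andP[rho0 rho1] D0 v0 gS gl.
apply: (approx_time_average C0 vC) => e e0.
have e1 : 0 < e / (1 + D) by rewrite divr_gt0// ltr_pwDl.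
have rho1' : `|rho| < 1 by rewrite ger0_norm.
have /cvgrPdist_le/(_ _ e1)[m _ /(_ m (leqnn m))/=] := cvg_expr rho1'.
rewrite sub0r normrN ger0_norm ?exprn_ge0// ler_pdivlMr ?ltr_pwDl// => hm.
exists (fun k => g 0%N k - g m k + l), l; split; last by rewrite subrr normr0 ltW.
- move=> k; have -> : g 0%N k - (g 0%N k - g m k + l) = g m k - l by ring.
  apply: (le_trans (gl m k)); rewrite ler_wpM2r//.
  by have := exprn_ge0 m rho0; lra.
- have tele i : time_average (fun k => g 0%N k - g i k) @ \oo --> (0 : R).
    elim: i => [|i ih].
      rewrite (_ : (fun k => _) = fun=> 0); first exact: time_average_cst.
      by apply/funext => k; rewrite subrr.
    rewrite (_ : time_average _ = fun n => time_average (fun k => g 0%N k - g i k) n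
        + time_average (fun k => g i k - g i.+1 k) n).
      by rewrite -[X in _ --> X]addr0; exact: cvgD.
    apply/funext => n; rewrite -time_averageD; congr time_average.
    by apply/funext => k; ring.
  rewrite (_ : time_average _ = fun n => time_average (fun k => g 0%N k - g m k) n
        + time_average (fun=> l) n).
    by rewrite -[X in _ --> X]add0r; apply: cvgD => //; exact: time_average_cst.
  by apply/funext => n; rewrite -time_averageD.
Qed.

(** Summing the drift inequality bounds the sum of v by a multiple of the time at
    the times 2^j; monotonicity of the partial sums of v >= 0 fills the
    gaps at the price of a factor 2, and the first 2^J terms go into the
    constant. *)
Lemma dyadic_drift_bound v (lambda B : R) (J : nat) :
  (forall k, 0 <= v k) -> 0 <= lambda < 1 -> 0 <= B ->
  (forall j, (J <= j)%N -> \sum_(k < 2 ^ j) v k.+1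
     <= (2 ^ j)%:R + \sum_(k < 2 ^ j) (lambda * v k + B)) ->
  exists2 C : R, 0 <= C & forall n, \sum_(k < n) v k <= C * n%:R.
Proof.
move=> v0 /andP[lam0 lam1] B0 h.
pose A n := \sum_(k < n) v k.
have A0 n : 0 <= A n by exact: sumr_ge0.
have AS n : A n <= A n.+1 by rewrite /A big_ord_recr/= lerDl.
have Amono : {homo A : m n / (m <= n)%N >-> m <= n}.
  by apply: homo_leq => //; exact: le_trans.
pose C1 := (v 0%N + 1 + B) / (1 - lambda).
have C10 : 0 <= C1 by rewrite divr_ge0 ?subr_ge0 ?(ltW lam1)// !addr_ge0.
have dyadic j : (J <= j)%N -> A (2 ^ j)%N <= C1 * (2 ^ j)%:R.
  move=> /h; set N := (2 ^ j)%N => hj.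
  have N1 : 1 <= N%:R :> R by rewrite ler1n expn_gt0.
  rewrite /C1 mulrAC ler_pdivlMr ?subr_gt0//.
  have : A N.+1 = v 0%N + \sum_(k < N) v k.+1 by rewrite /A big_ord_recl.
  have := AS N.
  move: hj; rewrite big_split/= -mulr_sumr sumr_const card_ord -[B *+ _]mulr_natr -/(A N).
  have : v 0%N <= v 0%N * N%:R by rewrite ler_peMr.
  lra.
exists (C1 * (2 ^ J.+1)%:R) => [|n]; first by rewrite mulr_ge0.
case: n => [|n]; first by rewrite big_ord0 mulr_ge0// mulr_ge0.
pose j := maxn J (trunc_log 2 n.+1).+1.
have nj : (n.+1 <= 2 ^ j)%N.
  apply/ltnW/(leq_trans (trunc_log_ltn n.+1 (isT : (1 < 2)%N))).
  by rewrite leq_exp2l// leq_maxr.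
have jn : (2 ^ j <= 2 ^ J.+1 * n.+1)%N.
  rewrite /j; have [_|_] := leqP J (trunc_log 2 n.+1).+1.
    rewrite expnS [X in (_ <= X * _)%N]expnS -mulnA leq_mul2l/=.
    apply: (leq_trans (trunc_logP (isT : (1 < 2)%N) (ltn0Sn n))).
    by rewrite leq_pmull// expn_gt0.
  by rewrite expnS mulnC mulnA leq_pmull.
apply: (le_trans (Amono _ _ nj)); apply: (le_trans (dyadic j (leq_maxl _ _))).
by rewrite -mulrA ler_wpM2l// -natrM ler_nat.
Qed.

End time_averages.

Section closed_set_approximation.
Context (R : realType) (T : topologicalType) (dist : T -> T -> R).
Hypothesis hdist : complete_metric_for dist.

Let dist_refl x : dist x x = 0.
Proof. by have [d0 _ _ _ _] := hdist; exact/d0. Qed.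

Let dist_sym x y : dist x y = dist y x.
Proof. by have [_ + _ _ _] := hdist. Qed.

Let dist_tri x y z : dist x z <= dist x y + dist y z.
Proof. by have [_ _ + _ _] := hdist. Qed.

Let dist_ge0 x y : 0 <= dist x y.
Proof. by have := dist_tri x y x; rewrite dist_refl (dist_sym y x); lra. Qed.

Let bump (n : nat) (x y : T) : R := maxr 0 (1 - n%:R * dist x y).

(** A continuous approximation from above of the indicator of F, equal to
    max(0, 1 - n d(x,F)) when F is nonempty. The supremum over F also gives the
    right value 0 for the empty set. *)
Definition closed_bump (F : set T) (n : nat) (x : T) : R :=
  sup [set bump n x y | y in F].

Let bump_itv n x y : 0 <= bump n x y <= 1.
Proof.
rewrite le_max lexx/= ge_max ler01/= lerBlDr lerDl mulr_ge0//.
Qed.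

Let bump_ub F n x : ubound [set bump n x y | y in F] 1.
Proof. by move=> _ [y _ <-]; have /andP[] := bump_itv n x y. Qed.

Lemma closed_bump_itv F n x : 0 <= closed_bump F n x <= 1.
Proof.
have [->|/set0P[y Fy]] := eqVneq F set0.
  by rewrite /closed_bump image_set0 sup0 lexx ler01.
have ne : [set bump n x y | y in F] !=set0 by exists (bump n x y); exists y.
apply/andP; split; last by apply: ge_sup => //; exact: bump_ub.
apply: (le_trans (proj1 (andP (bump_itv n x y)))); apply: ub_le_sup.
  by exists 1; exact: bump_ub.
by exists y.
Qed.

Lemma closed_bump1 F n x : F x -> closed_bump F n x = 1.
Proof.
move=> Fx; apply/eqP; rewrite eq_le; have /andP[_ ->] := closed_bump_itv F n x.
apply: ub_le_sup; first by exists 1; exact: bump_ub.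
by exists x => //; rewrite /bump dist_refl mulr0 subr0 max_r.
Qed.

Lemma closed_bump_lip F n x x' :
  closed_bump F n x <= closed_bump F n x' + n%:R * dist x x'.
Proof.
have [->|/set0P[y0 Fy0]] := eqVneq F set0.
  by rewrite /closed_bump !image_set0 sup0 add0r mulr_ge0.
apply: ge_sup; first by exists (bump n x y0); exists y0.
move=> _ [y Fy <-].
apply: (@le_trans _ _ (bump n x' y + n%:R * dist x x')); last first.
  by rewrite lerD2r; apply: ub_le_sup; [exists 1; exact: bump_ub|exists y].
have := ler_wpM2l (ler0n R n) (dist_tri x' x y); rewrite mulrDr (dist_sym x' x) => h.
have := mulr_ge0 (ler0n R n) (dist_ge0 x x') => h0.
rewrite /bump ge_max; apply/andP; split.
  by rewrite addr_ge0// le_max lexx.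
have : 1 - n%:R * dist x' y <= maxr 0 (1 - n%:R * dist x' y) by rewrite le_max lexx orbT.
lra.
Qed.

Lemma continuous_closed_bump F n : continuous (closed_bump F n).
Proof.
move=> x; apply/cvgrPdist_le => e e0.
have [_ _ _ hn _] := hdist; apply/hn.
have e1 : 0 < e / n.+1%:R by rewrite divr_gt0.
exists (e / n.+1%:R) => // y /= xy.
have nxy : n%:R * dist x y <= e.
  apply: (@le_trans _ _ (n.+1%:R * dist x y)).
    by rewrite ler_wpM2r// ler_nat.
  by move: xy; rewrite ltr_pdivlMr// mulrC => /ltW.
have := closed_bump_lip F n x y; have := closed_bump_lip F n y x.
rewrite (dist_sym y x) ler_norml => ? ?.
by apply/andP; split; lra.
Qed.

Lemma closed_bump_cvg F x : closed F ->
  (fun n => closed_bump F n x) @ \oo --> (\1_F x : R).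
Proof.
move=> cF; have [Fx|nFx] := pselect (F x).
  rewrite indicE mem_set//; apply: cvg_near_cst; apply: nearW => n.
  exact: closed_bump1.
rewrite indicE memNset//.
have [_ _ _ hn _] := hdist.
have : nbhs x (~` F) by apply: open_nbhs_nbhs; split => //; exact: closed_openC.
move=> /hn[e e0 eF].
apply: cvg_near_cst; exists (Num.truncn e^-1).+1 => // n /= en.
have n1 : 1 <= n%:R * e.
  rewrite -ler_pdivrMr// mul1r; apply/ltW/(lt_le_trans (truncnS_gt _)).
  by rewrite ler_nat.
apply/eqP; rewrite eq_le; have /andP[-> _] := closed_bump_itv F n x.
rewrite andbT; have [F0|/set0P[y Fy]] := eqVneq F set0.
  by rewrite /closed_bump F0 image_set0 sup0.
apply: ge_sup; first by exists (bump n x y); exists y.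
move=> _ [z Fz <-]; rewrite /bump ge_max lexx/= subr_le0 (le_trans n1)// ler_wpM2l//.
by rewrite leNgt; apply/negP => /eF; exact.
Qed.

End closed_set_approximation.

(** * The tempering process *)

(** The conditional expectation is only given for bounded functions: W is
    truncated at level N and N goes to infinity by monotone convergence. *)
Lemma transition_moment dO (Omega : measurableType dO) (R : realType)
    (Pr : probability Omega R) (G : set (set Omega)) d (S : measurableType d)
    (X : Omega -> S) (K : Omega -> {measure set S -> \bar R})
    (W : S -> R) (g : Omega -> R) :
  G setT -> measurable_fun setT X -> (forall w, K w setT = 1%E) ->
  (forall f : S -> R, measurable_fun setT f -> is_bounded f ->
    is_conditional_expectation Pr G (fun w => f (X w)) (fun w => \int[K w]_y f y)) ->
  measurable_fun setT W -> (forall x, 0 <= W x) ->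
  measurable_fun setT g ->
  (forall w, \int[K w]_y (W y)%:E <= (g w)%:E)%E ->
  (\int[Pr]_w (W (X w))%:E <= \int[Pr]_w (g w)%:E)%E.
Proof.
move=> GT mX K1 hK mW W0 mg Wg.
pose f (N : nat) x := minr (W x) N%:R.
have mf N : measurable_fun setT (f N) by exact: measurable_minr.
have f0 N x : 0 <= f N x by rewrite le_min W0/=.
have fN N x : `|f N x| <= N%:R by rewrite ger0_norm// ge_min lexx orbT.
have fW N x : f N x <= W x by rewrite ge_min lexx.
have mfX N : measurable_fun setT (fun w => (f N (X w))%:E).
  by apply/measurable_EFinP; exact: (measurableT_comp (mf N) mX).
have : (fun N => \int[Pr]_w (f N (X w))%:E)%E @ \oo --> (\int[Pr]_w (W (X w))%:E)%E.
  rewrite (_ : (fun w => (W (X w))%:E) = fun w => limn (fun N => (f N (X w))%:E)).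
    apply: cvg_monotone_convergence => //.
    - by move=> N w _; rewrite lee_fin.
    - by move=> w _ a b ab; rewrite lee_fin le_min ge_min lexx/= ge_min ler_nat ab orbT.
  apply/funext => w; apply/esym/cvg_lim => //; apply: cvg_near_cst.
  exists (Num.truncn (W (X w))).+1 => // N /= hN.
  rewrite /f min_l//; apply/ltW/(lt_le_trans (truncnS_gt _)).
  by rewrite ler_nat.
move=> /cvg_lim <-//; apply: lime_le.
  apply: ereal_nondecreasing_is_cvgn => a b ab; apply: ge0_le_integral => //.
  - by move=> w _; rewrite lee_fin.
  - by move=> w _; rewrite lee_fin le_min ge_min lexx/= ge_min ler_nat ab orbT.
apply: nearW => N.
have [|_ iV ->//] := hK (f N) (mf N); first by exists N%:R => _ [x _ <-].
have g0 w : 0 <= g w.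
  by rewrite -lee_fin (le_trans _ (Wg w))// integral_ge0// => x _; rewrite lee_fin.
apply: ge0_le_integral => //.
- by move=> w _; rewrite lee_fin Rintegral_ge0.
- exact: measurable_int iV.
- exact/measurable_EFinP.
- move=> w _; apply: le_trans (Wg w).
  rewrite EFin_Rintegral; last exact: (bounded_integrable (K1 w) (mf N) (@fN N)).
  apply: ge0_le_integral => //.
  + by move=> x _; rewrite lee_fin.
  + exact/measurable_EFinP.
  + exact/measurable_EFinP.
  + by move=> x _; rewrite lee_fin.
Qed.

(** Iterating the contraction, g m stays within rho^m c (1 + kappa V) of some
    constant; the common mean of the g m under Pi is within the corresponding
    distance of that constant. *)
Lemma harris_iterates d (T : measurableType d) (R : realType)
    (V : T -> R) (Q : T -> {measure set T -> \bar R}) (lambda b : R)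
    (Pi : probability T R) (g : nat -> T -> R) (c : R) :
  measurable_fun setT V -> (forall x, 1 <= V x) ->
  (forall x, Q x setT = 1%E) ->
  (forall x, \int[Q x]_y (V y)%:E <= (lambda * V x + b)%:E)%E ->
  0 <= lambda < 1 -> 0 <= b ->
  (forall r, 1 < r -> one_small Q [set x | V x <= r]) ->
  (\int[Pi]_x (V x)%:E < +oo)%E ->
  (forall m, measurable_fun setT (g m)) -> (forall m x, `|g m x| <= c) ->
  (forall m, g m.+1 = kernel_act Q (g m)) ->
  (forall m, \int[Pi]_x g m x = \int[Pi]_x g 0%N x) ->
  exists rho D : R, [/\ 0 <= rho < 1, 0 <= D &
    forall m x, `|g m x - \int[Pi]_x g 0%N x| <= D * rho ^+ m * V x].
Proof.
move=> mV V1 Q1 drift lam01 b0 small PiV mg gc gS gPi.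
have [kappa [rho [kappa0 rho01 contr]]] := harris_contraction mV V1 Q1 drift lam01 b0 small.
have /andP[rho0 rho1] := rho01.
have c0 : 0 <= c := le_trans (normr_ge0 _) (gc 0%N point).
have Pi1 : Pi setT = 1%E by exact: probability_setT.
have iV : Pi.-integrable setT (EFin \o V).
  apply/integrableP; split; first exact/measurable_EFinP.
  rewrite (eq_integral (EFin \o V))// => x _.
  by rewrite /= ger0_norm// (le_trans ler01).
have centre m : exists e, forall x, `|g m x - e| <= rho ^+ m * c * (1 + kappa * V x).
  elim: m => [|m [e he]].
    exists 0 => x; rewrite subr0 mul1r (le_trans (gc _ _))// ler_peMr// lerDl.
    by rewrite mulr_ge0 ?(ltW kappa0)// (le_trans ler01).
  have D0 : 0 <= rho ^+ m * c by rewrite mulr_ge0// exprn_ge0.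
  have [e' he'] := contr _ _ _ _ (mg m) (gc m) D0 he.
  by exists e' => x; rewrite gS exprS -(mulrA rho); exact: he'.
pose v := \int[Pi]_x V x.
have v0 : 0 <= v by apply: Rintegral_ge0 => x _; rewrite (le_trans ler01).
exists rho, (c * (2 + kappa + kappa * v)); split => // [|m x].
  by rewrite mulr_ge0// !addr_ge0// ?mulr_ge0// ltW.
have [e he] := centre m.
have D0 : 0 <= rho ^+ m * c by rewrite mulr_ge0// exprn_ge0.
have ig := bounded_integrable Pi1 (mg m) (gc m).
have ie : Pi.-integrable setT (EFin \o cst e).
  by apply: (bounded_integrable Pi1 (c := `|e|)).
have ikV := integrableZl measurableT kappa iV.
have i1 : Pi.-integrable setT (EFin \o cst 1).
  by apply: (bounded_integrable Pi1 (c := `|1|)).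
have iH := integrableZl measurableT (rho ^+ m * c) (integrableD measurableT i1 ikV).
have mean : `|\int[Pi]_x g 0%N x - e| <= rho ^+ m * c * (1 + kappa * v).
  rewrite -(gPi m) -[X in _ - X](Rintegral_cst1 e Pi1) -RintegralB//.
  have ige := integrableB measurableT ig ie.
  apply: (le_trans (le_normr_Rintegral measurableT ige)).
  have <- : \int[Pi]_x (rho ^+ m * c * (1 + kappa * V x)) = rho ^+ m * c * (1 + kappa * v).
    rewrite (RintegralZl _ measurableT (integrableD measurableT i1 ikV)).
    rewrite (RintegralD measurableT i1 ikV) (Rintegral_cst1 1 Pi1).
    by rewrite (RintegralZl _ measurableT iV).
  by apply: le_Rintegral => //; exact: integrable_norm.
have -> : g m x - \int[Pi]_x g 0%N x = (g m x - e) - (\int[Pi]_x g 0%N x - e) by ring.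
apply: (le_trans (ler_normB _ _)); apply: (le_trans (lerD (he x) mean)).
have kv : 0 <= kappa * v * (V x - 1) by rewrite !mulr_ge0 ?(ltW kappa0)// subr_ge0.
have := ler_wpM2l D0 (_ : 1 + kappa * V x + (1 + kappa * v)
  <= (2 + kappa + kappa * v) * V x); rewrite mulrDr => /(_ _)/le_trans; apply.
  by have := V1 x; nra.
by rewrite le_eqVlt; apply/orP; left; apply/eqP; ring.
Qed.

Section tempering_process.
Context (R : realType) d (S : borelType d) (upsilon : {i01 R})
  (P : R.-pker S ~> S) (p : {mfun S >-> R}) (beta : R)
  dO (Omega : measurableType dO) (Pr : probability Omega R)
  (Y X : nat -> {RV Pr >-> S}) (F : nat -> set (set Omega)).
Local Notation u := (upsilon%:num).
Local Notation Pth := (tempering_kernel upsilon P p beta).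
Local Notation K n w := (Pth (empirical R (fun k => Y k w) n) (X n w)).
Hypotheses (hF : filtration F) (u01 : 0 < u < 1).
Hypothesis adapted : forall n, measurable_wrt (F n) (X n).
Hypothesis transition : forall (n : nat) (f : S -> R),
  measurable_fun setT f -> is_bounded f ->
  is_conditional_expectation Pr (F n) (fun w => f (X n.+1 w))
    (fun w => \int[K n w]_y f y).

Let Pr1 : Pr setT = 1%E. Proof. exact: probability_setT. Qed.

Let K1 n w : K n w setT = 1%E. Proof. exact: tempering_kernel_setT. Qed.

Let FT n : F n setT.
Proof. by have [sF _ _] := hF; case: (sF n) => G0 GC _; rewrite -[setT]setD0; exact: GC. Qed.

Let adapted_next n (f : S -> R) : measurable_fun setT f ->
  measurable_wrt (F n.+1) (fun w => f (X n.+1 w)).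
Proof.
by move=> mf B mB; apply: (@adapted n.+1 (f @^-1` B)); rewrite -[_ @^-1` _]setTI; exact: mf.
Qed.

(** The second moments of the averages are of order 1/n, hence summable along
    the squares, and the partial sums have bounded increments. *)
Lemma bounded_lln (f : S -> R) (c : R) :
  measurable_fun setT f -> (forall x, `|f x| <= c) ->
  {ae Pr, forall w,
    time_average (fun k => f (X k.+1 w) - kernel_act (Pth (empirical R (fun k => Y k w) k)) f (X k w))
      @ \oo --> (0 : R)}.
Proof.
move=> mf fc.
have fb : is_bounded f by exists c => _ [x _ <-].
pose Z k w := f (X k.+1 w); pose U k w := \int[K k w]_y f y.
have Zc k w : `|Z k w| <= c by exact: fc.
have Uc k w : `|U k w| <= c by exact: (Rintegral_bound (K1 k w) mf fc).
have c0 : 0 <= c := le_trans (normr_ge0 _) (fc point).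
have mZ k : measurable_fun setT (Z k) by exact: (measurableT_comp mf).
have ZB (j k : nat) : \int[Pr]_w (Z k w) ^+ 2 <= c ^+ 2.
  rewrite -[leRHS]ger0_norm ?sqr_ge0//; apply: le_trans (ler_norm _) _.
  rewrite [leRHS]ger0_norm ?sqr_ge0//; apply: Rintegral_bound => //.
    exact: measurable_funX.
  by move=> w; rewrite normrX lerXn2r ?nnegrE.
have BC n : \sum_(j < n) c ^+ 2 / (j.+1 ^ 2)%:R <= c ^+ 2 * 2.
  by rewrite -mulr_sumr ler_wpM2l ?sqr_ge0// sum_inv_squares.
have sq0 j : (0 < j.+1 ^ 2)%N by rewrite expn_gt0.
have := martingale_array_ae_cvg0 hF (fun (_ : nat) k => @adapted_next k f mf)
  (fun (_ : nat) k => transition k mf fb) (fun=> Zc) (fun=> Uc) ZB sq0 BC.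
apply: filterS => w hw.
rewrite /time_average; apply: (cvg0_from_squares (L := 2 * c) _ hw) => m n.
elim: n => [|n ih]; first by rewrite leqn0 => /eqP->; rewrite subrr normr0 subnn mulr0.
rewrite leq_eqVlt => /predU1P[->|]; first by rewrite subrr normr0 subnn mulr0.
rewrite ltnS => mn; rewrite subSn// -[(n - m).+1%:R]natr1 mulrDr mulr1.
rewrite /martingale big_ord_recr/= addrAC; apply: (le_trans (ler_normD _ _)).
apply: lerD; first exact: ih.
by apply: (le_trans (ler_normB _ _)); have := Zc n w; have := Uc n w; lra.
Qed.

Variables (W : S -> R) (lambda b : R).
Hypotheses (mW : measurable_fun setT W) (W1 : forall x, 1 <= W x).
Hypotheses (lam01 : 0 <= lambda < 1) (b0 : 0 <= b).
Hypothesis drift : forall x, (\int[P x]_y (W y)%:E <= (lambda * W x + b)%:E)%E.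
Variable CY : R.
Hypothesis momentY : forall n, (\int[Pr]_w (W (Y n w))%:E <= CY%:E)%E.
Hypothesis momentX0 : (\int[Pr]_w (W (X 0%N w))%:E < +oo)%E.

Let W0 x : 0 <= W x. Proof. exact: le_trans (W1 x). Qed.

Let lam := (1 - u) * lambda + u.

Let lam_itv : 0 <= lam < 1.
Proof.
by rewrite /lam; move: u01 lam01 => /andP[? ?] /andP[? ?]; apply/andP; split; nra.
Qed.

Let empW w n := empirical_mean (fun k => Y k w) n W.

Let empW0 w n : 0 <= empW w n.
Proof. by rewrite /empW /empirical_mean mulr_ge0 ?invr_ge0// sumr_ge0. Qed.

Let mWY n : measurable_fun setT (fun w => W (Y n w)).
Proof. exact: (measurableT_comp mW). Qed.

Let mWX n : measurable_fun setT (fun w => W (X n w)).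
Proof. exact: (measurableT_comp mW). Qed.

Let mempW n : measurable_fun setT (fun w => empW w n).
Proof. by apply: measurable_funM => //; exact: measurable_sum. Qed.

Let process_drift n w :
  (\int[K n w]_y (W y)%:E <= (lam * W (X n w) + (b + empW w n))%:E)%E.
Proof.
apply: (tempering_drift upsilon p beta mW W0 b0 (empW0 w n) (drift (X n w))).
by rewrite ge0_integral_empirical.
Qed.

(** The drift of the kernels with the empirical measures has the random constant
    b + theta_n(W), whose expectation is bounded because the moments of the
    Y n are. *)
Lemma process_moment : exists2 C : R, 0 <= C &
  forall n, (\int[Pr]_w (W (X n w))%:E <= C%:E)%E.
Proof.
have /andP[l0 l1] := lam_itv.
have CY0 : 0 <= CY.
  rewrite -lee_fin; apply: le_trans (momentY 0%N); apply: integral_ge0 => w _.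
  by rewrite lee_fin.
pose m0 := fine (\int[Pr]_w (W (X 0%N w))%:E)%E.
have i0 : (0 <= \int[Pr]_w (W (X 0%N w))%:E)%E.
  by apply: integral_ge0 => w _; rewrite lee_fin.
have m0E : (\int[Pr]_w (W (X 0%N w))%:E = m0%:E)%E by rewrite fineK// ge0_fin_numE.
have m00 : 0 <= m0 by exact: fine_ge0.
(* the initial moment plus the fixed point of m |-> lam m + b + CY *)
exists (m0 + (b + CY) / (1 - lam)).
  by rewrite addr_ge0// divr_ge0 ?subr_ge0 ?(ltW l1)// addr_ge0.
elim=> [|n ih].
  by rewrite m0E lee_fin lerDl divr_ge0 ?subr_ge0 ?(ltW l1)// addr_ge0.
have mX : measurable_fun setT (X n.+1) by [].
have mg : measurable_fun setT (fun w => lam * W (X n w) + (b + empW w n)).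
  apply: measurable_funD; first exact: measurable_funM.
  exact: measurable_funD.
apply: (le_trans (transition_moment (FT n) mX (K1 n) (transition n) mW W0 mg
  (process_drift n))).
have mWX' : measurable_fun setT (fun w => (W (X n w))%:E) by exact/measurable_EFinP.
have mE' : measurable_fun setT (fun w => (empW w n)%:E) by exact/measurable_EFinP.
rewrite (eq_integral (fun w => (lam%:E * (W (X n w))%:E + (b%:E + (empW w n)%:E))%E))//.
rewrite ge0_integralD//; last 4 first.
- by move=> w _; rewrite mule_ge0// lee_fin.
- exact: measurable_funeM.
- by move=> w _; rewrite adde_ge0// lee_fin.
- exact: emeasurable_funD.
have eW w : setT w -> (0 <= (W (X n w))%:E)%E by rewrite lee_fin.
have eE w : setT w -> (0 <= (empW w n)%:E)%E by rewrite lee_fin.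
have eb (w : Omega) : setT w -> (0 <= b%:E)%E by rewrite lee_fin.
rewrite (ge0_integralZl_EFin Pr measurableT eW mWX' l0).
rewrite (ge0_integralD Pr measurableT eb (measurable_cst _) eE mE').
rewrite integral_cst// [X in (_ + (_ * X + _))%E]Pr1 mule1.
have Eemp : (\int[Pr]_w (empW w n)%:E <= CY%:E)%E.
  rewrite (eq_integral (fun w => (n.+1%:R^-1)%:E * \sum_(k < n.+1) (W (Y k w))%:E)%E); last first.
    by move=> w _; rewrite sumEFin -EFinM.
  have mWY' k : measurable_fun setT (fun w => (W (Y k w))%:E) by exact/measurable_EFinP.
  rewrite ge0_integralZl_EFin//; last 2 first.
  - by move=> w _; apply: sume_ge0 => k _; rewrite lee_fin.
  - exact: emeasurable_sum.
  rewrite ge0_integral_sum//; last by move=> k w _; rewrite lee_fin.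
  apply: (@le_trans _ _ ((n.+1%:R^-1)%:E * \sum_(k < n.+1) CY%:E)%E).
    by rewrite lee_wpmul2l// lee_sum.
  rewrite sumEFin -EFinM lee_fin sumr_const card_ord -[CY *+ _]mulr_natl.
  by rewrite mulrA mulVf ?mul1r.
set C := m0 + _ in ih *.
apply: (@le_trans _ _ (lam%:E * C%:E + (b%:E + CY%:E))%E).
  by apply: leeD; [rewrite lee_wpmul2l|rewrite leeD2l].
rewrite -!EFinD lee_fin.
have CE : C * (1 - lam) = m0 * (1 - lam) + (b + CY).
  by rewrite /C mulrDl divfK// gt_eqF// subr_gt0.
have : 0 <= m0 * (1 - lam) by rewrite mulr_ge0// subr_ge0 ltW.
lra.
Qed.

(** At time 2^j the function W is truncated at t j = r^j with r = 2^(1/a), so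
    that its a-th power is at most 2^j. The bounded first moment of W gives the
    truncated increments second moments of order r^((2a-1)j) with
    r^(2a-1) < 2, which makes the martingale part at most 2^j eventually.
    Since r > 2, the sum of W over the first 2^j steps is eventually
    below t j, and the truncation is not active. What remains is the
    drift inequality along the path. *)
Lemma ae_power_average_bound (a : R) : 2^-1 <= a < 1 ->
  {ae Pr, forall w, exists B : R, forall n, empW w n <= B} ->
  {ae Pr, forall w, exists2 C : R, 0 <= C &
     forall n, \sum_(k < n) W (X k w) `^ a <= C * n%:R}.
Proof.
move=> /andP[a2 a1] empB.
have a0 : 0 < a by apply: lt_le_trans a2; rewrite invr_gt0.
have a01 : 0 < a < 1 by rewrite a0.
have [C C0 momX] := process_moment.
have /andP[l0 l1] := lam_itv.
pose r : R := 2 `^ a^-1.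
have ra : r `^ a = 2 by rewrite /r -powRrM mulVf ?gt_eqF// powRr1.
have r1 : 1 < r by apply: powR_gt1; rewrite ?ltr1n// invr_gt0.
have r0 : 0 < r by exact: lt_trans r1.
have r2 : 2 < r.
  have -> : r = 2 * 2 `^ (a^-1 - 1).
    rewrite -[X in X * _]powRr1// -powRD; last by apply/implyP => _; rewrite pnatr_eq0.
    by rewrite addrC subrK.
  by rewrite ltr_pMr// powR_gt1 ?ltr1n// subr_gt0 invf_gt1.
pose t j := r ^+ j.
have t1 j : 1 <= t j by rewrite exprn_ege1// ltW.
have t0 j : 0 < t j by exact: lt_le_trans (t1 j).
have ta j : t j `^ a = 2 ^+ j by rewrite powR_exprn ?ra// ltW.
pose s := r `^ (2 * a - 1).
have s0 : 0 <= s by exact: powR_ge0.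
have s2 : s < 2.
  have -> : 2 = s * r `^ (1 - a).
    rewrite /s -powRD; last by apply/implyP => _; rewrite gt_eqF.
    by rewrite -[LHS]ra; congr (_ `^ _); ring.
  by rewrite ltr_pMr ?powR_gt0// powR_gt1// subr_gt0.
pose f j x := (minr (W x) (t j)) `^ a.
have mf j : measurable_fun setT (f j).
  by apply: (measurableT_comp (@measurable_powR R a)); exact: measurable_minr.
have f0 j x : 0 <= f j x by exact: powR_ge0.
have min0 j x : 0 < minr (W x) (t j).
  by rewrite lt_min t0 andbT; exact: lt_le_trans (W1 x).
have monoR (c x y : R) : 0 <= c -> 0 < x -> x <= y -> x `^ c <= y `^ c.
  move=> c0 x0 xy; apply: ge0_ler_powR => //; rewrite nnegrE ltW//.
  exact: lt_le_trans xy.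
have ft j x : `|f j x| <= 2 ^+ j.
  rewrite ger0_norm// -ta; apply: (monoR _ _ _ (ltW a0) (min0 j x)).
  by rewrite ge_min lexx orbT.
have fb j : is_bounded (f j) by exists (2 ^+ j) => _ [x _ <-].
have fW j x : f j x <= W x `^ a.
  by apply: (monoR _ _ _ (ltW a0) (min0 j x)); rewrite ge_min lexx.
have f2 j x : f j x ^+ 2 <= s ^+ j * W x.
  have -> : f j x ^+ 2 = minr (W x) (t j) `^ (2 * a - 1) * minr (W x) (t j).
    rewrite -[X in _ = _ * X]powRr1 ?(ltW (min0 j x))//.
    rewrite -powRD; last by apply/implyP => _; rewrite gt_eqF.
    by rewrite subrK mulrC powRrM powR_mulrn ?powR_ge0.
  apply: ler_pM; rewrite ?powR_ge0 ?(ltW (min0 j x))// ?ge_min ?lexx//.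
  rewrite /s -powR_exprn ?(ltW r0)//; apply: monoR => //.
  - by rewrite subr_ge0 -ler_pdivrMl// mulr1.
  - by rewrite ge_min lexx orbT.
pose Z j k w := f j (X k.+1 w); pose U j k w := \int[K k w]_y f j y.
have Zc j k w : `|Z j k w| <= 2 ^+ j by exact: ft.
have Uc j k w : `|U j k w| <= 2 ^+ j by exact: (Rintegral_bound (K1 k w) (mf j) (ft j)).
have mZ j k : measurable_fun setT (Z j k) by exact: (measurableT_comp (mf j)).
have ZB j k : \int[Pr]_w (Z j k w) ^+ 2 <= C * s ^+ j.
  rewrite -lee_fin EFin_Rintegral; last first.
    apply: (bounded_integrable Pr1 (c := (2 ^+ j) ^+ 2)); first exact: measurable_funX.
    by move=> w; rewrite normrX lerXn2r ?nnegrE ?exprn_ge0.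
  have sj0 : 0 <= s ^+ j by exact: exprn_ge0.
  apply: (@le_trans _ _ (\int[Pr]_w ((s ^+ j)%:E * (W (X k.+1 w))%:E))%E).
    apply: ge0_le_integral => //.
    - by move=> w _; rewrite lee_fin sqr_ge0.
    - by apply/measurable_EFinP; exact: measurable_funX.
    - by apply: measurable_funeM; exact/measurable_EFinP.
    - by move=> w _; rewrite -EFinM lee_fin; exact: f2.
  have mWX' : measurable_fun setT (fun w => (W (X k.+1 w))%:E).
    exact/measurable_EFinP.
  have WX0 w : setT w -> (0 <= (W (X k.+1 w))%:E)%E by rewrite lee_fin.
  rewrite (ge0_integralZl_EFin Pr measurableT WX0 mWX' sj0).
  by rewrite mulrC EFinM lee_wpmul2l ?lee_fin.
have N0 j : (0 < 2 ^ j)%N by rewrite expn_gt0.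
have BC n : \sum_(j < n) C * s ^+ j / (2 ^ j)%:R <= C * (1 - s / 2)^-1.
  have -> : \sum_(j < n) C * s ^+ j / (2 ^ j)%:R = C * \sum_(j < n) (s / 2) ^+ j.
    by rewrite mulr_sumr; apply: eq_bigr => j _; rewrite expr_div_n natrX mulrA.
  rewrite ler_wpM2l//; apply: sum_geometric_le.
  by rewrite divr_ge0//= ltr_pdivrMr// mul1r.
have ae1 := martingale_array_ae_cvg0 hF (fun j k => @adapted_next k (f j) (mf j))
  (fun j k => transition k (mf j) (fb j)) Zc Uc ZB N0 BC.
(* each of the first 2^j values of W is at most their sum *)
pose Z2 j w := (\sum_(k < 2 ^ j) W (X k.+1 w)) / t j.
have mZ2 j : measurable_fun setT (Z2 j).
  by apply: measurable_funM => //; exact: measurable_sum.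
have Z20 j w : 0 <= Z2 j w by rewrite divr_ge0 ?sumr_ge0// ltW.
have Z2B j : (\int[Pr]_w (Z2 j w)%:E <= (C * (2 / r) ^+ j)%:E)%E.
  have mWX' k : measurable_fun setT (fun w => (W (X k w))%:E) by exact/measurable_EFinP.
  have tj0 : 0 <= (t j)^-1 by rewrite invr_ge0 ltW.
  rewrite (eq_integral (fun w => ((t j)^-1)%:E * \sum_(k < 2 ^ j) (W (X k.+1 w))%:E)%E); last first.
    by move=> w _; rewrite sumEFin -EFinM mulrC.
  have WS0 w : setT w -> (0 <= \sum_(k < 2 ^ j) (W (X k.+1 w))%:E)%E.
    by move=> _; apply: sume_ge0 => k _; rewrite lee_fin.
  have mWS : measurable_fun setT (fun w => \sum_(k < 2 ^ j) (W (X k.+1 w))%:E)%E.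
    exact: emeasurable_sum.
  rewrite (ge0_integralZl_EFin Pr measurableT WS0 mWS tj0).
  rewrite ge0_integral_sum//; last by move=> k w _; rewrite lee_fin.
  apply: (@le_trans _ _ (((t j)^-1)%:E * \sum_(k < 2 ^ j) C%:E)%E).
    by rewrite lee_wpmul2l// lee_sum.
  rewrite sumEFin -EFinM lee_fin sumr_const card_ord -[C *+ _]mulr_natl natrX.
  by rewrite expr_div_n le_eqVlt; apply/orP; left; apply/eqP; rewrite /t; ring.
have BC2 n : \sum_(j < n) C * (2 / r) ^+ j <= C * (1 - 2 / r)^-1.
  rewrite -mulr_sumr ler_wpM2l//; apply: sum_geometric_le.
  by rewrite divr_ge0 ?(ltW r0)//= ltr_pdivrMr// mul1r.
have ae2 := summable_ae_cvg0 mZ2 Z20 Z2B BC2.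
move: ae1 ae2 empB; apply: filterS3 => w hS hZ [B hB].
have B0 : 0 <= B := le_trans (empW0 w 0%N) (hB 0%N).
have /cvgrPdist_le/(_ 1 ltr01)[J1 _ hJ1] := hS.
have /cvgrPdist_le/(_ 1 ltr01)[J2 _ hJ2] := hZ.
pose v k := W (X k w) `^ a.
have v0 k : 0 <= v k by exact: powR_ge0.
have lam'01 : 0 <= 1 - a * (1 - lam) < 1.
  have : 0 < a * (1 - lam) by rewrite mulr_gt0// subr_gt0.
  have : a * (1 - lam) <= 1 * 1 by apply: ler_pM => //; [exact: ltW|lra|exact: ltW|lra].
  by move=> ? ?; apply/andP; split; lra.
have aB0 : 0 <= a * (b + B) by rewrite mulr_ge0 ?addr_ge0// ltW.
apply: (dyadic_drift_bound (J := maxn J1 J2) v0 lam'01 aB0) => j Jj.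
have j1 : (J1 <= j)%N := leq_trans (leq_maxl _ _) Jj.
have j2 : (J2 <= j)%N := leq_trans (leq_maxr _ _) Jj.
have Wt (k : 'I_(2 ^ j)) : W (X k.+1 w) <= t j.
  have := hJ2 j j2; rewrite /= sub0r normrN ger0_norm// ler_pdivrMr// mul1r.
  apply: le_trans; rewrite (bigD1 k)//= lerDl; exact: sumr_ge0.
have SN : martingale (Z j) (U j) (2 ^ j) w <= (2 ^ j)%:R.
  have := hJ1 j j1; rewrite /= sub0r normrN ger0_norm ?sqr_ge0// => h.
  rewrite -[leRHS]mul1r -ler_pdivrMr ?ltr0n//.
  by rewrite leNgt; apply/negP => h1; move: h; rewrite leNgt exprn_egt1.
have UV k : U j k w <= (1 - a * (1 - lam)) * v k + a * (b + B).
  rewrite -lee_fin EFin_Rintegral; last exact: (bounded_integrable (K1 k w) (mf j) (ft j)).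
  apply: (@le_trans _ _ (\int[K k w]_y (W y `^ a)%:E)%E).
    apply: ge0_le_integral => //.
    - by move=> x _; rewrite lee_fin.
    - exact/measurable_EFinP.
    - by apply/measurable_EFinP; exact: (measurableT_comp (@measurable_powR R a)).
    - by move=> x _; rewrite lee_fin.
  apply: (power_drift (K1 k w) mW W0 a01 _ (W1 _)); first by rewrite addr_ge0.
  by apply: (le_trans (process_drift k w)); rewrite lee_fin lerD2l lerD2l.
have <- : \sum_(k < 2 ^ j) Z j k w = \sum_(k < 2 ^ j) v k.+1.
  by apply: eq_bigr => k _; rewrite /Z /f min_l.
have -> : \sum_(k < 2 ^ j) Z j k w = martingale (Z j) (U j) (2 ^ j) w + \sum_(k < 2 ^ j) U j k w.
  by rewrite /martingale -big_split/=; apply: eq_bigr => k _; rewrite subrK.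
by apply: lerD => //; apply: ler_sum => k _.
Qed.

Lemma one_small_tempering (theta : probability S R) (C : set S) :
  one_small P C -> one_small (Pth theta) C.
Proof.
move=> [delta delta0 [nu Pnu]]; have /andP[u0 u1] := u01.
exists ((1 - u) * delta); first by rewrite mulr_gt0// subr_gt0.
exists nu => x Cx A mA.
rewrite [X in (_ <= X)%E](tempering_kernelE upsilon P p beta theta x A).
rewrite EFinM -muleA; apply: (@le_trans _ _ ((1 - u)%:E * P x A)%E).
  by apply: lee_wpmul2l; [rewrite lee_fin subr_ge0|exact: Pnu].
by rewrite leeDl// mule_ge0.
Qed.

Hypotheses (cp : continuous p) (p0 : forall x, 0 < p x) (beta0 : 0 <= beta).
Variables (M : R) (theta Pi : probability S R) (BT a : R).
Hypothesis pM : forall x, p x <= M.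
Hypothesis PF : kernel_feller P.
Hypothesis lln : forall (f : S -> R) (c : R), continuous f ->
  (forall x, `|f x| <= c) ->
  {ae Pr, forall w,
    (fun n => empirical_mean (fun k => Y k w) n f) @ \oo --> \int[theta]_x f x}.
Hypothesis empB : {ae Pr, forall w, exists B : R, forall n, empW w n <= B}.
Hypothesis thetaW : (\int[theta]_x (W x)%:E <= BT%:E)%E.
Hypothesis a_itv : 2^-1 <= a < 1.
Hypothesis smallP : forall r, 1 < r -> one_small P [set x | W x `^ a <= r].
Hypothesis level : forall r, exists2 q, 0 < q & forall x, W x `^ a <= r -> q <= p x.
Hypothesis invPi : forall (f : S -> R) (c : R), measurable_fun setT f ->
  (forall x, `|f x| <= c) -> measurable_fun setT (kernel_act (Pth theta) f) ->
  \int[Pi]_x kernel_act (Pth theta) f x = \int[Pi]_x f x.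
Hypothesis PiV : (\int[Pi]_x (W x `^ a)%:E < +oo)%E.

Let phi x := p x `^ beta.

Let phi_gt0 x : 0 < phi x. Proof. exact: powR_gt0. Qed.

Let continuous_test (f : S -> R) (s : R) : 0 < s -> continuous f ->
  continuous (fun y => metropolis (phi y) s * f y).
Proof.
move=> s0 cf y; apply: cvgM; last exact: cf.
apply: (@continuous_min _ _ (cst 1) (fun y => phi y / s)); first exact: cvg_cst.
apply: cvgM; last exact: cvg_cst.
exact: continuous_powR_pos.
Qed.

(** For each parameter the integrand is a bounded continuous test function of
    the auxiliary process. *)
Lemma ae_acceptance_mean_cvg (f : S -> R) (c : R) : continuous f ->
  (forall x, `|f x| <= c) ->
  {ae Pr, forall w, forall i N : nat,
    (fun k => acceptance_mean phi (empirical R (fun k => Y k w) k) f (i.+1%:R / N.+1%:R))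
      @ \oo --> acceptance_mean phi theta f (i.+1%:R / N.+1%:R)}.
Proof.
move=> cf fc; apply/ae_foralln => i; apply/ae_foralln => N.
have s0 : 0 < i.+1%:R / N.+1%:R :> R by rewrite divr_gt0.
have bd := metropolis_bound (fun y => ltW (phi_gt0 y)) s0 fc.
have ct := continuous_test s0 cf.
have := lln ct bd; apply: filterS => w.
have -> : (fun k => acceptance_mean phi (empirical R (fun k => Y k w) k) f
      (i.+1%:R / N.+1%:R)) = (fun n => empirical_mean (fun k => Y k w) n
      (fun y => metropolis (phi y) (i.+1%:R / N.+1%:R) * f y)).
  apply/funext => k.
  exact: (Rintegral_empirical _ _ (continuous_measurable_real ct) bd).
exact.
Qed.

(** See the opening comment: [g m] is the m-th iterate of the limiting
    kernel at f, bounded and continuous by the Feller property. *)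
Lemma bounded_continuous_lln (f : S -> R) (c : R) : continuous f ->
  (forall x, `|f x| <= c) ->
  {ae Pr, forall w, time_average (fun k => f (X k w)) @ \oo --> \int[Pi]_x f x}.
Proof.
move=> cf fc.
have /andP[a2 a1] := a_itv.
have a0 : 0 < a by apply: lt_le_trans a2; rewrite invr_gt0.
have a01 : 0 < a < 1 by rewrite a0.
have /andP[l0 l1] := lam_itv.
pose Q := Pth theta; pose V x := W x `^ a.
have mV : measurable_fun setT V by exact: (measurableT_comp (@measurable_powR R a)).
have V1 x : 1 <= V x.
  have : 1 `^ a <= W x `^ a by apply: ge0_ler_powR; rewrite ?nnegrE// ltW.
  by rewrite powR1.
have V0 x : 0 <= V x := le_trans ler01 (V1 x).
have Q1 x : Q x setT = 1%E by exact: tempering_kernel_setT.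
have BT0 : 0 <= BT.
  rewrite -lee_fin; apply: le_trans thetaW; apply: integral_ge0 => x _.
  by rewrite lee_fin.
have driftV x : (\int[Q x]_y (V y)%:E
    <= ((1 - a * (1 - lam)) * V x + a * (b + BT))%:E)%E.
  apply: (power_drift (Q1 x) mW W0 a01 _ (W1 x)); first by rewrite addr_ge0.
  exact: (tempering_drift upsilon p beta mW W0 b0 BT0 (drift x) thetaW).
have lamV : 0 <= 1 - a * (1 - lam) < 1.
  have h1 : 0 < a * (1 - lam) by rewrite mulr_gt0// subr_gt0.
  have h2 : a * (1 - lam) <= 1 * 1 by apply: ler_pM; lra.
  by apply/andP; split; lra.
have aB0 : 0 <= a * (b + BT) by rewrite mulr_ge0 ?addr_ge0// ltW.
pose g m := iter m (kernel_act Q) f.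
have gP m : continuous (g m) /\ forall x, `|g m x| <= c.
  elim: m => [//|m [cg gc]]; split => /=.
    exact: (tempering_feller cp p0 PF cg gc).
  move=> x; exact: (Rintegral_bound (Q1 x) (continuous_measurable_real cg) gc).
have cg m := (gP m).1; have gc m := (gP m).2.
have mg m := continuous_measurable_real (cg m).
have gPi m : \int[Pi]_x g m x = \int[Pi]_x g 0%N x.
  by elim: m => // m <-; exact: (invPi (mg m) (gc m) (mg m.+1)).
have [rho [D [rho01 D0 gD]]] := harris_iterates mV V1 Q1 driftV lamV aB0
  (fun r r1 => one_small_tempering theta (smallP r1)) PiV mg gc (fun=> erefl) gPi.
have one_bd (y : S) : `|(cst 1 : S -> R) y| <= 1 by rewrite normr1.
have c1 : continuous (cst 1 : S -> R) by move=> x; exact: cvg_cst.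
have ae_m : {ae Pr, forall w, forall m, (forall i N : nat,
      (fun k => acceptance_mean phi (empirical R (fun k => Y k w) k) (g m) (i.+1%:R / N.+1%:R))
        @ \oo --> acceptance_mean phi theta (g m) (i.+1%:R / N.+1%:R)) /\
    time_average (fun k => g m (X k.+1 w)
      - kernel_act (Pth (empirical R (fun k => Y k w) k)) (g m) (X k w)) @ \oo --> (0 : R)}.
  apply/ae_foralln => m.
  have := bounded_lln (mg m) (gc m); have := ae_acceptance_mean_cvg (cg m) (gc m).
  by apply: filterS2 => w h1 h2; split.
have := ae_power_average_bound a_itv empB; have := ae_acceptance_mean_cvg c1 one_bd.
move: ae_m; apply: filterS3 => w test_slln tone [C C0 VC].
have Vk0 k : 0 <= V (X k w) by exact: V0.
apply: (contraction_time_average (g := fun m k => g m (X k w)) C0 VC rho01 D0 Vk0) => [m|m k]; last exact: gD.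
apply: (perturbed_time_average (c := c) C0 VC Vk0 _ _ _ (test_slln m).2) => [k|k|k|r eta r0 eta0].
- exact: gc.
- exact: (tempering_act_bound _ _ _ _ _ _ (mg m) (gc m)).
- exact: (gc m.+1).
(* on {V <= r} the parameter phi ranges over [q^beta, M^beta] *)
have [q q0 qp] := level r.
have s0 : 0 < q `^ beta by exact: powR_gt0.
have := tempering_act_cvg_unif upsilon P (mg m) (gc m) (test_slln m).1 tone (M `^ beta) s0 eta0.
apply: filterS => k hk Vr; apply: hk.
have qx := qp _ Vr.
apply/andP; split; apply: ge0_ler_powR => //; rewrite nnegrE; try exact: ltW.
exact: le_trans (ltW (p0 (X k w))) (pM _).
Qed.

End tempering_process.

(** * From bounded continuous functions to weighted functions and sets *)

(** Signed functions, by splitting into positive and negative parts, so that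
    both sides agree whether or not f is integrable. *)
Lemma Rintegral_density d (T : measurableType d) (R : realType)
    (m nu : {measure set T -> \bar R}) (q : T -> R) (f : T -> R) :
  measurable_fun setT q -> (forall x, 0 <= q x) ->
  (forall A, measurable A -> nu A = \int[m]_(x in A) (q x)%:E)%E ->
  measurable_fun setT f -> \int[nu]_x f x = \int[m]_x (f x * q x).
Proof.
move=> mq q0 nuE mf; congr fine; rewrite integralE [RHS]integralE.
have mf' : measurable_fun setT (EFin \o f) by exact/measurable_EFinP.
rewrite (integral_density mq q0 nuE (measurable_funepos mf'))//.
rewrite (integral_density mq q0 nuE (measurable_funeneg mf'))//.
congr (_ - _)%E; apply: eq_integral => x _.
  rewrite !funeposE /= -EFin_max -EFinM -EFin_max; congr EFin.
  by rewrite maxr_pMl// mul0r.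
rewrite !funenegE /= -?EFinN -EFin_max -EFinM -EFin_max; congr EFin.
by rewrite maxr_pMl// mul0r mulNr.
Qed.

Section lln_extensions.
Context (R : realType) d (S : borelType d) dO (Omega : measurableType dO)
  (Pr : probability Omega R) (X : nat -> Omega -> S) (Pi : probability S R).
Hypothesis lln : forall (f : S -> R) (c : R), continuous f -> (forall x, `|f x| <= c) ->
  {ae Pr, forall w, time_average (fun k => f (X k w)) @ \oo --> \int[Pi]_x f x}.

Let Pi1 : Pi setT = 1%E. Proof. exact: probability_setT. Qed.

(** Where |f| exceeds a large level, W is large and W^a' is small compared with
    W^a; truncating f therefore costs little relative to W^a. *)
Lemma weighted_lln (W f : S -> R) (a a' C0 : R) :
  measurable_fun setT W -> (forall x, 1 <= W x) -> 0 < a' < a -> 0 < C0 ->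
  (\int[Pi]_x (W x `^ a)%:E < +oo)%E ->
  {ae Pr, forall w, exists2 C : R, 0 <= C &
     forall n, \sum_(k < n) W (X k w) `^ a <= C * n%:R} ->
  continuous f -> (forall x, `|f x| <= C0 * W x `^ a') ->
  {ae Pr, forall w, time_average (fun k => f (X k w)) @ \oo --> \int[Pi]_x f x}.
Proof.
move=> mW W1 /andP[a'0 a'a] C00 PiV aeV cf fW.
have a0 : 0 < a by exact: lt_trans a'a.
pose V x := W x `^ a.
have mV : measurable_fun setT V by exact: (measurableT_comp (@measurable_powR R a)).
have V0 x : 0 <= V x by exact: powR_ge0.
have mf := continuous_measurable_real cf.
have W0 x : 0 < W x by exact: lt_le_trans (W1 x).
have monoR (c x y : R) : 0 <= c -> 0 < x -> x <= y -> x `^ c <= y `^ c.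
  move=> c0 x0 xy; apply: ge0_ler_powR => //; rewrite nnegrE ltW//.
  exact: lt_le_trans xy.
have iV : Pi.-integrable setT (EFin \o V).
  apply/integrableP; split; first exact/measurable_EFinP.
  by rewrite (eq_integral (EFin \o V))// => x _; rewrite /= ger0_norm.
have fV x : `|f x| <= C0 * V x.
  apply: (le_trans (fW x)); rewrite ler_wpM2l ?(ltW C00)//.
  by rewrite /V ler_powR// ltW.
have if_ : Pi.-integrable setT (EFin \o f).
  apply: le_integrable (integrableZl measurableT C0 iV) => //.
    exact/measurable_EFinP.
  by move=> x _ /=; rewrite lee_fin (le_trans (fV x))// ger0_norm// mulr_ge0// ltW.
pose g (n : nat) x := maxr (- n%:R) (minr n%:R (f x)).
have cg n : continuous (g n).
  move=> x; apply: (@continuous_max _ _ (cst (- n%:R)) (fun x => minr n%:R (f x))).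
    exact: cvg_cst.
  by apply: (@continuous_min _ _ (cst n%:R) f); [exact: cvg_cst|exact: cf].
have gn n x : `|g n x| <= n%:R.
  rewrite ler_norml le_max lexx/= ge_max ge_min lexx/= andbT.
  by rewrite (@le_trans _ _ 0)// oppr_le0.
have gf n x : `|f x| <= n%:R -> g n x = f x.
  by rewrite ler_norml => /andP[fn1 fn2]; rewrite /g (min_r fn2) (max_r fn1).
have fg n x : `|f x - g n x| <= `|f x|.
  have n0 : 0 <= n%:R :> R by [].
  rewrite /g; have [fn|nf] := leP (f x) n%:R; have [fn'|nf'] := leP (- n%:R) _.
  - by rewrite subrr normr0.
  - by rewrite !ler0_norm; lra.
  - by rewrite !ger0_norm; lra.
  - lra.
have approx (e : R) : 0 < e -> exists n, forall x, `|f x - g n x| <= e * V x.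
  move=> e0; have Ce : 0 < C0 / e by rewrite divr_gt0.
  have aa : 0 < a - a' by rewrite subr_gt0.
  (* the level of W above which C0 W^a' <= e W^a *)
  pose t := (C0 / e) `^ (a - a')^-1.
  have t0 : 0 < t by exact: powR_gt0.
  have tE : t `^ (a - a') = C0 / e by rewrite /t -powRrM mulVf ?gt_eqF// powRr1// ltW.
  exists (Num.truncn (C0 * t `^ a')).+1 => x.
  set n := _.+1; have tn : C0 * t `^ a' < n%:R by exact: truncnS_gt.
  have [fn|nf] := leP `|f x| n%:R.
    by rewrite gf// subrr normr0 mulr_ge0// ltW.
  apply: (le_trans (fg n x)); apply: (le_trans (fW x)).
  have tW : t <= W x.
    rewrite leNgt; apply/negP => Wt.
    have h := monoR a' _ _ (ltW a'0) (W0 x) (ltW Wt).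
    have := ler_wpM2l (ltW C00) h; have := fW x; lra.
  have h := monoR (a - a') _ _ (ltW aa) t0 tW.
  have VE : V x = W x `^ (a - a') * W x `^ a'.
    rewrite /V -powRD; first by rewrite subrK.
    by apply/implyP => _; rewrite gt_eqF.
  rewrite VE mulrA ler_wpM2r ?powR_ge0//.
  by move: h; rewrite tE ler_pdivrMr// mulrC.
have ae_g : {ae Pr, forall w, forall n,
    time_average (fun k => g n (X k w)) @ \oo --> \int[Pi]_x g n x}.
  by apply/ae_foralln => n; exact: lln (cg n) (gn n).
move: ae_g aeV; apply: filterS2 => w hg [C C1 VC].
apply: (approx_time_average C1 VC) => e e0.
pose v := \int[Pi]_x V x.
have v0 : 0 <= v by exact: Rintegral_ge0.
have [e' [e'0 e'e e'v]] : exists e', [/\ 0 < e', e' <= e & e' * v <= e].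
  exists (e / (1 + v)); have h : 0 < 1 + v by exact: ltr_pwDl.
  split; first exact: divr_gt0.
    by rewrite ler_pdivrMr// ler_peMr ?(ltW e0)// lerDl.
  by rewrite mulrAC ler_pdivrMr// ler_wpM2l ?(ltW e0)// lerDr.
have [n hn] := approx _ e'0.
exists (fun k => g n (X k w)), (\int[Pi]_x g n x); split => [k|//|].
  by apply: (le_trans (hn _)); exact: (ler_wpM2r (V0 _)) e'e.
have ig := bounded_integrable Pi1 (continuous_measurable_real (cg n)) (gn n).
have ifg := integrableB measurableT if_ ig.
rewrite -RintegralB//; apply: (le_trans (le_normr_Rintegral measurableT ifg)).
apply: le_trans e'v; rewrite /v -(RintegralZl e' measurableT iV).
apply: le_Rintegral => //; first exact: integrable_norm.
exact: (integrableZl measurableT e' iV).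
Qed.

Lemma measurable_closed_borel (A : set S) : closed A -> measurable A.
Proof.
move=> cA; rewrite -[A]setCK; apply: measurableC; rewrite measurable_borelE.
by apply: sub_gen_smallest; exact: closed_openC.
Qed.

Lemma closed_bump_integral (dist : S -> S -> R) (A : set S) :
  complete_metric_for dist -> closed A ->
  (fun n => \int[Pi]_x closed_bump dist A n x) @ \oo --> fine (Pi A).
Proof.
move=> hd cA; have mA := measurable_closed_borel cA.
have mb n : measurable_fun setT (closed_bump dist A n).
  by apply: continuous_measurable_real; exact: continuous_closed_bump.
have b01 n x := closed_bump_itv hd A n x.
have : (fun n => \int[Pi]_x (closed_bump dist A n x)%:E)%E @ \oo -->
    (\int[Pi]_x (\1_A x)%:E)%E.
  apply: (@dominated_cvg _ _ _ Pi setT measurableT _ _ (cst 1%E)).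
  - by move=> n; exact/measurable_EFinP.
  - move=> x _; apply: cvg_EFin; first exact: nearW.
    exact: (closed_bump_cvg hd cA).
  - by [].
  - exact: finite_measure_integrable_cst.
  - by move=> n x _; rewrite /= lee_fin; have /andP[? ?] := b01 n x; rewrite ger0_norm.
rewrite integral_indic// setIT -[X in _ --> X]fineK; last exact: fin_num_measure.
by move=> /fine_cvg.
Qed.

(** The indicator of A lies between those of its interior and its closure, which
    have the same mass as A; continuous bumps approximate the closure and
    the complement of the interior from above. *)
Lemma set_lln (dist : S -> S -> R) (A : set S) :
  complete_metric_for dist -> measurable A -> Pi (boundary A) = 0%E ->
  {ae Pr, forall w, time_average (fun k => \1_A (X k w)) @ \oo --> fine (Pi A)}.
Proof.
move=> hd mA dA0.
pose G := ~` interior A.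
have cG : closed G by apply: open_closedC; exact: open_interior.
have cC : closed (closure A) by exact: closed_closure.
have mC := measurable_closed_borel cC; have mG := measurable_closed_borel cG.
have mI : measurable (interior A) by rewrite -[interior A]setCK; exact: measurableC.
have mB : measurable (boundary A) by exact: measurableD.
have finE (B : set S) : measurable B -> (fine (Pi B))%:E = Pi B.
  by move=> mB'; rewrite fineK//; exact: fin_num_measure.
have CA : fine (Pi (closure A)) <= fine (Pi A).
  rewrite -lee_fin !finE//.
  apply: (@le_trans _ _ (Pi (A `|` boundary A))).
    apply: le_measure; rewrite ?inE//; first exact: measurableU.
    move=> x Cx; have [Ix|nIx] := pselect (interior A x).
      by left; exact: interior_subset.
    by right.
  by apply: (le_trans (measureU2 _ mA mB)); rewrite [X in (_ + X <= _)%E]dA0 adde0.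
have AI : fine (Pi A) <= fine (Pi (interior A)).
  rewrite -lee_fin !finE//.
  apply: (@le_trans _ _ (Pi (interior A `|` boundary A))).
    apply: le_measure; rewrite ?inE//; first exact: measurableU.
    move=> x Ax; have [Ix|nIx] := pselect (interior A x); first by left.
    by right; split => //; exact: subset_closure.
  by apply: (le_trans (measureU2 _ mI mB)); rewrite [X in (_ + X <= _)%E]dA0 adde0.
have GI : fine (Pi G) = 1 - fine (Pi (interior A)).
  have := probability_setC Pi mI.
  by rewrite -/G -(finE _ mI) -(finE _ mG) -EFinB => -[].
pose h n := closed_bump dist (closure A) n; pose h' n := closed_bump dist G n.
have bd (B : set S) n x : `|closed_bump dist B n x| <= 1.
  by have /andP[? ?] := closed_bump_itv hd B n x; rewrite ger0_norm.
have ae_h : {ae Pr, forall w, forall n,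
    time_average (fun k => h n (X k w)) @ \oo --> \int[Pi]_x h n x}.
  by apply/ae_foralln => n; apply: (@lln _ 1) => [|x]; [exact: continuous_closed_bump|exact: bd].
have ae_h' : {ae Pr, forall w, forall n,
    time_average (fun k => h' n (X k w)) @ \oo --> \int[Pi]_x h' n x}.
  by apply/ae_foralln => n; apply: (@lln _ 1) => [|x]; [exact: continuous_closed_bump|exact: bd].
move: ae_h ae_h'; apply: filterS2 => w hh hh'.
apply: sandwich_time_average => e e0.
have /cvgrPdist_le/(_ _ e0)[n1 _ /(_ n1 (leqnn _))/=] := closed_bump_integral hd cC.
rewrite ler_norml => /andP[hn1 _].
have /cvgrPdist_le/(_ _ e0)[n2 _ /(_ n2 (leqnn _))/=] := closed_bump_integral hd cG.
rewrite ler_norml => /andP[hn2 _].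
exists (fun k => 1 - h' n2 (X k w)), (fun k => h n1 (X k w)),
  (1 - \int[Pi]_x h' n2 x), (\int[Pi]_x h n1 x); split => //.
- move=> k; rewrite indicE; apply/andP; split.
    have [Ax|nAx] := boolP (X k w \in A).
      by have /andP[? ?] := closed_bump_itv hd G n2 (X k w); rewrite /h' /=; lra.
    rewrite /h' (closed_bump1 hd) ?subrr// => Ix.
    by move: nAx; rewrite mem_set//; exact: interior_subset.
  have [Ax|nAx] := boolP (X k w \in A).
    by rewrite /h (closed_bump1 hd)//; apply: subset_closure; exact: set_mem.
  by have /andP[] := closed_bump_itv hd (closure A) n1 (X k w).
- rewrite (_ : time_average _ = fun n => time_average (fun=> 1) n
      - time_average (fun k => h' n2 (X k w)) n).
    by apply: cvgB => //; exact: time_average_cst.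
  by apply/funext => n; rewrite -time_averageB.
- by rewrite GI in hn2; rewrite /h'; lra.
- by rewrite /h; lra.
Qed.

End lln_extensions.

(** * The drift function, the tempered target and the theorem *)

Section drift_function_properties.
Context (R : realType) (T : topologicalType) (p : T -> R) (tau : R) (x0 : T).
Hypotheses (p0 : forall x, 0 < p x) (bp : is_bounded p) (tau0 : 0 < tau).
Local Notation M := (sup_norm p).
Local Notation W := (drift_function p tau).

Lemma le_sup_norm x : p x <= M.
Proof.
by apply: (le_trans (ler_norm _)); apply: ub_le_sup => //; exists x.
Qed.

Lemma sup_norm_gt0 : 0 < M.
Proof. exact: lt_le_trans (p0 x0) (le_sup_norm x0). Qed.

Let ratio_gt0 x : 0 < p x / M.
Proof. by rewrite divr_gt0// sup_norm_gt0. Qed.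

Lemma drift_function_ge1 x : 1 <= W x.
Proof.
rewrite /drift_function powRN invf_ge1 ?powR_gt0//.
have : (p x / M) `^ tau <= 1 `^ tau.
  apply: ge0_ler_powR; rewrite ?nnegrE ?(ltW tau0) ?(ltW (ratio_gt0 x))//.
  by rewrite ler_pdivrMr ?sup_norm_gt0// mul1r le_sup_norm.
by rewrite powR1.
Qed.

Lemma continuous_drift_function : continuous p -> continuous W.
Proof.
move=> cp; apply: (@continuous_powR_pos T R (fun x => p x / M)) => // x.
by apply: cvgM; [exact: cp|exact: cvg_cst].
Qed.

(** A bound on a power of W is a positive lower bound on p, and r > 1 keeps it
    below the supremum of p. *)
Lemma drift_function_level (a r : R) : 0 < a -> 1 < r ->
  exists2 q, 0 < q < M & forall x, W x `^ a <= r -> q <= p x.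
Proof.
move=> a0 r1; have r0 : 0 < r := lt_trans ltr01 r1.
have ta0 : 0 < tau * a by rewrite mulr_gt0.
have rV0 : 0 < r^-1 by rewrite invr_gt0.
have M0 := sup_norm_gt0.
exists (M * (r^-1) `^ (tau * a)^-1).
  rewrite mulr_gt0 ?powR_gt0//= gtr_pMr//.
  have : (r^-1) `^ (tau * a)^-1 < 1 `^ (tau * a)^-1.
    apply: gt0_ltr_powR; rewrite ?nnegrE ?invr_gt0 ?(ltW rV0)//.
    by rewrite invf_lt1.
  by rewrite powR1.
move=> x; rewrite /drift_function -powRrM mulNr powRN => Wr.
have Wr' : r^-1 <= (p x / M) `^ (tau * a).
  by rewrite -[leRHS]invrK lef_pV2 ?posrE ?invr_gt0 ?powR_gt0.
rewrite mulrC -ler_pdivlMr//.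
rewrite -[leRHS]powRr1 ?(ltW (ratio_gt0 x))// -(mulfV (lt0r_neq0 ta0)) powRrM.
apply: ge0_ler_powR; rewrite ?nnegrE ?powR_ge0 ?(ltW rV0)//.
by rewrite invr_ge0 ltW.
Qed.

End drift_function_properties.

Lemma cvg_bounded_above (R : realType) (u_ : nat -> R) (l : R) :
  u_ @ \oo --> l -> exists B, forall n, u_ n <= B.
Proof.
move=> /cvgrPdist_le/(_ 1 ltr01)[N _ hN].
exists (`|l| + 1 + \sum_(k < N) `|u_ k|) => n.
have s0 : 0 <= \sum_(k < N) `|u_ k| by exact: sumr_ge0.
have [nN|Nn] := ltnP n N.
  have : `|u_ n| <= \sum_(k < N) `|u_ k|.
    by rewrite (bigD1 (Ordinal nN))//= lerDl sumr_ge0.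
  have := ler_norm (u_ n); have := normr_ge0 l; lra.
have := hN n Nn; rewrite /= ler_norml => /andP[h _].
have := ler_norm l; lra.
Qed.

Section tempered_target.
Context (R : realType) d (S : measurableType d) (mu : {measure set S -> \bar R})
  (p : {mfun S >-> R}) (hp : probability_density mu p) (T : R)
  (theta : probability S R).
Hypotheses (p0 : forall x, 0 < p x) (T1 : 1 < T).
Hypothesis htheta : has_density_proportional_to mu (fun x => p x `^ T^-1) theta.
Local Notation beta := (1 - T^-1).
Local Notation Pi := (density_probability hp).

Lemma density_probabilityE (f : S -> \bar R) : measurable_fun setT f ->
  (forall x, 0 <= f x)%E -> (\int[Pi]_x f x = \int[mu]_x (f x * (p x)%:E))%E.
Proof.
move=> mf f0; apply: integral_density => //.
by move=> x; exact: ltW.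
Qed.

(** With beta = 1 - 1/T, p^(1/T) = p^(-beta) p: relative to the target the
    tempered distribution has a density proportional to p^(-beta). The constant
    is positive since the total mass is 1. *)
Lemma tempered_density : exists2 c : R, 0 < c &
  forall h : S -> \bar R, measurable_fun setT h -> (forall x, 0 <= h x)%E ->
  (\int[theta]_x h x = \int[Pi]_x (h x * (c / p x `^ beta)%:E))%E.
Proof.
have [c hc] := htheta.
have mq (k : R) : measurable_fun setT (fun x => p x `^ k).
  exact: (measurableT_comp (@measurable_powR R k)).
have c0 : 0 < c.
  rewrite ltNge; apply/negP => c0.
  have : (theta setT <= 0)%E.
    rewrite hc// (eq_integral (fun x => - (- c * p x `^ T^-1)%:E)%E) => [|x _]; last first.
      by rewrite -EFinN mulNr opprK.
    have cq0 x : (0 <= (- c * p x `^ T^-1)%:E)%E.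
      by rewrite lee_fin mulr_ge0 ?powR_ge0// oppr_ge0.
    by rewrite integral_ge0N// oppe_le0 integral_ge0.
  by rewrite probability_setT leNgt lte_fin ltr01.
exists c => // h mh h0.
have mcq : measurable_fun setT (fun x => c * p x `^ T^-1) by exact: measurable_funM.
have cq0 x : 0 <= c * p x `^ T^-1 by rewrite mulr_ge0 ?powR_ge0// ltW.
rewrite (integral_density mcq cq0 hc mh h0).
have mV : measurable_fun setT (fun x => c / p x `^ beta).
  apply: measurable_funM => //.
  by rewrite (_ : (fun _ => _) = fun x => p x `^ (- beta))//; apply/funext => x; rewrite powRN.
rewrite density_probabilityE; last 2 first.
- by apply: emeasurable_funM => //; exact/measurable_EFinP.
- by move=> x; rewrite mule_ge0// lee_fin divr_ge0 ?powR_ge0// ltW.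
apply: eq_integral => x _; rewrite -muleA -EFinM; congr (_ * _%:E)%E.
rewrite -mulrA; congr (_ * _).
have px : 0 < p x `^ beta by exact: powR_gt0.
apply: (mulfI (lt0r_neq0 px)); rewrite mulrA mulfV ?gt_eqF// mul1r.
rewrite -powRD; last by apply/implyP => _; rewrite gt_eqF.
by rewrite subrK powRr1// ltW.
Qed.

(** The density p^(-beta) of the tempered distribution relative to the target is
    bounded away from 0, as p is bounded. *)
Lemma target_moment (M : R) (W : S -> R) : 0 < M -> (forall x, p x <= M) ->
  measurable_fun setT W -> (forall x, 0 <= W x) ->
  (\int[theta]_x (W x)%:E < +oo)%E -> (\int[Pi]_x (W x)%:E < +oo)%E.
Proof.
move=> M0 pM mW W0; have [c c0 thetaE] := tempered_density.
have mW' : measurable_fun setT (fun x => (W x)%:E) by exact/measurable_EFinP.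
have W0' x : (0 <= (W x)%:E)%E by rewrite lee_fin.
have b0 : 0 <= beta by rewrite subr_ge0 invf_le1 ?(lt_trans ltr01)// ltW.
pose k := c / M `^ beta.
have k0 : 0 < k by rewrite divr_gt0 ?powR_gt0.
rewrite (thetaE _ mW' W0') => fin; rewrite ltNge leye_eq; apply/negP => /eqP E.
have : (k%:E * \int[Pi]_x (W x)%:E <= \int[Pi]_x ((W x)%:E * (c / p x `^ beta)%:E))%E.
  rewrite -ge0_integralZl_EFin// ?(ltW k0)//; apply: ge0_le_integral => //.
  - by move=> x _; rewrite mule_ge0// lee_fin ltW.
  - exact: measurable_funeM.
  - apply: emeasurable_funM => //; apply/measurable_EFinP; apply: measurable_funM => //.
    rewrite (_ : (fun _ => _) = fun x => p x `^ (- beta)).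
      exact: (measurableT_comp (@measurable_powR R (- beta))).
    by apply/funext => x; rewrite powRN.
  - move=> x _; rewrite -!EFinM lee_fin mulrC ler_wpM2l// ler_wpM2l ?(ltW c0)//.
    rewrite lef_pV2 ?posrE ?powR_gt0//; apply: ge0_ler_powR; rewrite ?nnegrE//.
    + exact: ltW.
    + exact: ltW.
by rewrite E gt0_muley ?lte_fin// leye_eq => /eqP Ey; move: fin; rewrite Ey.
Qed.

End tempered_target.

Theorem theorem3p5 (R : realType)
  (d : measure_display) (S : borelType d) (hS : polish R S)
  (mu : {measure set S -> \bar R})
  (pi : {mfun S >-> R}) (hpi : probability_density mu pi)
  (T : R) (hT : 1 < T)
  (upsilon : {i01 R}) (hupsilon : 0 < upsilon%:num < 1)
  (P : R.-pker S ~> S)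
  (theta_star : probability S R)
  (htheta_star :
    has_density_proportional_to mu (fun x => pi x `^ T^-1) theta_star)
  (dO : measure_display) (Omega : measurableType dO) (Pr : probability Omega R)
  (Y : nat -> {RV Pr >-> S})
  (hY : forall f : S -> R, continuous f -> is_bounded f ->
    {ae Pr, forall w,
      (fun n : nat => n%:R^-1 * \sum_(1 <= k < n.+1) f (Y k w)) @ \oo
        --> \int[theta_star]_x f x})
  (X : nat -> {RV Pr >-> S})
  (F : nat -> set (set Omega)) (hF : filtration F)
  (hadapted : forall n : nat,
    measurable_wrt (F n) (X n) /\
    measurable_wrt (F n)
      (fun w => empirical R (fun k => Y k w) n : pprobability S R))
  (htransition : forall (n : nat) (f : S -> R),
    measurable_fun setT f -> is_bounded f ->
    is_conditional_expectation Pr (F n)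
      (fun w => f (X n.+1 w))
      (fun w => \int[tempering_kernel upsilon P pi (1 - T^-1)
                       (empirical R (fun k => Y k w) n) (X n w)]_y f y))
  (hI1 : [/\ continuous pi, forall x, 0 < pi x & is_bounded pi])
  (hI2a : [/\ kernel_irreducible (density_distribution mu pi) P,
              kernel_aperiodic (density_distribution mu pi) P,
              kernel_feller P & kernel_invariant P mu pi])
  (tau lambda b : R) (htau : 0 < tau < T^-1) (hlambda : 0 < lambda < 1)
  (hI2b : forall x,
    (\int[P x]_y (drift_function pi tau y)%:E
       <= (lambda * drift_function pi tau x + b)%:E)%E)
  (hI2c : forall p : R, 0 < p < sup_norm pi ->
    one_small P [set x | p <= pi x])
  (hI3a_moment : (\int[theta_star]_x (drift_function pi tau x)%:E < +oo)%E)
  (hI3a_lln : forall f : S -> R, continuous f ->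
    finite_weighted_norm (drift_function pi tau) f ->
    {ae Pr, forall w,
      (fun n => empirical_mean (fun k => Y k w) n f) @ \oo
        --> \int[theta_star]_x f x})
  (hI3b : (ereal_sup (range (fun n : nat =>
             'E_Pr[fun w => drift_function pi tau (Y n w)])) < +oo)%E)
  (hX0 : ('E_Pr[fun w => drift_function pi tau (X 0%N w)] < +oo)%E) :
  (forall A : set S, measurable A ->
     density_distribution mu pi (boundary A) = 0%E ->
     {ae Pr, forall w,
       (fun n : nat => n%:R^-1 * \sum_(0 <= k < n) \1_A (X k w)) @ \oo
         --> \int[mu]_(x in A) pi x}) /\
  (forall (a : R) (f : S -> R), 0 < a < 1 -> continuous f ->
     finite_weighted_norm (fun x => drift_function pi tau x `^ a) f ->
     {ae Pr, forall w,
       (fun n : nat => n%:R^-1 * \sum_(0 <= k < n) f (X k w)) @ \oo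
         --> \int[mu]_x (f x * pi x)}).
Proof.
have [cpi pi0 bpi] := hI1.
have [_ _ PF Pinv] := hI2a.
have /andP[tau0 tauT] := htau; have /andP[lam0 lam1] := hlambda.
have T0 : 0 < T := lt_trans ltr01 hT.
have beta0 : 0 <= 1 - T^-1 by rewrite subr_ge0 invf_le1// ltW.
pose M := sup_norm pi; pose W := drift_function pi tau.
have pM x : pi x <= M by exact: le_sup_norm.
have M0 : 0 < M by exact: (sup_norm_gt0 point pi0 bpi).
have W1 x : 1 <= W x by exact: (drift_function_ge1 point pi0 bpi tau0).
have W0 x : 0 <= W x := le_trans ler01 (W1 x).
have cW : continuous W by exact: (continuous_drift_function point pi0 bpi cpi).
have mW := continuous_measurable_real cW.
pose Pi : probability S R := density_probability hpi.
have mP A : measurable A -> measurable_fun setT (P ^~ A) by exact: measurable_kernel.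
have PiP A : measurable A -> (\int[Pi]_x P x A = Pi A)%E.
  move=> mA; rewrite density_probabilityE//; last exact: mP.
  exact: Pinv.
have [c c0 thetaE] := tempered_density hpi pi0 htheta_star.
have PiW := target_moment hpi pi0 hT htheta_star M0 pM mW W0 hI3a_moment.
pose BT := fine (\int[theta_star]_x (W x)%:E)%E.
have thW0 : (0 <= \int[theta_star]_x (W x)%:E)%E.
  by apply: integral_ge0 => x _; rewrite lee_fin.
have thW : (\int[theta_star]_x (W x)%:E <= BT%:E)%E.
  by rewrite fineK// ge0_fin_numE.
have drift x : (\int[P x]_y (W y)%:E <= (lambda * W x + `|b|)%:E)%E.
  by apply: (le_trans (hI2b x)); rewrite lee_fin lerD2l ler_norm.
have lam01 : 0 <= lambda < 1 by rewrite (ltW lam0).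
have lln (f : S -> R) (c' : R) : continuous f -> (forall x, `|f x| <= c') ->
    {ae Pr, forall w, (fun n => empirical_mean (fun k => Y k w) n f) @ \oo
      --> \int[theta_star]_x f x}.
  move=> cf fc; apply: hI3a_lln => //; exists c' => _ [x _ <-].
  by rewrite ler_pdivrMr ?(lt_le_trans ltr01 (W1 x))// (le_trans (fc x))// ler_peMr// (le_trans _ (fc x)).
have empB : {ae Pr, forall w, exists B : R, forall n,
    empirical_mean (fun k => Y k w) n W <= B}.
  have hW : finite_weighted_norm W W.
    by exists 1 => _ [x _ <-]; rewrite ger0_norm// divff// gt_eqF// (lt_le_trans ltr01).
  have := hI3a_lln W cW hW; apply: filterS => w; exact: cvg_bounded_above.
pose CY := fine (ereal_sup (range (fun n : nat => 'E_Pr[fun w => W (Y n w)])))%E.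
have EY n : ('E_Pr[fun w => W (Y n w)] = \int[Pr]_w (W (Y n w))%:E)%E by rewrite unlock.
have momY n : (\int[Pr]_w (W (Y n w))%:E <= CY%:E)%E.
  have le_sup : ('E_Pr[fun w => W (Y n w)]
      <= ereal_sup (range (fun n : nat => 'E_Pr[fun w => W (Y n w)])))%E.
    by apply: ereal_sup_ubound; exists n.
  rewrite /CY fineK -?EY// ge0_fin_numE//; apply: le_trans le_sup.
  by rewrite EY; apply: integral_ge0 => w _; rewrite lee_fin.
have momX : (\int[Pr]_w (W (X 0%N w))%:E < +oo)%E by move: hX0; rewrite unlock.
have adapted n := (hadapted n).1.
have smallP (a r : R) : 0 < a -> 1 < r -> one_small P [set x | W x `^ a <= r].
  move=> a0 r1; have [q qM hq] := drift_function_level point pi0 bpi tau0 a0 r1.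
  have [delta delta0 [nu hnu]] := hI2c q qM.
  by exists delta => //; exists nu => x Wx; apply: hnu; exact: hq.
have level (a r : R) : 0 < a -> exists2 q, 0 < q & forall x, W x `^ a <= r -> q <= pi x.
  move=> a0; have r1 : 1 < maxr r 2 by rewrite lt_max ltr1n orbT.
  have [q /andP[q0 _] hq] := drift_function_level point pi0 bpi tau0 a0 r1.
  by exists q => // x Wx; apply: hq; rewrite le_max Wx.
have invPi (f : S -> R) (c' : R) : measurable_fun setT f -> (forall x, `|f x| <= c') ->
    measurable_fun setT (kernel_act (tempering_kernel upsilon P pi (1 - T^-1) theta_star) f) ->
    \int[Pi]_x kernel_act (tempering_kernel upsilon P pi (1 - T^-1) theta_star) f x
      = \int[Pi]_x f x.
  exact: (tempering_invariant pi0 (ltW c0) PiP thetaE).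
have PiV (a : R) : a < 1 -> (\int[Pi]_x (W x `^ a)%:E < +oo)%E.
  move=> a1; apply: le_lt_trans PiW; apply: ge0_le_integral => //.
  - by move=> x _; rewrite lee_fin powR_ge0.
  - by apply/measurable_EFinP; exact: (measurableT_comp (@measurable_powR R a)).
  - exact/measurable_EFinP.
  - by move=> x _; rewrite lee_fin -[leRHS]powRr1// ler_powR// ltW.
have half_pos (a : R) : 2^-1 <= a < 1 -> 0 < a.
  by move=> /andP[a2 _]; apply: lt_le_trans a2; rewrite invr_gt0.
have target_lln (f : S -> R) (c' : R) : continuous f -> (forall x, `|f x| <= c') ->
    {ae Pr, forall w, time_average (fun k => f (X k w)) @ \oo --> \int[Pi]_x f x}.
  have a_itv : 2^-1 <= (2^-1 : R) < 1 by rewrite lexx invf_lt1// ltr1n.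
  have a0 := half_pos 2^-1 a_itv; have /andP[_ a1] := a_itv.
  exact: (bounded_continuous_lln hF hupsilon adapted htransition mW W1 lam01
    (normr_ge0 b) drift momY momX cpi pi0 beta0 pM PF lln empB thW a_itv
    (fun r => smallP _ r a0) (fun r => level _ r a0) invPi (PiV _ a1)).
have [_ [dist hdist]] := hS.
split=> [A mA dA0|a0 f /andP[a00 a01] cf fW].
  have := set_lln target_lln hdist mA dA0; apply: filterS => w.
  have -> : (fun n : nat => n%:R^-1 * \sum_(0 <= k < n) \1_A (X k w)) =
      time_average (fun k => \1_A (X k w) : R).
    by apply/funext => n; rewrite big_mkord.
  exact.
pose a := (1 + a0) / 2.
have a_itv : 2^-1 <= a < 1.
  by rewrite /a -[leLHS]mul1r ler_pM2r ?invr_gt0// lerDl ltW//= ltr_pdivrMr//; lra.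
have a0a : 0 < a0 < a by rewrite a00/= /a ltr_pdivlMr//; lra.
have [B hB] := fW.
have C0 : 0 < maxr B 1 by rewrite lt_max ltr01 orbT.
have fB x : `|f x| <= maxr B 1 * W x `^ a0.
  rewrite -ler_pdivrMr; last by rewrite powR_gt0// (lt_le_trans ltr01).
  by rewrite le_max (hB _ _)//; exists x.
have aeV := ae_power_average_bound hF hupsilon adapted htransition mW W1 lam01
  (normr_ge0 b) drift momY momX a_itv empB.
have /andP[_ a1] := a_itv.
have := weighted_lln target_lln mW W1 a0a C0 (PiV _ a1) aeV cf fB.
rewrite (@Rintegral_density _ _ _ mu Pi pi f)//; last 2 first.
- by move=> x; exact: ltW.
- exact: continuous_measurable_real.
apply: filterS => w.
have -> : (fun n : nat => n%:R^-1 * \sum_(0 <= k < n) f (X k w)) =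
    time_average (fun k => f (X k w)).
  by apply/funext => n; rewrite big_mkord.
exact.
Qed.
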